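(* For $t\in(0,T]$, let $\mathbf u^h(t)\in\mathbb U^h$, $p^h(t)\in\mathbb P^h$, $\mathbb B^h(t)\in\mathbb S^h$ with $\mathbb B^h(t)$ positive definite, $\mathbf X^h(t)\in\mathbf V(\Gamma^h(t))$ and $\kappa^h(t)\in V(\Gamma^h(t))$ be a solution of the semi-discrete system of the context, and let the mesh assumptions of the context hold for $\Gamma^h(t)$ and $\mathcal T^h$. (i) It holds, with $W(\mathbb B)=\frac G2\operatorname{Tr}(\mathbb B-\ln\mathbb B-\mathbb I)$, $$\begin{aligned}&\frac{d}{dt}\Big(\tfrac12\|\sqrt{\rho^h}\,\mathbf u^h\|_{L^2}^2+(W(\mathbb B^h),1)^h_{\mathcal T^h}+\gamma\mathcal H^{d-1}(\Gamma^h(t))\Big)+\|\sqrt{2\mu^h}\,\mathbb D(\mathbf u^h)\|_{L^2}^2\\&\quad+\big(\tfrac{G}{2\lambda^h},\operatorname{Tr}(\mathbb B^h+[\mathbb B^h]^{-1}-2\mathbb I)\big)^h_{\mathcal T^h}+\tfrac{\alpha G}{2d}\|\nabla I^h_1\ln\det\mathbb B^h\|_{L^2}^2\le(\rho^h\mathbf f^h_1+\mathbf f^h_2,\mathbf u^h).\end{aligned}$$ (ii) For any $t\in(0,T]$, $\Gamma^h(t)$ is a conformal polyhedral hypersurface. Moreover, if $d=2$, then $\Gamma^h(t)$ is weakly equidistributed for all $t\in(0,T]$, i.e. any two neighbouring elements of the curve $\Gamma^h(t)$ have equal lengths or are parallel.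
   Context: **Domain, parameters, notation.** $d\in\{2,3\}$, $T>0$; $\Omega\subset\mathbb R^d$ is a bounded Lipschitz domain with polygonal (polyhedral) boundary and outer unit normal $\mathbf n$; $\partial_D\Omega\subset\partial\Omega$ is closed with positive surface measure, $\partial_N\Omega=\partial\Omega\setminus\partial_D\Omega$; $H^1_D(\Omega;\mathbb R^d)=\{\mathbf z\in H^1(\Omega;\mathbb R^d):\mathbf z=\mathbf 0\text{ on }\partial_D\Omega,\ \mathbf z\cdot\mathbf n=0\text{ on }\partial_N\Omega\}$. Constants $\rho_\pm,\mu_\pm,\lambda_\pm,G,\gamma>0$, $\alpha\ge0$; $\mathbf f_1,\mathbf f_2\in C([0,T];C(\overline\Omega;\mathbb R^d))$. $\mathbb R^{d\times d}_S$: symmetric matrices; $\mathbb I$: identity matrix; $:$ Frobenius product; $(\nabla\mathbf u)_{ij}=\partial_{x_j}u_i$; $\mathbb D(\mathbf u)=\frac12(\nabla\mathbf u+(\nabla\mathbf u)^\top)$. Scalar functions act on symmetric matrices through the spectrum. $(\cdot,\cdot)$: $L^2(\Omega)$ inner product; $\mathcal H^{d-1}$: Hausdorff measure. **Bulk mesh and spaces.** $\mathcal T^h$ is a fixed regular partitioning of $\Omega$ into disjoint open simplices, matching $\partial_D\Omega$ exactly by its sides. $\mathcal S^h_k$ ($k\ge1$): continuous piecewise polynomials of degree $\le k$ on $\mathcal T^h$; $\mathcal S^h_0$: piecewise constants; $I^h_k$ ($k\ge1$): nodal interpolation into $\mathcal S^h_k$ (entrywise). $\mathbb S^h=[\mathcal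 S^h_1]^{d\times d}_S$; $\mathbb U^h\subset H^1_D(\Omega;\mathbb R^d)$ a finite-dimensional space of continuous piecewise polynomials on $\mathcal T^h$; $\mathbb P^h\subset L^2(\Omega)$ a finite-dimensional pressure space with $\mathcal S^h_1\subset\mathbb P^h$. $\mathbf f^h_i(t)=I^h_2\mathbf f_i(t)$. Mass lumping: $(a,b)^h_{\mathcal T^h}=\frac1{d+1}\sum_{K\in\mathcal T^h}|K|\sum_{k=0}^d\lim_{K\ni\mathbf p\to\mathbf p^K_k}a(\mathbf p)b(\mathbf p)$, $\mathbf p^K_k$ the vertices of $K$ (with $:$ for matrices). **Interface.** For each $t$, $\Gamma^h(t)$ is a closed polyhedral hypersurface without self-intersections, a union of closures of $(d-1)$-simplices $\sigma\in\mathcal T(\Gamma^h(t))$ without hanging vertices; $\Omega^h_-(t)$, $\Omega^h_+(t)$ are its interior and exterior in $\Omega$; $\pmb\nu^h(t)$ is the piecewise constant unit normal pointing into $\Omega^h_+(t)$; $\nabla_s$ the surface gradient. $V(\Gamma^h(t))$: continuous functions on $\Gamma^h(t)$ affine on each $\sigma$; $\mathbf V(\Gamma^h(t))=[V(\Gamma^h(t))]^d$. $\mathbf X^h(t)=\mathbf{id}|_{\Gamma^h(t)}\in\mathbf V(\Gamma^h(t))$ describes the interface, and $\partial_t\mathbf X^h\in\mathbf V(\Gamma^h(t))$ is the piecewise linear function whose value at each vertex is the velocity of that vertex. $\langle\cdot,\cdot\rangle_{\Gamma^h(t)}$: $L^2(\Gamma^h(t))$ inner product; $\langle a,b\rangle^h_{\Gamma^h(t)}=\frac1d\sum_\sigma|\sigma|\sum_{k=0}^{d-1}\lim_{\sigma\ni\mathbf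 q\to\mathbf q^\sigma_k}a(\mathbf q)b(\mathbf q)$, $\mathbf q^\sigma_k$ the vertices of $\sigma$. $\rho^h(t)\in\mathcal S^h_0$ equals $\rho_-$ on $K\subset\Omega^h_-(t)$, $\rho_+$ on $K\subset\Omega^h_+(t)$, $\frac12(\rho_-+\rho_+)$ on $K$ with $K\cap\Gamma^h(t)\neq\emptyset$; $\mu^h,\lambda^h$ analogously. A polyhedral hypersurface $\Gamma^h$ is called *conformal* if there is $\kappa\in V(\Gamma^h)$ with $\langle\kappa\,\pmb\nu^h,\pmb\zeta\rangle^h_{\Gamma^h}+\langle\nabla_s\mathbf{id},\nabla_s\pmb\zeta\rangle_{\Gamma^h}=0$ for all $\pmb\zeta\in\mathbf V(\Gamma^h)$. **The tensor $\mathbf\Lambda_{i,j}$.** For $K\in\mathcal T^h$ with vertices $\mathbf p^K_0,\dots,\mathbf p^K_d$ let $\mathcal A_K$ be the matrix such that $\hat{\mathbf x}\mapsto\mathbf p^K_0+\mathcal A_K\hat{\mathbf x}$ maps the reference simplex (vertices: origin and standard basis vectors) to $K$, $i$-th vertex to $\mathbf p^K_i$. For $\mathbb B\in\mathbb S^h$ positive definite let $\mathbb B^K_i=\mathbb B(\mathbf p^K_i)$ and, for $i=1,\dots,d$, $\hat{\mathbf\Lambda}_i=\mathbb B^K_i$ if $\mathbb B^K_i=\mathbb B^K_0$, and otherwise $\hat{\mathbf\Lambda}_i=\mathbb B^K_i+\lambda_i(\mathbb B^K_0-\mathbb B^K_i)$ with $$\lambda_i=\frac{\operatorname{Tr}\ln(\mathbb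 B^K_i)^{-1}-\operatorname{Tr}\ln(\mathbb B^K_0)^{-1}+\mathbb B^K_i:(-(\mathbb B^K_i)^{-1}+(\mathbb B^K_0)^{-1})}{(\mathbb B^K_i-\mathbb B^K_0):(-(\mathbb B^K_i)^{-1}+(\mathbb B^K_0)^{-1})}.$$ Then $\mathbf\Lambda_{i,j}(\mathbb B)|_K=\sum_{m=1}^d[(\mathcal A_K^\top)^{-1}]_{i,m}\hat{\mathbf\Lambda}_m[\mathcal A_K^\top]_{m,j}$. **Semi-discrete system.** Given $\Gamma^h(0)$, $\mathbf u^h(0)\in\mathbb U^h$, $\mathbb B^h(0)\in\mathbb S^h$ positive definite, find for all $t\in(0,T]$ $\mathbf u^h(t)\in\mathbb U^h$, $p^h(t)\in\mathbb P^h$, $\mathbb B^h(t)\in\mathbb S^h$ positive definite, $\mathbf X^h(t)\in\mathbf V(\Gamma^h(t))$, $\kappa^h(t)\in V(\Gamma^h(t))$ such that, for all $t$ and all (time-dependent) test functions $(\mathbf w,q,\mathbb G,\pmb\zeta,\chi)\in\mathbb U^h\times\mathbb P^h\times\mathbb S^h\times\mathbf V(\Gamma^h(t))\times V(\Gamma^h(t))$ (all occurring time derivatives being assumed to exist), $$\begin{aligned}0={}&\tfrac{d}{dt}\tfrac12(\rho^h\mathbf u^h,\mathbf w)+\tfrac12(\rho^h\partial_t\mathbf u^h,\mathbf w)-\tfrac12(\rho^h\mathbf u^h,\partial_t\mathbf w)+\tfrac12(\rho^h,[(\mathbf u^h\cdot\nabla)\mathbf u^h]\cdot\mathbf w)-\tfrac12(\rho^h,\mathbf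 u^h\cdot[(\mathbf u^h\cdot\nabla)\mathbf w])\\&+(2\mu^h\mathbb D(\mathbf u^h),\mathbb D(\mathbf w))-(p^h,\operatorname{div}\mathbf w)+G(\mathbb B^h-\mathbb I,\nabla\mathbf w)-\gamma\langle\kappa^h\pmb\nu^h,\mathbf w\rangle_{\Gamma^h(t)}-(\rho^h\mathbf f^h_1+\mathbf f^h_2,\mathbf w),\\ 0={}&(\operatorname{div}\mathbf u^h,q),\\ 0={}&\tfrac{d}{dt}(\mathbb B^h,\mathbb G)^h_{\mathcal T^h}-(\mathbb B^h,\partial_t\mathbb G)^h_{\mathcal T^h}-\sum_{i,j=1}^d([\mathbf u^h]_i\mathbf\Lambda_{i,j}(\mathbb B^h),\partial_{x_j}\mathbb G)+(\tfrac1{\lambda^h}(\mathbb B^h-\mathbb I),\mathbb G)^h_{\mathcal T^h}\\&-2(\nabla\mathbf u^h,I^h_1[\mathbb G\mathbb B^h])+\alpha(\nabla\mathbb B^h,\nabla\mathbb G),\\ 0={}&\langle\kappa^h\pmb\nu^h,\pmb\zeta\rangle^h_{\Gamma^h(t)}+\langle\nabla_s\mathbf X^h,\nabla_s\pmb\zeta\rangle_{\Gamma^h(t)},\\ 0={}&\langle\partial_t\mathbf X^h\cdot\pmb\nu^h,\chi\rangle^h_{\Gamma^h(t)}-\langle\mathbf u^h\cdot\pmb\nu^h,\chi\rangle_{\Gamma^h(t)}.\end{aligned}$$ **Mesh assumptions.** $\mathcal H^{d-1}(\sigma)>0$ for all $\sigma\in\mathcal T(\Gamma^h(t))$, $\Gamma^h(t)\subset\overline\Omega$.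 With $\mathbf q_k$, $k=1,\dots,\mathcal K$, the vertices of $\Gamma^h(t)$, $\Xi_k=\{\sigma:\mathbf q_k\in\overline\sigma\}$, $\Theta_k=\bigcup_{\sigma\in\Xi_k}\overline\sigma$, $\pmb\omega_k=\frac1{\mathcal H^{d-1}(\Theta_k)}\sum_{\sigma\in\Xi_k}\mathcal H^{d-1}(\sigma)\pmb\nu^h|_\sigma$, it holds $\dim\operatorname{span}\{\pmb\omega_1,\dots,\pmb\omega_{\mathcal K}\}=d$. If $\alpha>0$, all simplices of $\mathcal T^h$ are non-obtuse (all dihedral angles $\le\pi/2$). *)

(* Defs.v *)
From HB Require Import structures.
From mathcomp Require Import all_boot all_order all_algebra.
From mathcomp Require Import all_classical all_reals all_analysis.

Set Implicit Arguments.
Unset Strict Implicit.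
Unset Printing Implicit Defensive.

Import Order.TTheory GRing.Theory Num.Theory.
Import numFieldNormedType.Exports.

Local Open Scope classical_set_scope.
Local Open Scope ring_scope.

(* The Lebesgue measure on [R^m], carried by the [m]-tuples (whose product
   sigma-algebra is in the library) and built by iterated products. *)
Section LebesgueStep.
Context {R : realType} {m : nat}.
Variable mu : {sigma_finite_measure set (m.-tuple (measurableTypeR R)) -> \bar R}.

Definition tcons (x : measurableTypeR R * m.-tuple (measurableTypeR R)) :
  m.+1.-tuple (measurableTypeR R) := [tuple of x.1 :: x.2].

Lemma measurable_tcons : measurable_fun setT tcons.
Proof. exact: measurable_cons. Qed.

Let prod_mu := (@lebesgue_measure R \x mu)%E.

Definition leb_step : set (m.+1.-tuple (measurableTypeR R)) -> \bar R :=
  pushforward prod_mu tcons.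

Let leb_step_measure : {measure set (m.+1.-tuple (measurableTypeR R)) -> \bar R} :=
  @measure_function_pushforward__canonical__measure_function_Measure
    _ _ _ _ _ [the measure _ _ of prod_mu] tcons measurable_tcons.

HB.instance Definition _ := isMeasure.Build _ _ _ leb_step
  (measure0 leb_step_measure) (measure_ge0 leb_step_measure)
  (@measure_semi_sigma_additive _ _ _ leb_step_measure).

Lemma leb_step_sigma_finite : sigma_finite setT leb_step.
Proof.
have /sigma_finiteP[F [TF ndF Foo]] := sigma_finiteT (@lebesgue_measure R).
have /sigma_finiteP[G [TG ndG Goo]] := sigma_finiteT mu.
pose g (t : m.+1.-tuple (measurableTypeR R)) := (thead t, [tuple of behead t]).
have gK : cancel tcons g.
  by move=> [x t]; rewrite /g /tcons theadE; congr pair; apply/val_inj.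
have mg : measurable_fun setT g.
  apply/measurable_fun_pairP; split; first exact: measurable_tnth.
  exact: measurable_behead.
exists (fun i => g @^-1` (F i `*` G i)).
  rewrite -preimage_bigcup (_ : \bigcup_i _ = setT)// predeqE => -[x y]; split => // _.
  have [n _ Fnx] : (\bigcup_i F i) x by rewrite -TF.
  have [k _ Gky] : (\bigcup_i G i) y by rewrite -TG.
  exists (maxn n k) => //; split.
  - by move: x Fnx; exact/subsetPset/ndF/leq_maxl.
  - by move: y Gky; exact/subsetPset/ndG/leq_maxr.
move=> i; have [mF Fi] := Foo i; have [mG Gi] := Goo i; split.
  by rewrite -[X in measurable X]setTI; apply: mg => //; exact: measurableX.
rewrite /leb_step /pushforward -comp_preimage (_ : g \o tcons = id); last first.
  by apply/funext => x; exact: gK.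
by rewrite preimage_id /prod_mu product_measure1E// lte_mul_pinfty// ge0_fin_numE.
Qed.

HB.instance Definition _ :=
  Measure_isSigmaFinite.Build _ _ _ leb_step leb_step_sigma_finite.
End LebesgueStep.

Fixpoint leb {R : realType} m :
    {sigma_finite_measure set (m.-tuple (measurableTypeR R)) -> \bar R} :=
  if m is m'.+1 then @leb_step R m' (leb m') else \d_ [tuple].

Definition cvec {R : realType} {m} (t : m.-tuple (measurableTypeR R)) :
  'cV[R]_m := \col_i tnth t i.

Definition Lint {R : realType} {m} (D : set 'cV[R]_m) (f : 'cV[R]_m -> R) : R :=
  \int[leb m]_(t in cvec @^-1` D) f (cvec t).

Definition vol {R : realType} {m} (D : set 'cV[R]_m) : R :=
  fine (leb m (cvec @^-1` D)).

Section Algebra.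
Context {R : realType}.

Definition frob {p q} (A B : 'M[R]_(p, q)) : R :=
  \sum_i \sum_j A i j * B i j.

Definition posdef {p} (A : 'M[R]_p) : Prop :=
  A^T = A /\ forall x : 'cV[R]_p, x != 0 -> 0 < frob x (A *m x).

(* [f] acting on a symmetric matrix through its spectrum. *)
Definition specfun {p} (f : R -> R) (A : 'M[R]_p) : 'M[R]_p :=
  xget 0 [set B | exists (Q : 'M[R]_p) (l : 'rV[R]_p),
    [/\ Q *m Q^T = 1%:M, A = Q^T *m diag_mx l *m Q
      & B = Q^T *m diag_mx (map_mx f l) *m Q]].

Definition mxln {p} (A : 'M[R]_p) : 'M[R]_p := specfun (@ln R) A.

Definition fin_dim {T : Type} {V : lmodType R} (U : set (T -> V)) : Prop :=
  exists N (e : 'I_N -> T -> V),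
    U = [set f | exists c : 'I_N -> R, f = fun x => \sum_k c k *: e k x].

End Algebra.

Section TimeDerivative.
Context {R : realType} {V : normedModType R}.

(* Time derivatives are taken relative to [0, T], hence one-sided at [T]. *)
Definition tquot (T : R) (f : R -> V) (t : R) : set_system V :=
  (s - t)^-1 *: (f s - f t) @[s --> within `[0, T] t^'].

Definition has_ddt T f t (l : V) : Prop := tquot T f t --> l.
Definition ex_ddt T f t : Prop := cvg (tquot T f t).
Definition ddt T f t : V := lim (tquot T f t).

End TimeDerivative.

Section Calculus.
Context {R : realType} {d : nat}.

Definition pd {V : normedModType R} (j : 'I_d) (f : 'cV[R]_d -> V) x : V :=
  'D_(delta_mx j 0) f x.

Definition grad (u : 'cV[R]_d -> 'cV[R]_d) x : 'M[R]_d :=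
  \matrix_(i, j) pd j u x i 0.

Definition symgrad u x : 'M[R]_d := 2^-1 *: (grad u x + (grad u x)^T).

Definition divg u x : R := \tr (grad u x).

Definition poly_on (D : set 'cV[R]_d) (k : nat) (f : 'cV[R]_d -> R) : Prop :=
  exists N (c : 'I_N -> R) (a : 'I_N -> 'I_d -> nat),
    (forall m, (\sum_i a m i <= k)%N) /\
    forall x, D x -> f x = \sum_m c m * \prod_i x i 0 ^+ a m i.

End Calculus.

Section Simplices.
Context {R : realType} {d m : nat}.
Implicit Types v : 'I_m.+1 -> 'cV[R]_d.

Definition edges v : 'M[R]_(d, m) :=
  \matrix_(i, j) (v (lift ord0 j) i 0 - v ord0 i 0).

Definition face v (J : {set 'I_m.+1}) : set 'cV[R]_d :=
  [set x | exists l : 'I_m.+1 -> R,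
    [/\ forall k, 0 <= l k, forall k, k \notin J -> l k = 0,
        \sum_k l k = 1 & x = \sum_k l k *: v k]].

Definition csimplex v : set 'cV[R]_d := face v [set: 'I_m.+1]%SET.

Definition osimplex v : set 'cV[R]_d :=
  [set x | exists l : 'I_m.+1 -> R,
    [/\ forall k, 0 < l k, \sum_k l k = 1 & x = \sum_k l k *: v k]].

(* The [m]-dimensional Hausdorff measure of the simplex [v], and the integral
   over [v] against that measure, both by the affine parametrization of [v]
   over the reference simplex. *)
Definition gram v : R := Num.sqrt (\det ((edges v)^T *m edges v)).

Definition area v : R := gram v / m`!%:R.

Definition surf_int v (f : 'cV[R]_d -> R) : R :=
  gram v * Lint [set s : 'cV[R]_m | (forall i, 0 < s i 0) /\ \sum_i s i 0 < 1]
    (fun s => f (v ord0 + edges v *m s)).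

(* Surface gradient on the flat simplex [v]: with [E := edges v] and
   [g := E^T E], it is [\sum_(j, k) g^-1 j k (d_(E k) f) (E j)]. *)
Definition sgrad v (f : 'cV[R]_d -> R) x : 'cV[R]_d :=
  edges v *m invmx ((edges v)^T *m edges v) *m
    \col_j 'D_(col j (edges v)) f x.

Definition sgradv v (z : 'cV[R]_d -> 'cV[R]_d) x : 'M[R]_d :=
  \matrix_(i, j) sgrad v (fun y => z y i 0) x j 0.

End Simplices.

Section Bulk.
Context {R : realType} {n : nat}.
Local Notation d := n.+1.
Local Notation pt := 'cV[R]_d.

Definition boundary (Om : set pt) : set pt := closure Om `\` Om.

(* Near each boundary point, [Om] is the strict subgraph of a Lipschitz
   function over the hyperplane orthogonal to some unit vector [e]. *)
Definition lipschitz_domain (Om : set pt) : Prop :=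
  [/\ [/\ Om !=set0, open Om, connected Om & bounded_set Om] &
    forall x, boundary Om x -> exists (e : pt) (g : pt -> R) (L : R),
      [/\ frob e e = 1, forall y z, `|g y - g z| <= L * `|y - z| &
        \forall z \near x, Om z <-> frob e z < g (z - frob e z *: e)]].

Definition polyhedral_boundary (Om : set pt) : Prop :=
  exists N (a : 'I_N -> pt) (b : 'I_N -> R), (forall k, a k != 0) /\
    boundary Om `<=` [set x | exists k, frob (a k) x = b k].

Record mesh := Mesh { ncell : nat; cell : 'I_ncell -> 'I_d.+1 -> pt }.

Variables (Om : set pt) (M : mesh).
Local Notation K_ := (@cell M).

Definition regular_partition : Prop :=
  [/\ forall K, \det (edges (K_ K)) != 0,
      forall K, osimplex (K_ K) `<=` Om,
      trivIset setT (fun K => osimplex (K_ K)),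
      closure Om = \bigcup_K csimplex (K_ K) &
      forall K K', csimplex (K_ K) `&` csimplex (K_ K') `<=`
        face (K_ K) [set k | [exists k', K_ K k == K_ K' k']]%SET].

(* The side of the cell [F.1] opposite to its [F.2]-th vertex. *)
Definition side (F : 'I_(ncell M) * 'I_d.+1) : 'I_d -> pt :=
  fun j => K_ F.1 (lift F.2 j).

Definition boundary_side F : Prop := csimplex (side F) `<=` boundary Om.

Definition outer_normal (v : 'I_d.+1 -> pt) (i : 'I_d.+1) (nu : pt) : Prop :=
  [/\ frob nu nu = 1,
      forall j k, j != i -> k != i -> frob nu (v j - v k) = 0 &
      forall j, j != i -> frob nu (v i - v j) < 0].

(* The mesh matches the closed set [dD] exactly by its sides. *)
Definition dirichlet_part (dD : set pt) : Prop :=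
  exists S : {set 'I_(ncell M) * 'I_d.+1},
    [/\ forall F, F \in S -> boundary_side F,
        dD = \bigcup_(F in [set` S]) csimplex (side F) &
        0 < \sum_(F in S) area (side F)].

(* Angle between the sides of [v] opposite to the vertices [i] and [j]; their
   outer normals enclose the supplementary angle. *)
Definition nonobtuse (v : 'I_d.+1 -> pt) : Prop :=
  forall i j ni nj, i != j -> outer_normal v i ni -> outer_normal v j nj ->
    acos (- frob ni nj) <= pi / 2.

Definition Sh (k : nat) : set (pt -> R) :=
  [set f | {within closure Om, continuous f} /\
           forall K, poly_on (csimplex (K_ K)) k f].

Definition lagrange_node (k : nat) (z : pt) : Prop :=
  exists K (a : 'I_d.+1 -> nat), (\sum_j a j = k)%N /\
    z = \sum_j ((a j)%:R / k%:R) *: K_ K j.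

(* Nodal interpolation into [Sh k], for [1 <= k]. Here and for all finite
   element functions only the values on [closure Om] are meaningful. *)
Definition interp (k : nat) (g : pt -> R) : pt -> R :=
  xget (fun=> 0) [set f | Sh k f /\ forall z, lagrange_node k z -> f z = g z].

Definition interp_mx (k : nat) {p q} (g : pt -> 'M[R]_(p, q)) : pt -> 'M[R]_(p, q) :=
  fun x => \matrix_(i, j) interp k (fun y => g y i j) x.

Definition SSh : set (pt -> 'M[R]_d) :=
  [set B | (forall x, closure Om x -> (B x)^T = B x) /\
           forall i j, Sh 1 (fun x => B x i j)].

Definition posdef_on (B : pt -> 'M[R]_d) : Prop :=
  forall x, closure Om x -> posdef (B x).

(* The conditions defining [H^1_D], for a function continuous on [closure Om]
   and piecewise polynomial: it is in [H^1], and its trace is its restriction. *)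
Definition H1D_conditions (dD : set pt) (z : pt -> pt) : Prop :=
  (forall x, dD x -> z x = 0) /\
  forall F nu x, boundary_side F -> outer_normal (K_ F.1) F.2 nu ->
    csimplex (side F) x -> ~ dD x -> frob (z x) nu = 0.

Definition velocity_space (dD : set pt) (U : set (pt -> pt)) : Prop :=
  fin_dim U /\ forall z, U z ->
    [/\ {within closure Om, continuous z},
        forall K, exists k, forall i, poly_on (csimplex (K_ K)) k (fun x => z x i 0) &
        H1D_conditions dD z].

Definition L2 (p : pt -> R) : Prop :=
  measurable_fun (cvec @^-1` Om) (p \o cvec) /\
  (\int[leb d]_(t in cvec @^-1` Om) ((p (cvec t)) ^+ 2)%:E < +oo)%E.

Definition ae_eq_on (f g : pt -> R) : Prop :=
  {ae leb d, forall t, Om (cvec t) -> f (cvec t) = g (cvec t)}.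

Definition pressure_space (P : set (pt -> R)) : Prop :=
  [/\ @fin_dim R pt R^o P, forall p, P p -> L2 p &
      forall f, Sh 1 f -> exists2 p, P p & ae_eq_on f p].

(* Piecewise constant functions are 0 on the (Lebesgue null) skeleton. *)
Definition pwconst {V : lmodType R} (c : 'I_(ncell M) -> V) : pt -> V :=
  fun x => \sum_K (\1_(osimplex (K_ K)) x : R) *: c K.

(* Integration over [Om], cell by cell: piecewise derivatives are only
   meaningful off the (Lebesgue null) skeleton. *)
Definition intOm (f : pt -> R) : R := \sum_K Lint (osimplex (K_ K)) f.

(* Mass lumping: [(a, b)^h] is [lump] of the product of [a] and [b]. *)
Definition lump (f : pt -> R) : R :=
  d.+1%:R^-1 * \sum_K vol (osimplex (K_ K)) *
    \sum_k lim (f p @[p --> within (osimplex (K_ K)) (nbhs (K_ K k))]).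

Definition lam_coef (Bi B0 : 'M[R]_d) : R :=
  (\tr (mxln (invmx Bi)) - \tr (mxln (invmx B0))
     + frob Bi (- invmx Bi + invmx B0))
  / frob (Bi - B0) (- invmx Bi + invmx B0).

Definition hatLambda (K : 'I_(ncell M)) (B : pt -> 'M[R]_d) (i : 'I_d) : 'M[R]_d :=
  let Bi := B (K_ K (lift ord0 i)) in let B0 := B (K_ K ord0) in
  if Bi == B0 then Bi else Bi + lam_coef Bi B0 *: (B0 - Bi).

Definition Lambda (B : pt -> 'M[R]_d) (i j : 'I_d) : pt -> 'M[R]_d :=
  pwconst (fun K => \sum_m
    ((invmx (edges (K_ K))^T) i m * ((edges (K_ K))^T) m j) *: hatLambda K B m).

(* Membership in [C([0, T]; C(closure Om; R^d))]. *)
Definition forcing (T : R) (f : R -> pt -> pt) : Prop :=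
  (forall t, 0 <= t <= T -> {within closure Om, continuous (f t)}) /\
  forall t, 0 <= t <= T -> forall e, 0 < e ->
    \forall s \near within `[0, T] (nbhs t),
      forall x, closure Om x -> `|f s x - f t x| <= e.

Definition dt {V : normedModType R} (T : R) (w : R -> pt -> V) (t : R) : pt -> V :=
  fun x => ddt T (fun s => w s x) t.

Definition time_differentiable {V : normedModType R} (T : R) (w : R -> pt -> V) : Prop :=
  forall t x, 0 < t <= T -> closure Om x -> ex_ddt T (fun s => w s x) t.

Definition test_fun {V : normedModType R} (T : R) (S : set (pt -> V)) (w : R -> pt -> V) : Prop :=
  (forall t, 0 <= t <= T -> S (w t)) /\ time_differentiable T w.

End Bulk.

Section Surface.
Context {R : realType} {n : nat}.
Local Notation d := n.+1.
Local Notation pt := 'cV[R]_d.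
Variables (nv ne : nat) (el : 'I_ne -> 'I_d -> 'I_nv) (q : 'I_nv -> pt).

Definition elt (s : 'I_ne) : 'I_d -> pt := fun j => q (el s j).

Definition Gam : set pt := \bigcup_s csimplex (elt s).

Definition vset (s : 'I_ne) : {set 'I_nv} := [set el s j | j : 'I_d]%SET.

Definition facet (s : 'I_ne) (j : 'I_d) : {set 'I_nv} :=
  [set el s i | i in [set~ j]]%SET.

(* A closed simplicial complex of dimension [d - 1], embedded in [R^d]: every
   facet of an element is shared by exactly two elements, the elements at a
   vertex are connected to each other through common facets at that vertex,
   and the elements meet only in common faces. *)
Definition closed_hypersurface : Prop :=
  [/\ [/\ forall s, injective (el s), injective vset, injective q
        & forall k, exists s, k \in vset s],
      forall s j, #|[set s' | facet s j \subset vset s']%SET| = 2,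
      forall k s s', k \in vset s -> k \in vset s' ->
        connect [rel a b | [&& k \in vset a, k \in vset b
                             & n <= #|vset a :&: vset b|]%N] s s' &
      forall s s', csimplex (elt s) `&` csimplex (elt s') `<=`
        face (elt s) [set k | el s k \in vset s']%SET].

(* [In] and [Ex] are the interior and the exterior of the surface in [R^d]; for
   a connected surface these conditions determine them as the bounded and the
   unbounded component of the complement. They are not intersected with the
   domain, so that normals make sense where the surface touches its boundary. *)
Definition separates (In Ex : set pt) : Prop :=
  [/\ open In, open Ex, In `&` Ex = set0 & In `|` Ex = ~` Gam] /\
  [/\ bounded_set In, Gam `<=` closure In & Gam `<=` closure Ex].

Definition unit_normal_into (Ex : set pt) (s : 'I_ne) (nu : pt) : Prop :=
  [/\ frob nu nu = 1, (edges (elt s))^T *m nu = 0 &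
      forall x, osimplex (elt s) x -> \forall e \near 0^'+, Ex (x + e *: nu)].

Definition VG : set (pt -> R) :=
  [set f | {within Gam, continuous f} /\
    forall s, exists a b, forall x, csimplex (elt s) x -> f x = frob a x + b].

Definition VGv : set (pt -> pt) :=
  [set z | forall i, VG (fun x => z x i 0)].

Definition intG (f : pt -> R) : R := \sum_s surf_int (elt s) f.

Definition lumpG (f : pt -> R) : R :=
  d%:R^-1 * \sum_s area (elt s) *
    \sum_k lim (f p @[p --> within (osimplex (elt s)) (nbhs (elt s k))]).

Definition areaG : R := \sum_s area (elt s).

Definition dirichletG (z w : pt -> pt) : R :=
  \sum_s surf_int (elt s) (fun x => frob (sgradv (elt s) z x) (sgradv (elt s) w x)).

Variable nu : 'I_ne -> pt.

Definition nuh (x : pt) : pt := \sum_s (\1_(osimplex (elt s)) x : R) *: nu s.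

Definition curvature_identity (kap : pt -> R) (X : pt -> pt) : Prop :=
  forall z, VGv z -> 0 = lumpG (fun x => frob (kap x *: nuh x) (z x)) + dirichletG X z.

Definition conformal : Prop := exists2 kap, VG kap & curvature_identity kap id.

Definition star (k : 'I_nv) : {set 'I_ne} := [set s | k \in vset s]%SET.

Definition omega (k : 'I_nv) : pt :=
  (\sum_(s in star k) area (elt s))^-1 *: \sum_(s in star k) area (elt s) *: nu s.

Definition surface_mesh_assumptions (Om : set pt) : Prop :=
  [/\ forall s, 0 < area (elt s), Gam `<=` closure Om &
      \rank (\matrix_(k < nv, j < d) omega k j 0) = d].

(* Two elements are parallel when their edges span the same space. *)
Definition weakly_equidistributed : Prop :=
  forall s s', s != s' -> vset s :&: vset s' != finset.set0 ->
    area (elt s) = area (elt s') \/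
    ((edges (elt s))^T == (edges (elt s'))^T)%MS.

End Surface.

Section System.
Context {R : realType} {n : nat}.
Local Notation d := n.+1.
Local Notation pt := 'cV[R]_d.

Record physics := Physics {
  rho_m : R; rho_p : R; mu_m : R; mu_p : R; lam_m : R; lam_p : R;
  modG : R; gam : R; alpha : R }.

Definition physics_ok (c : physics) : Prop :=
  [/\ [/\ 0 < rho_m c, 0 < rho_p c, 0 < mu_m c & 0 < mu_p c],
      [/\ 0 < lam_m c, 0 < lam_p c, 0 < modG c & 0 < gam c] & 0 <= alpha c].

(* The triangulated surface [Gamma^h(t)]: the vertices move, the connectivity
   is fixed. *)
Record interface := Interface {
  nvert : nat; nelt : nat; conn : 'I_nelt -> 'I_d -> 'I_nvert;
  vert : R -> 'I_nvert -> pt;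
  inside : R -> set pt; outside : R -> set pt;
  normal : R -> 'I_nelt -> pt }.

Definition interface_ok (T : R) (I : interface) : Prop :=
  forall t, 0 <= t <= T ->
    [/\ closed_hypersurface (@conn I) (@vert I t),
        separates (@conn I) (@vert I t) (inside I t) (outside I t) &
        forall s, unit_normal_into (@conn I) (@vert I t) (outside I t) s
                    (@normal I t s)].

Variables (T : R) (Om : set pt) (M : @mesh R n) (c : physics).
Variables (f1 f2 : R -> pt -> pt) (I : interface).

Local Notation el := (@conn I).
Local Notation q := (@vert I).
Local Notation nu t := (@nuh R n _ _ el (q t) (@normal I t)).

Definition phase (am ap : R) (t : R) : pt -> R :=
  @pwconst R n M R^o (fun K =>
    if `[< osimplex (@cell _ _ M K) `<=` Om `&` inside I t >] then am
    else if `[< osimplex (@cell _ _ M K) `<=` Om `&` outside I t >] then ap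
    else (am + ap) / 2).

Definition rhoh := phase (rho_m c) (rho_p c).
Definition muh := phase (mu_m c) (mu_p c).
Definition lamh := phase (lam_m c) (lam_p c).

Definition loadh (t : R) : pt -> pt := fun x =>
  rhoh t x *: interp_mx Om M 2 (f1 t) x + interp_mx Om M 2 (f2 t) x.

Definition kinetic (u w : R -> pt -> pt) (s : R) : R :=
  intOm M (fun x => frob (rhoh s x *: u s x) (w s x)).

Local Notation ip f := (intOm M f).
Local Notation lp f := (lump M f).

Definition momentum_eq (u : R -> pt -> pt) (p : R -> pt -> R)
    (B : R -> pt -> 'M[R]_d) (kap : R -> pt -> R)
    (w : R -> pt -> pt) (t : R) : Prop :=
  0 = ddt T (fun s => 2^-1 * kinetic u w s : R^o) t
    + 2^-1 * ip (fun x => frob (rhoh t x *: dt T u t x) (w t x))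
    - 2^-1 * ip (fun x => frob (rhoh t x *: u t x) (dt T w t x))
    + 2^-1 * ip (fun x => rhoh t x * frob (grad (u t) x *m u t x) (w t x))
    - 2^-1 * ip (fun x => rhoh t x * frob (u t x) (grad (w t) x *m u t x))
    + ip (fun x => frob ((2 * muh t x) *: symgrad (u t) x) (symgrad (w t) x))
    - ip (fun x => p t x * divg (w t) x)
    + modG c * ip (fun x => frob (B t x - 1%:M) (grad (w t) x))
    - gam c * intG el (q t) (fun x => frob (kap t x *: nu t x) (w t x))
    - ip (fun x => frob (loadh t x) (w t x)).

Definition tensor_eq (u : R -> pt -> pt) (B GG : R -> pt -> 'M[R]_d) (t : R) : Prop :=
  0 = ddt T (fun s => lp (fun x => frob (B s x) (GG s x)) : R^o) t
    - lp (fun x => frob (B t x) (dt T GG t x))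
    - \sum_i \sum_j
        ip (fun x => frob (u t x i 0 *: Lambda M (B t) i j x) (pd j (GG t) x))
    + lp (fun x => frob ((lamh t x)^-1 *: (B t x - 1%:M)) (GG t x))
    - 2 * ip (fun x => frob (grad (u t) x)
                 (interp_mx Om M 1 (fun y => GG t y *m B t y) x))
    + alpha c * ip (fun x => \sum_j frob (pd j (B t) x) (pd j (GG t) x)).

(* [dX t] is the piecewise affine function on [Gamma^h(t)] whose value at each
   vertex is the velocity of that vertex; [X^h(t)] is the identity. A test
   function is required to be differentiable in time, and the time derivatives
   of the pairings with it are part of what a solution provides. *)
Record solution (U : set (pt -> pt)) (P : set (pt -> R))
    (u : R -> pt -> pt) (p : R -> pt -> R) (B : R -> pt -> 'M[R]_d)
    (kap : R -> pt -> R) (dX : R -> pt -> pt) : Prop := Solution {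
  sol_u : forall t, 0 <= t <= T -> U (u t);
  sol_B : forall t, 0 <= t <= T -> SSh Om M (B t) /\ posdef_on Om (B t);
  sol_p : forall t, 0 < t <= T -> P (p t);
  sol_kap : forall t, 0 < t <= T -> VG el (q t) (kap t);
  sol_du : time_differentiable Om T u;
  sol_dB : time_differentiable Om T B;
  sol_dX : forall t, 0 < t <= T -> VGv el (q t) (dX t) /\
    forall k, has_ddt T (fun s => q s k) t (dX t (q t k));
  sol_momentum : forall t w, 0 < t <= T -> test_fun Om T U w ->
    ex_ddt T (kinetic u w : R -> R^o) t /\ momentum_eq u p B kap w t;
  sol_div : forall t r, 0 < t <= T -> P r ->
    0 = ip (fun x => divg (u t) x * r x);
  sol_tensor : forall t GG, 0 < t <= T -> test_fun Om T (SSh Om M) GG ->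
    ex_ddt T (fun s => lp (fun x => frob (B s x) (GG s x)) : R^o) t /\
    tensor_eq u B GG t;
  sol_curvature : forall t, 0 < t <= T ->
    curvature_identity el (q t) (@normal I t) (kap t) id;
  sol_kinematic : forall t chi, 0 < t <= T -> VG el (q t) chi ->
    0 = lumpG el (q t) (fun x => frob (dX t x) (nu t x) * chi x)
        - intG el (q t) (fun x => frob (u t x) (nu t x) * chi x) }.

Definition elastic_density (A : 'M[R]_d) : R :=
  modG c / 2 * \tr (A - mxln A - 1%:M).

Definition energy (u : R -> pt -> pt) (B : R -> pt -> 'M[R]_d) (t : R) : R :=
  2^-1 * ip (fun x => let z := Num.sqrt (rhoh t x) *: u t x in frob z z)
  + lp (fun x => elastic_density (B t x))
  + gam c * areaG el (q t).

Definition viscous_dissipation (u : R -> pt -> pt) (t : R) : R :=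
  ip (fun x => let D := Num.sqrt (2 * muh t x) *: symgrad (u t) x in frob D D).

Definition relaxation_dissipation (B : R -> pt -> 'M[R]_d) (t : R) : R :=
  lp (fun x => modG c / (2 * lamh t x) *
    \tr (B t x + invmx (B t x) - 2 *: 1%:M)).

Definition stress_diffusion (B : R -> pt -> 'M[R]_d) (t : R) : R :=
  let L := interp Om M 1 (fun x => ln (\det (B t x))) in
  alpha c * modG c / (2 * d%:R) * ip (fun x => \sum_j (pd j (L : pt -> R^o) x) ^+ 2).

End System.

(* Main.v *)
(* Testing the momentum equation with the velocity, the tensor equation with the
   nodal interpolant of [G / 2 (1 - B^-1)], the curvature equation with the
   velocity of the interface and the kinematic equation with the curvature, and
   adding up, gives the energy law, once two terms are understood.

   Transport: by the choice of [Lambda] the convective term is [G / 2] times the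
   integral of [u . grad L], where [L] interpolates [ln (det B)]. Since [L] is
   almost everywhere a pressure function, the integral of [L div u] vanishes; by
   the divergence theorem on each cell, and because the fluxes cancel on interior
   facets and vanish on the boundary, so does the integral of [div (L u)].

   Diffusion: on a non-obtuse simplex the gradients of distinct barycentric
   coordinates have nonpositive products, which reduces the claim to the bound
   [(ln det A - ln det B)^2 <= d (A - B) : (B^-1 - A^-1)] for pairs of nodes.

   Equidistribution follows from the curvature equation tested with a hat function
   at the vertex shared by two neighbouring segments. *)

From mathcomp Require Import all_fingroup.
Require Import Defs.
From HB Require Import structures.
From mathcomp Require Import all_boot all_order all_algebra.
From mathcomp Require Import all_classical all_reals all_analysis.
From mathcomp Require complex.
From mathcomp Require Import measurable_realfun ring lra.

Set Implicit Arguments.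
Unset Strict Implicit.
Unset Printing Implicit Defensive.

Import Order.TTheory GRing.Theory Num.Theory.
Import numFieldNormedType.Exports.

Local Open Scope classical_set_scope.
Local Open Scope ring_scope.

(** * Affine changes of variables for the iterated Lebesgue measure *)

(** The test matrix [G / 2 (1 - B^-1)] is the derivative of the elastic density. Paired with the
    time derivative of [B] at the nodes it gives the rate of the lumped elastic energy, and times
    [B] it gives [G / 2 (B - 1)], so the elastic stress in the momentum equation cancels exactly.
    The only inequality of the energy law is the diffusion bound. The divergence theorem is reached
    without a surface measure on cell facets: facet integrals are normalised means over the
    reference simplex, and the cell determinant times the gradient of a barycentric coordinate
    stands for area times normal. Cancellation across a facet then only needs that the two
    barycentric coordinates vanishing there are proportional with negative ratio. What must be
    supplied is the affine change of variables for the iterated Lebesgue measure. The logarithmic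
    bound is read off the eigenvalues [m] of [B^(-1/2) A B^(-1/2)]: the pairing is the sum of
    [m + 1/m - 2], each term dominates [(ln m)^2], and Cauchy-Schwarz over [d] eigenvalues produces
    the factor [d], hence the constant [alpha G / (2 d)]. *)

Section LebesgueAffine.
Context {R : realType}.
Local Notation mR := (measurableTypeR R).
Local Notation mu := (@lebesgue_measure R).

(** Uniqueness of Lebesgue measure: the scaled image measure gives every half-open interval its
    length. For [a < 0] the preimage is half-open on the other side, which leaves its length
    unchanged. *)
Lemma lebesgue_measure_affine (a b : R) (A : set mR) : a != 0 -> measurable A ->
  mu A = (`|a|%:E * mu ((fun x : mR => (a * x + b)%R : mR) @^-1` A))%E.
Proof.
move=> a0 mA.
have mf : measurable_fun setT (fun x : mR => a * x + b : mR).
  by apply: measurable_funD => //; apply: measurable_funM.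
pose nu := mscale (NngNum (normr_ge0 a))
  (@measure_function_pushforward__canonical__measure_function_Measure
    _ _ _ _ _ [the measure _ _ of mu] _ mf).
rewrite -[RHS]/(nu A); apply: lebesgue_measure_unique => // X [[p q] _ <-].
rewrite -[RHS]/(`|a|%:E * mu ((fun x : mR => (a * x + b)%R : mR) @^-1` `]p, q]%classic))%E.
have [a_gt0|] := ltP 0 a.
  rewrite (_ : _ @^-1` _ = `](p - b) / a, (q - b) / a]%classic); last first.
    apply/seteqP; split => x /=; rewrite !in_itv /=.
      by rewrite ltr_pdivrMr// ler_pdivlMr// ltrBlDr lerBrDr (mulrC x).
    by rewrite ltr_pdivrMr// ler_pdivlMr// ltrBlDr lerBrDr (mulrC x).
  rewrite !lebesgue_measure_itv /= !lte_fin ltr_pM2r ?invr_gt0// ltrD2r.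
  case: ifP => _; last by rewrite mule0.
  rewrite -!EFinB -EFinM gtr0_norm//; congr (_%:E).
  by field.
rewrite le_eqVlt (negbTE a0) /= => a_lt0.
rewrite (_ : _ @^-1` _ = `[(q - b) / a, (p - b) / a[%classic); last first.
  apply/seteqP; split => x /=; rewrite !in_itv /=.
    by rewrite ltr_ndivlMr// ler_ndivrMr// ltrBlDr lerBrDr (mulrC x) andbC.
  by rewrite ltr_ndivlMr// ler_ndivrMr// ltrBlDr lerBrDr (mulrC x) andbC.
rewrite !lebesgue_measure_itv /= !lte_fin ltr_nM2r ?invr_lt0// ltrD2r.
case: ifP => _; last by rewrite mule0.
rewrite -!EFinB -EFinM ltr0_norm//; congr (_%:E).
by field.
Qed.

Lemma ge0_integral_affine (a b : R) (f : mR -> \bar R) : a != 0 ->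
  measurable_fun setT f -> (forall x, 0 <= f x)%E ->
  (`|a|%:E * \int[mu]_x f (a * x + b)%R = \int[mu]_x f x)%E.
Proof.
move=> a0 mf f0.
have mg : measurable_fun setT (fun x : mR => a * x + b : mR).
  by apply: measurable_funD => //; apply: measurable_funM.
pose pf := (@measure_function_pushforward__canonical__measure_function_Measure
    _ _ _ _ _ [the measure _ _ of mu] _ mg).
pose nu := mscale (NngNum (normr_ge0 a)) pf.
transitivity (\int[nu]_x f x)%E.
  rewrite ge0_integral_mscale//=; congr (_ * _)%E.
  by rewrite ge0_integral_pushforward// preimage_setT.
apply: eq_measure_integral => A mA _.
exact: (esym (lebesgue_measure_affine b a0 mA)).
Qed.

Section Step.
Context {m : nat}.
Implicit Types f : m.+1.-tuple mR -> \bar R.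

Lemma ge0_integral_leb1 f : measurable_fun setT f -> (forall t, 0 <= f t)%E ->
  (\int[leb m.+1]_t f t = \int[mu]_x \int[leb m]_y f (tcons (x, y)))%E.
Proof.
move=> mf f0.
transitivity (\int[(mu \x leb m)%E]_z (f \o tcons) z)%E.
  rewrite /=.
  have mt : measurable_fun setT (@tcons R m) by exact: measurable_tcons.
  rewrite -[X in (_ = \int[_]_(z in X) _)%E](preimage_setT (@tcons R m)).
  by rewrite -(ge0_integral_pushforward mt).
apply: fubini_tonelli1 => //.
  by apply: measurableT_comp => //; exact: measurable_tcons.
by move=> z; exact: f0.
Qed.

(** Integrating first over the leading coordinate serves maps whose first output coordinate depends
    on the remaining variables: for these frozen, it is a one-dimensional affine map. *)
Lemma ge0_integral_leb2 f : measurable_fun setT f -> (forall t, 0 <= f t)%E ->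
  (\int[leb m.+1]_t f t = \int[leb m]_y \int[mu]_x f (tcons (x, y)))%E.
Proof.
move=> mf f0; rewrite ge0_integral_leb1//.
apply: (@fubini_tonelli _ _ _ _ _ _ _ (f \o @tcons R m)) => //.
  by apply: measurableT_comp => //; exact: measurable_tcons.
by move=> z; exact: f0.
Qed.

Lemma measurable_integral_leb f : measurable_fun setT f -> (forall t, 0 <= f t)%E ->
  measurable_fun setT (fun x : mR => \int[leb m]_y f (tcons (x, y)))%E.
Proof.
move=> mf f0.
apply: (@measurable_fun_fubini_tonelli_F _ _ _ _ _ _ (f \o @tcons R m)) => //.
  by apply: measurableT_comp => //; exact: measurable_tcons.
by move=> z; exact: f0.
Qed.

End Step.

Definition tvec {m} (x : 'cV[R]_m) : m.-tuple mR := [tuple x i 0 | i < m].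

Lemma cvecK m : cancel (@cvec R m) tvec.
Proof. by move=> t; apply: eq_from_tnth => i; rewrite tnth_mktuple mxE. Qed.

Lemma tvecK m : cancel tvec (@cvec R m).
Proof. by move=> x; apply/colP => i; rewrite mxE tnth_mktuple. Qed.

Definition atup {m} (A : 'M[R]_m) (c : 'cV[R]_m) (t : m.-tuple mR) : m.-tuple mR :=
  tvec (A *m cvec t + c).

Lemma measurable_tvec {d'} {T : measurableType d'} {m} (g : T -> 'cV[R]_m) :
  (forall i, measurable_fun setT (fun x => g x i 0)) -> measurable_fun setT (tvec \o g).
Proof.
move=> mg; apply/measurable_fun_tnthP => i.
by apply: eq_measurable_fun (mg i) => t _ /=; rewrite /= tnth_mktuple.
Qed.

Lemma measurable_cvec_coord {m} (i : 'I_m) :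
  measurable_fun setT (fun t : m.-tuple mR => cvec t i 0).
Proof.
apply: eq_measurable_fun (measurable_tnth i) => t _.
by rewrite /= mxE.
Qed.

Lemma measurable_atup m (A : 'M[R]_m) c : measurable_fun setT (atup A c).
Proof.
apply: measurable_tvec => i; under eq_fun do rewrite mxE mxE.
apply: measurable_funD => //; apply: measurable_sum => j.
apply: measurable_funM => //; exact: measurable_cvec_coord.
Qed.

(** For nonnegative functions Tonelli applies without integrability. Quantifying over the
    translation inside makes the property multiplicative in [A] and lets it absorb the shifts that
    arise when other coordinates are frozen. *)
Definition affine_cv {m} (A : 'M[R]_m) := forall c f,
  measurable_fun setT f -> (forall t, 0 <= f t)%E ->
  (`|\det A|%:E * \int[leb m]_t f (atup A c t) = \int[leb m]_t f t)%E.

Lemma affine_cvM m (A B : 'M[R]_m) : affine_cv A -> affine_cv B -> affine_cv (A *m B).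
Proof.
move=> cA cB c f mf f0.
rewrite det_mulmx normrM EFinM -muleA.
rewrite -(cA c f)//; congr (_ * _)%E.
rewrite -(cB 0 (fun t => f (atup A c t)))//; last first.
  by apply: measurableT_comp => //; exact: measurable_atup.
congr (_ * _)%E; apply: eq_integral => t _; congr f.
by rewrite /atup tvecK addr0 mulmxA.
Qed.

End LebesgueAffine.

Section LebesgueAffine.
Context {R : realType}.
Local Notation mR := (measurableTypeR R).
Local Notation mu := (@lebesgue_measure R).

Lemma cvec_tcons m (x : mR) (y : m.-tuple mR) :
  cvec (tcons (x, y)) = col_mx (x%:M : 'M[R]_1) (cvec y) :> 'cV[R]_(1 + m).
Proof.
apply/colP => i; rewrite !mxE; case: splitP => j ij.
  by rewrite (ord1 j) !mxE /= (tnth_nth x) /= ij (ord1 j) mulr1n.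
by rewrite !mxE !(tnth_nth x) /= ij.
Qed.

Lemma atup_tcons m (A : 'M[R]_(1 + m)) (c : 'cV[R]_(1 + m)) (x : mR) (y : m.-tuple mR) :
  atup A c (tcons (x, y) : (1 + m).-tuple mR) =
  tcons (ulsubmx A 0 0 * x + ((ursubmx A *m cvec y) 0 0 + usubmx c 0 0),
         atup (drsubmx A) (dlsubmx A *m x%:M + dsubmx c) y).
Proof.
apply: (can_inj (@cvecK R _)); rewrite cvec_tcons /atup !tvecK cvec_tcons.
rewrite -{1}[A](@submxK _ 1 m 1 m) mul_block_col -{1}[c](@vsubmxK _ 1 m) add_col_mx.
congr col_mx; last by rewrite [RHS]addrA; congr (_ + _); exact: addrC.
by apply/matrixP => i j; rewrite !ord1 !mxE big_ord1 !mxE !mulr1n addrA.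
Qed.

(** A vanishing off-diagonal block decouples one group of coordinates from the other. The coupled
    group is integrated first, where the other group only contributes a translation; the decoupled
    group is then transformed on its own. *)
Lemma affine_cv_block m (A : 'M[R]_(1 + m)) : ulsubmx A 0 0 != 0 ->
  ursubmx A = 0 \/ dlsubmx A = 0 -> affine_cv (drsubmx A) -> affine_cv A.
Proof.
move=> a0 AE cA' c f mf f0.
have mfx x : measurable_fun setT (fun y => f (tcons (x, y))).
  apply: measurableT_comp => //.
  apply: (measurableT_comp (@measurable_tcons R m)).
  exact: measurable_fun_pair.
have mfy y : measurable_fun setT (fun x => f (tcons (x, y))).
  apply: measurableT_comp => //.
  apply: (measurableT_comp (@measurable_tcons R m)).
  exact: measurable_fun_pair.
have mfA : measurable_fun setT (fun t => f (atup A c t)).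
  by apply: measurableT_comp => //; exact: measurable_atup.
have detA : \det A = ulsubmx A 0 0 * \det (drsubmx A).
  rewrite -{1}[A](@submxK _ 1 m 1 m) (_ : ulsubmx A 0 0 = \det (ulsubmx A)).
    by case: AE => ->; [rewrite det_lblock | rewrite det_ublock].
  by rewrite [in RHS](mx11_scalar (ulsubmx A)) det_scalar1.
rewrite detA normrM EFinM.
case: AE => AE.
  rewrite ge0_integral_leb1// [in RHS]ge0_integral_leb1//.
  rewrite -[RHS](ge0_integral_affine (usubmx c 0 0) a0)//; first last.
  - by move=> x; apply: integral_ge0 => ? _; exact: f0.
  - exact: measurable_integral_leb.
  rewrite -muleA; congr (_ * _)%E.
  rewrite -ge0_integralZl//; first last.
  - by move=> x _; apply: integral_ge0 => ? _; exact: f0.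
  - exact: (@measurable_integral_leb _ _ (fun t => f (atup A c t))).
  apply: eq_integral => x _.
  rewrite -(cA' (dlsubmx A *m (x%:M) + dsubmx c) (fun y => f (tcons (_, y))))//.
  congr (_ * _)%E; apply: eq_integral => y _.
  by rewrite atup_tcons AE mul0mx [in X in (_ + X)%R]mxE add0r.
rewrite ge0_integral_leb2// [in RHS]ge0_integral_leb2//.
rewrite (muleC (`|_|%:E)) -muleA.
rewrite -(cA' (dsubmx c) (fun y => \int[mu]_x f (tcons (x, y)))%E); first last.
- by move=> y; apply: integral_ge0 => ? _; exact: f0.
- apply: (@measurable_fun_fubini_tonelli_G _ _ _ _ _ _ (f \o @tcons R m)) => //.
    by apply: measurableT_comp => //; exact: measurable_tcons.
  by move=> z; exact: f0.
congr (_ * _)%E.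
rewrite -ge0_integralZl//; first last.
- by move=> x _; apply: integral_ge0 => ? _; exact: f0.
- apply: (@measurable_fun_fubini_tonelli_G _ _ _ _ _ _ ((fun t => f (atup A c t)) \o @tcons R m)) => //.
    by apply: measurableT_comp => //; exact: measurable_tcons.
  by move=> z; exact: f0.
apply: eq_integral => y _.
rewrite -[RHS](ge0_integral_affine ((ursubmx A *m cvec y) 0 0 + usubmx c 0 0) a0)//.
congr (_ * _)%E; apply: eq_integral => x _.
by rewrite atup_tcons AE mul0mx add0r.
Qed.

Lemma affine_cv0 (A : 'M[R]_0) : affine_cv A.
Proof.
move=> c f mf f0; rewrite det_mx00 normr1 mul1e.
by apply: eq_integral => t _; congr f; apply: eq_from_tnth => -[].
Qed.

Lemma affine_cv_trig m (A : 'M[R]_m) : is_trig_mx A -> A \in unitmx -> affine_cv A.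
Proof.
elim: m A => [A _ _|m IH A]; first exact: affine_cv0.
rewrite -[A in is_trig_mx A](@submxK _ 1 m 1 m).
rewrite (@is_trig_block_mx _ 1 m 1 m)// => /and3P[/eqP ur0 _ tA].
rewrite -[A in A \in _](@submxK _ 1 m 1 m) ur0.
rewrite unitmxE (@det_lblock _ 1 m) unitrM => /andP[ul dr].
apply: affine_cv_block; [|by left|exact: IH].
by move: ul; rewrite {1}[@ulsubmx _ 1 m 1 m A]mx11_scalar det_scalar1 unitfE.
Qed.

Lemma affine_cv_trigT m (A : 'M[R]_m) : is_trig_mx A^T -> A \in unitmx -> affine_cv A.
Proof.
elim: m A => [A _ _|m IH A]; first exact: affine_cv0.
rewrite -[A in A^T](@submxK _ 1 m 1 m) (@tr_block_mx _ 1 m 1 m).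
rewrite (@is_trig_block_mx _ 1 m 1 m)// => /and3P[/eqP dl0 _ tA].
have {}dl0 : @dlsubmx _ 1 m 1 m A = 0 by rewrite -[LHS]trmxK dl0 trmx0.
rewrite -[A in A \in _](@submxK _ 1 m 1 m) dl0.
rewrite unitmxE (@det_ublock _ 1 m) unitrM => /andP[ul dr].
apply: affine_cv_block; [|by right|exact: IH].
by move: ul; rewrite {1}[@ulsubmx _ 1 m 1 m A]mx11_scalar det_scalar1 unitfE.
Qed.

End LebesgueAffine.

Section LebesgueAffineUnit.
Context {R : realType}.
Local Notation mR := (measurableTypeR R).
Local Notation mu := (@lebesgue_measure R).

(** Such a matrix is lower or upper triangular according to the order of [i] and [j]; the side
    condition excludes the singular case [1 + a = 0] on the diagonal. *)
Lemma affine_cv_elem m (i j : 'I_m) (a : R) : (i != j) || (a != -1) ->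
  affine_cv (1%:M + a *: delta_mx i j : 'M[R]_m).
Proof.
move=> ija.
have trig (k l : 'I_m) : (l <= k)%N -> is_trig_mx (1%:M + a *: delta_mx k l : 'M[R]_m).
  move=> lk; apply/is_trig_mxP => p q pq; rewrite !mxE.
  have /negbTE -> : p != q by rewrite neq_ltn pq.
  have [pk|pk] := eqVneq p k; have [ql|ql] := eqVneq q l => /=;
    rewrite ?mulr0 ?addr0//.
  by move: pq; rewrite pk ql ltnNge lk.
have trE (k l : 'I_m) : (1%:M + a *: delta_mx k l : 'M[R]_m)^T = 1%:M + a *: delta_mx l k.
  by rewrite linearD /= trmx1 linearZ /= trmx_delta.
have dettrig (k l : 'I_m) : (l <= k)%N -> (k != l) || (a != -1) ->
    \det (1%:M + a *: delta_mx k l : 'M[R]_m) != 0.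
  move=> lk kla; rewrite det_trig; last exact: trig.
  apply/prodf_neq0 => p _; rewrite !mxE eqxx.
  have [pk|pk] := eqVneq p k; have [pl|pl] := eqVneq p l => /=;
    rewrite ?mulr0 ?addr0 ?oner_neq0//.
  by move: kla; rewrite -pk -pl eqxx /= mulr1 -subr_eq0 opprK addrC.
have [ij|/ltnW ij] := leqP j i.
  by apply: affine_cv_trig; rewrite ?trig// unitmxE unitfE dettrig.
apply: affine_cv_trigT; rewrite ?trE ?trig//.
by rewrite unitmxE unitfE -det_tr trE dettrig// eq_sym.
Qed.

(** The three shears exchange the two coordinates up to one sign, and the last factor, a reflection,
    repairs the sign. *)
Lemma tperm_mxE m (i j : 'I_m) : i != j -> tperm_mx i j =
  (1%:M + 1 *: delta_mx i j) *m (1%:M + (-1) *: delta_mx j i) *m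
  (1%:M + 1 *: delta_mx i j) *m (1%:M + (-2) *: delta_mx i i) :> 'M[R]_m.
Proof.
move=> ij; have ji : j != i by rewrite eq_sym.
pose x := delta_mx i j : 'M[R]_m; pose y := delta_mx j i : 'M[R]_m.
pose p := delta_mx i i : 'M[R]_m; pose r := delta_mx j j : 'M[R]_m.
transitivity (1%:M + x + y - p - r).
  apply/matrixP => k l; rewrite !mxE.
  case: tpermP => [->|->|/eqP ki /eqP kj].
  - rewrite !eqxx (negbTE ij) /= !(eq_sym l).
    by case: (i == l); case: (j == l) => /=; ring.
  - rewrite !eqxx (negbTE ji) /= !(eq_sym l).
    by case: (i == l); case: (j == l) => /=; ring.
  - by rewrite (negbTE ki) (negbTE kj) /= !subr0 !addr0.
have mulE (k l k' l' : 'I_m) :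
  delta_mx k l *m delta_mx k' l' = (l == k')%:R *: delta_mx k l' :> 'M[R]_m.
  by rewrite mul_delta_mx_cond scaler_nat.
have H1 : (1%:M + x) *m (1%:M - y) = 1%:M + x - y - p.
  rewrite mulmxDl mul1mx mulmxDr mulmx1 mulmxN mulE eqxx scale1r.
  by rewrite addrACA (addrC (- y)) !addrA addrAC.
have H2 : (1%:M + x - y - p) *m (1%:M + x) = 1%:M + x - y - p - r.
  rewrite mulmxDr mulmx1 !mulmxDl !mulNmx mul1mx !mulE !eqxx (negbTE ji) scale0r !scale1r.
  by rewrite addr0 (addrAC x) subrr add0r.
have Hp : (1%:M + x - y - p - r) *m p = - y.
  rewrite !mulmxDl !mulNmx mul1mx !mulE !eqxx (negbTE ji).
  by rewrite !scale0r !scale1r oppr0 !addr0 addrAC subrr add0r.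
have H3 : (1%:M + x - y - p - r) *m (1%:M - 2 *: p) = 1%:M + x + y - p - r.
  rewrite mulmxDr mulmx1 mulmxN -scalemxAr Hp scalerN opprK scaler_nat mulr2n.
  by rewrite addrAC (addrAC _ (- p)) addrA addrNK.
rewrite !scale1r scaleN1r scaleNr -/x -/y -/p.
by rewrite H1 H2 H3.
Qed.

Lemma affine_cv_perm m (s : 'S_m) : affine_cv (perm_mx s : 'M[R]_m).
Proof.
have [ts -> ts_neq] := prod_tpermP s.
elim: ts ts_neq => [_|[i j] ts IH] /=.
  rewrite big_nil perm_mx1.
  by apply: affine_cv_trig; rewrite ?unitmx1 ?scalar_mx_is_trig.
move=> /andP[ij tsn]; rewrite big_cons perm_mxM.
apply: affine_cvM; last exact: IH.
rewrite -/(tperm_mx i j) tperm_mxE//.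
have n1 : (-2 : R) != -1 by rewrite eqr_opp (eqr_nat _ 2 1).
have ji : j != i by rewrite eq_sym.
apply: affine_cvM; [apply: affine_cvM; [apply: affine_cvM|]|]; apply: affine_cv_elem.
all: by rewrite ?ij ?ji ?n1 ?orbT.
Qed.

(** The LUP decomposition writes [A] as a permutation matrix times a lower and an upper triangular
    matrix, all of which are covered above. *)
Lemma affine_cv_unit m (A : 'M[R]_m) : A \in unitmx -> affine_cv A.
Proof.
case: m A => [A _|m A uA]; first exact: affine_cv0.
have := cormen_lup_perm A; have := cormen_lup_correct A.
have := cormen_lup_lower A; have := cormen_lup_upper A; have := cormen_lup_detL A.
case: (cormen_lup A) => -[P L] U /= detL Uu Ll PA /is_perm_mxP[s Ps].
have AE : A = perm_mx s^-1%g *m (L *m U).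
  by rewrite -[L *m U]PA Ps -[_ * A]/(_ *m A) mulmxA -perm_mxM mulVg perm_mx1 mul1mx.
have uLU : L *m U \in unitmx by move: uA; rewrite AE unitmx_mul => /andP[].
move: uLU; rewrite unitmx_mul => /andP[uL uU].
rewrite AE; apply: affine_cvM; first exact: affine_cv_perm.
apply: affine_cvM.
  apply: affine_cv_trig => //; apply/is_trig_mxP => i j ij.
  by rewrite Ll ?(ltnW ij)// (_ : (i == j) = false)//; apply/negbTE; rewrite neq_ltn ij.
by apply: affine_cv_trigT => //; apply/is_trig_mxP => i j ij; rewrite mxE Uu.
Qed.

End LebesgueAffineUnit.

(** * Integrals of polynomial functions *)

Section Polyf.
Context {R : realType}.
Local Notation mR := (measurableTypeR R).

Lemma is_derive_near_affine {V W : normedModType R} (f : V -> W) (x v : V) (l : W) :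
  (\forall h \near 0^', f (h *: v + x) = f x + h *: l) -> is_derive x v f l.
Proof.
move=> fE.
have cvl : (fun h => h^-1 *: ((f \o shift x) (h *: v) - f x)) @ 0^' --> l.
  apply: cvg_near_cst; near=> h.
  have h0 : h != 0 by near: h; exact: nbhs_dnbhs_neq.
  rewrite /= (near fE h)//.
  by rewrite addrC addKr scalerA mulVf// scale1r.
by apply: DeriveDef; [apply/cvg_ex; exists l|apply: cvg_lim].
Unshelve. all: by end_near. Qed.

(** Polynomial functions by closure rules: measurability, boundedness on bounded sets, continuity,
    differentiability and stability under composition each become one induction, with no bookkeeping
    of degrees or coefficients. *)
Inductive polyf {d} : ('cV[R]_d -> R) -> Prop :=
| polyf_cst c : polyf (fun=> c)
| polyf_coord i : polyf (fun x => x i 0)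
| polyfD f g of polyf f & polyf g : polyf (fun x => f x + g x)
| polyfM f g of polyf f & polyf g : polyf (fun x => f x * g x).

Lemma polyf_sum d I (r : seq I) (P : pred I) (f : I -> 'cV[R]_d -> R) :
  (forall i, P i -> polyf (f i)) -> polyf (fun x => \sum_(i <- r | P i) f i x).
Proof.
move=> pf; elim: r => [|a r IH].
  by under eq_fun do rewrite big_nil; exact: polyf_cst.
rewrite (funext (fun x => big_cons _ _ a r P (f^~ x))); case Pa: (P a) => //.
by apply: polyfD => //; exact: pf.
Qed.

Lemma polyf_prod d I (r : seq I) (P : pred I) (f : I -> 'cV[R]_d -> R) :
  (forall i, P i -> polyf (f i)) -> polyf (fun x => \prod_(i <- r | P i) f i x).
Proof.
move=> pf; elim: r => [|a r IH].
  by under eq_fun do rewrite big_nil; exact: polyf_cst.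
rewrite (funext (fun x => big_cons _ _ a r P (f^~ x))); case Pa: (P a) => //.
by apply: polyfM => //; exact: pf.
Qed.

Lemma polyfX d (f : 'cV[R]_d -> R) k : polyf f -> polyf (fun x => f x ^+ k).
Proof.
move=> pf; elim: k => [|k IH]; first exact: polyf_cst.
by under eq_fun do rewrite exprS; exact: polyfM.
Qed.

Lemma polyfZ d (f : 'cV[R]_d -> R) c : polyf f -> polyf (fun x => c * f x).
Proof. by move=> pf; apply: polyfM => //; exact: polyf_cst. Qed.

Lemma polyfN d (f : 'cV[R]_d -> R) : polyf f -> polyf (fun x => - f x).
Proof. by move=> pf; under eq_fun do rewrite -mulN1r; exact: polyfZ. Qed.

Lemma polyfB d (f g : 'cV[R]_d -> R) : polyf f -> polyf g -> polyf (fun x => f x - g x).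
Proof. by move=> pf pg; apply: polyfD => //; exact: polyfN. Qed.

Lemma polyf_mulmx d p q (A : 'M[R]_(p, d)) (B : 'cV[R]_q -> 'cV[R]_d) i :
  (forall j, polyf (fun x => B x j 0)) -> polyf (fun x => (A *m B x) i 0).
Proof.
by move=> pB; under eq_fun do rewrite mxE; apply: polyf_sum => j _; exact: polyfZ.
Qed.

Lemma polyf_comp d d' (f : 'cV[R]_d -> R) (g : 'cV[R]_d' -> 'cV[R]_d) :
  polyf f -> (forall i, polyf (fun x => g x i 0)) -> polyf (fun x => f (g x)).
Proof.
move=> pf pg; elim: pf => [c|i|h k _ IH _ IH'|h k _ IH _ IH'] //.
- exact: polyf_cst.
- exact: polyfD.
- exact: polyfM.
Qed.

Lemma poly_on_polyf d D k (f : 'cV[R]_d -> R) : poly_on D k f ->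
  exists2 g, polyf g & forall x, D x -> f x = g x.
Proof.
move=> [N [c [a [_ fE]]]]; exists (fun x => \sum_m c m * \prod_i x i 0 ^+ a m i) => //.
apply: polyf_sum => m _; apply: polyfZ; apply: polyf_prod => i _; apply: polyfX.
exact: polyf_coord.
Qed.

Lemma measurable_polyf d (f : 'cV[R]_d -> R) : polyf f ->
  measurable_fun setT (fun t : d.-tuple mR => f (cvec t)).
Proof.
elim=> [c|i|h k _ IH _ IH'|h k _ IH _ IH'].
- exact: measurable_cst.
- exact: measurable_cvec_coord.
- exact: measurable_funD.
- exact: measurable_funM.
Qed.

Lemma polyf_bounded d (f : 'cV[R]_d -> R) (C : R) : polyf f ->
  exists D, forall x : 'cV[R]_d, (forall i, `|x i 0| <= C) -> `|f x| <= D.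
Proof.
elim=> [c|i|h k _ [D hD] _ [D' hD']|h k _ [D hD] _ [D' hD']].
- by exists `|c|.
- by exists C => x; exact.
- exists (D + D') => x xC; apply: le_trans (ler_normD _ _) _.
  by apply: lerD; [exact: hD|exact: hD'].
- exists (D * D') => x xC; rewrite normrM.
  by apply: ler_pM => //; [exact: hD|exact: hD'].
Qed.

Lemma polyf_continuous d (f : 'cV[R]_d -> R) : polyf f -> continuous f.
Proof.
elim=> [c|i|h k _ IH _ IH'|h k _ IH _ IH'] x.
- exact: cst_continuous.
- exact: coord_continuous.
- by apply: continuousD; [exact: IH|exact: IH'].
- by apply: continuousM; [exact: IH|exact: IH'].
Qed.

Lemma polyf_derive d (f : 'cV[R]_d -> R) : polyf f ->
  exists2 G : 'I_d -> 'cV[R]_d -> R, (forall l, polyf (G l)) &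
    forall x v, is_derive x v f (\sum_l v l 0 * G l x).
Proof.
elim=> [c|i|h k ph [g pg hg] pk [g' pg' hg']|h k ph [g pg hg] pk [g' pg' hg']].
- exists (fun _ _ => 0) => [l|x v]; first exact: polyf_cst.
  by rewrite big1 => [|l _]; [exact: is_derive_cst|rewrite mulr0].
- exists (fun l _ => (l == i)%:R) => [l|x v]; first exact: polyf_cst.
  rewrite (bigD1 i)//= eqxx mulr1 big1 ?addr0 => [|l /negbTE ->]; last by rewrite mulr0.
  by apply: is_derive_near_affine; near=> t; rewrite !mxE addrC.
- exists (fun l x => g l x + g' l x) => [l|x v]; first exact: polyfD.
  rewrite (eq_bigr _ (fun l _ => mulrDr _ _ _)) big_split /=.
  exact: is_deriveD.
- exists (fun l x => h x * g' l x + k x * g l x) => [l|x v].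
    by apply: polyfD; exact: polyfM.
  rewrite (eq_bigr (fun l => h x * (v l 0 * g' l x) + k x * (v l 0 * g l x))); last first.
    by move=> l _; rewrite mulrDr !(mulrCA (v l 0)).
  by rewrite big_split /= -!mulr_sumr; exact: is_deriveM.
Unshelve. all: by end_near. Qed.

End Polyf.

Section LintRules.
Context {R : realType}.
Local Notation mR := (measurableTypeR R).

(** Exactly what makes every polynomial function integrable over [D], so that linearity of the
    integral carries no further side conditions. *)
Definition bmeas {m} (D : set 'cV[R]_m) :=
  measurable (cvec @^-1` D) /\ exists C, forall x, D x -> forall i, `|x i 0| <= C.

Lemma leb_box_lty m (C : R) :
  (leb m [set t | forall i, (`|cvec t i 0| <= C)%R] < +oo)%E.
Proof.
elim: m => [|m IH].
  rewrite (_ : [set _ | _] = setT); last by apply/seteqP; split => // t _ [].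
  by rewrite /= diracT ltry.
rewrite /= /leb_step /pushforward.
rewrite (_ : _ @^-1` _ = `[- C, C]%classic `*` [set t | forall i, `|cvec t i 0| <= C]).
  rewrite product_measure1E//=; last first.
    rewrite (_ : [set _ | _] = \big[setI/setT]_(i < m) [set t | `|cvec t i 0| <= C]).
      apply: bigsetI_measurable => i _; rewrite -[X in measurable X]setTI.
      apply: (measurable_fun_ler _ _ measurableT) => //.
      apply: measurableT_comp => //; exact: measurable_cvec_coord.
    rewrite -bigcap_seq; apply/seteqP; split => t /= tC i; first by move=> _; exact: tC.
    by apply: tC; rewrite /= mem_index_enum.
  rewrite lebesgue_measure_itv /= lte_fin; case: ifP => CC; last by rewrite mul0e ltry.
  rewrite -EFinB; apply: lte_mul_pinfty => //.
  by rewrite lee_fin subr_ge0 ltW.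
apply/seteqP; split => -[x t] /=.
  move=> xt; split.
    by have := xt ord0; rewrite /cvec mxE /= (tnth_nth x) /= in_itv /= ler_norml.
  by move=> i; have := xt (lift ord0 i); rewrite !mxE !(tnth_nth x) /=.
move=> [xC tC] i; rewrite mxE (tnth_nth x).
case: (unliftP ord0 i) => [j|] -> /=; last by move: xC; rewrite in_itv /= ler_norml.
by have := tC j; rewrite mxE (tnth_nth x).
Qed.

Lemma leb_bmeas_lty m (D : set 'cV[R]_m) : bmeas D -> (leb m (cvec @^-1` D) < +oo)%E.
Proof.
move=> [mD [C DC]]; apply: le_lt_trans (leb_box_lty m C).
apply: le_measure; rewrite ?inE//; last by move=> t /= /DC.
rewrite (_ : [set _ | _] = \big[setI/setT]_(i < m) [set t | `|cvec t i 0| <= C]).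
  apply: bigsetI_measurable => i _; rewrite -[X in measurable X]setTI.
  apply: (measurable_fun_ler _ _ measurableT) => //.
  apply: measurableT_comp => //; exact: measurable_cvec_coord.
rewrite -bigcap_seq; apply/seteqP; split => t /= tC i; first by move=> _; exact: tC.
by apply: tC; rewrite /= mem_index_enum.
Qed.

Lemma bmeas_integrable m (D : set 'cV[R]_m) f : bmeas D -> polyf f ->
  (leb m).-integrable (cvec @^-1` D) (EFin \o (f \o cvec)).
Proof.
move=> bD pf; have [mD [C DC]] := bD; have [K fK] := polyf_bounded C pf.
apply: (@le_integrable _ _ _ _ _ mD _ (EFin \o cst K)).
- by apply/measurable_EFinP; apply: measurable_funTS; exact: measurable_polyf.
- move=> t Dt /=; rewrite lee_fin.
  apply: le_trans (ler_norm _); apply: fK; exact: DC.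
- apply/integrableP; split; first by apply/measurable_EFinP; exact: measurable_cst.
  rewrite (eq_integral (cst `|K|%:E))// integral_cst//; apply: lte_mul_pinfty => //; exact: leb_bmeas_lty.
Qed.

Lemma Lint_ext m (D : set 'cV[R]_m) f g : (forall x, D x -> f x = g x) ->
  Lint D f = Lint D g.
Proof. by move=> fg; apply: eq_Rintegral => t /set_mem /= Dt; exact: fg. Qed.

Lemma LintD m (D : set 'cV[R]_m) f g : bmeas D -> polyf f -> polyf g ->
  Lint D (fun x => f x + g x) = Lint D f + Lint D g.
Proof.
by move=> bD pf pg; apply: RintegralD; [case: bD|exact: bmeas_integrable..].
Qed.

Lemma LintZ m (D : set 'cV[R]_m) f c : bmeas D -> polyf f ->
  Lint D (fun x => c * f x) = c * Lint D f.
Proof.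
by move=> bD pf; apply: RintegralZl; [case: bD|exact: bmeas_integrable].
Qed.

Lemma Lint_cst m (D : set 'cV[R]_m) c : bmeas D -> Lint D (fun=> c) = c * vol D.
Proof. by move=> [mD _]; apply: Rintegral_cst. Qed.

Lemma Lint0 m (D : set 'cV[R]_m) : Lint D (fun=> 0) = 0.
Proof. by rewrite /Lint /Rintegral (eq_integral (cst 0%E))// integral0. Qed.

Lemma Lint_sum m (D : set 'cV[R]_m) I (r : seq I) (P : pred I) f : bmeas D ->
  (forall i, P i -> polyf (f i)) ->
  Lint D (fun x => \sum_(i <- r | P i) f i x) = \sum_(i <- r | P i) Lint D (f i).
Proof.
move=> bD pf; elim: r => [|a r IH].
  by under eq_fun do rewrite big_nil; rewrite big_nil Lint0.
rewrite (funext (fun x => big_cons _ _ a r P (f^~ x))) big_cons; case Pa: (P a) => //.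
by rewrite LintD// ?IH//; [exact: pf|exact: polyf_sum].
Qed.

Lemma vol_ge0 m (D : set 'cV[R]_m) : 0 <= vol D.
Proof. exact: fine_ge0. Qed.

End LintRules.

Section LintAffine.
Context {R : realType}.
Local Notation mR := (measurableTypeR R).

Lemma Lint_affine m (A : 'M[R]_m) c D f : A \in unitmx -> bmeas D -> polyf f ->
  Lint D f = `|\det A| * Lint [set s | D (A *m s + c)] (fun s => f (A *m s + c)).
Proof.
move=> uA bD pf; have [mD _] := bD.
have detA : \det A != 0 by rewrite -unitfE -unitmxE.
pose g : m.-tuple mR -> \bar R := (EFin \o (f \o cvec)) \_ (cvec @^-1` D).
have ig : (leb m).-integrable setT g.
  apply/integrable_restrict => //; rewrite setTI; exact: bmeas_integrable.
have mg : measurable_fun setT g by case/integrableP : ig.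
rewrite /Lint /Rintegral integral_mkcond -/g [in RHS]integral_mkcond.
set h := (X in _ = _ * fine (integral _ _ X)).
have -> : h = g \o atup A c.
  apply/funext => t; rewrite /h /g /= /patch /=.
  have E : cvec (atup A c t) = A *m cvec t + c by rewrite /atup tvecK.
  rewrite E; congr (if _ then _ else _).
  by apply/idP/idP => /set_mem /= ?; apply/mem_set; rewrite /= ?E// -E.
rewrite integralE [in RHS]integralE.
have epos : ((g \o atup A c)^\+ = g^\+ \o atup A c)%E by exact: funepos_comp.
have eneg : ((g \o atup A c)^\- = g^\- \o atup A c)%E by exact: funeneg_comp.
have mp : measurable_fun setT (g^\+)%E by exact: measurable_funepos.
have mn : measurable_fun setT (g^\-)%E by exact: measurable_funeneg.
have fp := integrable_pos_fin_num measurableT ig; have fn := integrable_neg_fin_num measurableT ig.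
have cvp := affine_cv_unit uA c mp (funepos_ge0 _).
have cvn := affine_cv_unit uA c mn (funeneg_ge0 _).
rewrite epos eneg -[in LHS]cvp -[in LHS]cvn.
(* [fine] is linear on differences of finite values only. Finiteness of the transformed positive and
   negative parts is inherited from the original ones, because the factor [|det A|] is nonzero. *)
have fin (X Y : \bar R) : (`|\det A|%:E * X = Y)%E -> Y \is a fin_num -> X \is a fin_num.
  have dA : 0 < `|\det A| by rewrite normr_gt0.
  by move=> <-; case: X => [r| |] //; rewrite ?gt0_muley ?gt0_muleNy ?lte_fin.
have fp' := fin _ _ cvp fp; have fn' := fin _ _ cvn fn.
have aux (r : R) (X Y : \bar R) : X \is a fin_num -> Y \is a fin_num ->
    fine (r%:E * X - r%:E * Y)%E = r * fine (X - Y)%E.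
  by case: X => // x; case: Y => // y _ _; rewrite /= mulrBr.
exact: aux.
Qed.

Definition rsimplex m : set 'cV[R]_m :=
  [set s | (forall i, 0 < s i 0) /\ \sum_i s i 0 < 1].

Arguments rsimplex m _ : clear implicits.

Lemma bmeas_rsimplex m : bmeas (rsimplex m).
Proof.
split; last first.
  exists 1 => x [x0 x1] i; rewrite gtr0_norm//; apply: ltW; apply: le_lt_trans x1.
  by rewrite (bigD1 i)//= lerDl sumr_ge0// => j _; exact: ltW.
rewrite (_ : _ @^-1` _ = \big[setI/setT]_(i < m) [set t | 0 < cvec t i 0] `&`
   [set t | \sum_i cvec t i 0 < 1]); last first.
  rewrite -bigcap_seq; apply/seteqP; split => t /= [t0 t1]; split => //.
    by move=> i _; exact: t0.
  by move=> i; apply: t0; rewrite /= mem_index_enum.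
apply: measurableI; first apply: bigsetI_measurable => i _.
  rewrite -[X in measurable X]setTI.
  by apply: (measurable_fun_ltr _ _ measurableT) => //; exact: measurable_cvec_coord.
rewrite -[X in measurable X]setTI.
apply: (measurable_fun_ltr _ _ measurableT) => //.
by apply: measurable_sum => i; exact: measurable_cvec_coord.
Qed.

Definition pcons {m} (x : R) (y : 'cV[R]_m) : 'cV[R]_m.+1 :=
  \col_i (if unlift ord0 i is Some j then y j 0 else x).

Lemma pconsE m x (y : 'cV[R]_m) : pcons x y = cvec (tcons (x, tvec y)).
Proof.
apply/colP => i; rewrite !mxE (tnth_nth x).
case: unliftP => [j|] -> //=.
by rewrite -[in LHS](tvecK y) mxE (tnth_nth x).
Qed.

Lemma rsimplex_pcons m x (y : 'cV[R]_m) : rsimplex m.+1 (pcons x y) <->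
  rsimplex m y /\ 0 < x < 1 - \sum_i y i 0.
Proof.
have s0 : pcons x y ord0 0 = x by rewrite mxE unlift_none.
have sl j : pcons x y (lift ord0 j) 0 = y j 0 by rewrite mxE liftK.
have sE : \sum_i pcons x y i 0 = x + \sum_i y i 0.
  by rewrite big_ord_recl s0; congr (_ + _); apply: eq_bigr => j _; exact: sl.
rewrite /rsimplex /= sE; split.
  move=> [p0 s1]; have x0 : 0 < x by rewrite -s0.
  split; last by rewrite x0 ltrBrDr.
  split; first by move=> i; rewrite -sl.
  by apply: le_lt_trans s1; rewrite lerDr ltW.
move=> [[y0 _] /andP[x0 xs]]; split; last by rewrite -ltrBrDr.
by move=> i; case: (unliftP ord0 i) => [j|] ->; rewrite ?s0 ?sl.
Qed.

Lemma is_derive_pcons m (f : 'cV[R]_m.+1 -> R) g (y : 'cV[R]_m) (x : R) :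
  is_derive (pcons x y) (delta_mx ord0 0) f g ->
  is_derive x 1 (fun x => f (pcons x y)) g.
Proof.
move=> [df dE].
have E : (fun h : R => h^-1 *: (((fun x : R => f (pcons x y)) \o shift x) (h *: 1) - f (pcons x y)))
   = (fun h => h^-1 *: ((f \o shift (pcons x y)) (h *: delta_mx ord0 0) - f (pcons x y))).
  apply/funext => h; congr (_ *: (f _ - _)).
  apply/colP => i; rewrite !mxE /= eqxx andbT; case: unliftP => [j|] ->.
    by rewrite eq_sym (negbTE (neq_lift _ _)) mulr0 add0r.
  by rewrite eqxx.
by apply: DeriveDef; rewrite /derivable ?/derive E.
Qed.

(** Fubini, then the fundamental theorem of calculus in the first coordinate. Over a point [y] of
    the lower-dimensional simplex the fibre runs from [0] to [1] minus the sum of [y], that is, from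
    one facet to another. *)
Lemma Lint_rsimplex_derive m (f g : 'cV[R]_m.+1 -> R) : polyf f -> polyf g ->
  (forall x, is_derive x (delta_mx ord0 0) f (g x)) ->
  Lint (rsimplex m.+1) g =
  Lint (rsimplex m) (fun y => f (pcons (1 - \sum_i y i 0) y) - f (pcons 0 y)).
Proof.
move=> pf pg fg.
have [mD _] := bmeas_rsimplex m.+1; have [mD' _] := bmeas_rsimplex m.
pose H : m.+1.-tuple mR -> \bar R := (EFin \o (g \o cvec)) \_ (cvec @^-1` (rsimplex m.+1)).
have iH : (leb m.+1).-integrable setT H.
  apply/integrable_restrict => //; rewrite setTI.
  exact: bmeas_integrable (bmeas_rsimplex _) pg.
have mH : measurable_fun setT H by case/integrableP : iH.
have mt : measurable_fun setT (@tcons R m) by exact: measurable_tcons.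
have iHt : (@lebesgue_measure R \x leb m)%E.-integrable setT (H \o @tcons R m).
  apply/integrableP; split; first exact: measurableT_comp.
  case/integrableP : iH => _; apply: le_lt_trans.
  rewrite /= (_ : \int[leb_step _]_x `|H x| = \int[pushforward (@lebesgue_measure R \x leb m)%E (@tcons R m)]_x `|H x|)%E//.
  by rewrite (ge0_integral_pushforward mt)// ; exact: measurableT_comp.
rewrite /Lint /Rintegral integral_mkcond -/H; congr fine.
transitivity (\int[(@lebesgue_measure R \x leb m)%E]_z (H \o @tcons R m) z)%E.
  rewrite -[X in (_ = \int[_]_(z in X) _)%E](preimage_setT (@tcons R m)).
  by rewrite -(integral_pushforward mt).
rewrite -integral21_prod_meas1// [RHS]integral_mkcond; apply: eq_integral => y _.
rewrite /fubini_G /patch; case: ifPn => [/set_mem /= rsy|nrsy]; last first.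
  apply: integral0_eq => x _; rewrite /H /= /patch ifF//; apply/negP => /set_mem /=.
  rewrite -[y]cvecK -pconsE => /rsimplex_pcons[rsy _].
  by move/negP: nrsy; apply; exact/mem_set.
set s := \sum_i cvec y i 0.
have s1 : 0 < 1 - s by rewrite subr_gt0; case: rsy.
transitivity (\int[@lebesgue_measure R]_(x in `]0%R, (1 - s)%R[) (g (pcons x (cvec y)))%:E)%E.
  rewrite [RHS]integral_mkcond; apply: eq_integral => x _.
  rewrite /H /= /patch pconsE cvecK.
  congr (if _ then _ else _); apply/idP/idP => /set_mem /= xH; apply/mem_set => /=.
    by move: xH; rewrite -[y in tcons (x, y)]cvecK -pconsE in_itv /= => /rsimplex_pcons[_].
  rewrite -[y in tcons (x, y)]cvecK -pconsE.
  by apply/rsimplex_pcons; move: xH; rewrite in_itv.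
have df (x : R) : is_derive x 1 (fun x => f (pcons x (cvec y))) (g (pcons x (cvec y))).
  by apply: is_derive_pcons; exact: fg.
have cg : continuous (fun x => g (pcons x (cvec y))).
  have [g' pg' dg] := polyf_derive pg.
  move=> x; apply/differentiable_continuous/derivable1_diffP.
  by apply: ex_derive; apply: is_derive_pcons; exact: dg.
have cf : continuous (fun x => f (pcons x (cvec y))).
  by move=> x; apply/differentiable_continuous/derivable1_diffP.
rewrite integral_itv_bndo_bndc; last first.
  apply/measurable_EFinP; exact: measurable_funTS (continuous_measurable_fun cg).
rewrite integral_itv_obnd_cbnd; last first.
  apply/measurable_EFinP; exact: measurable_funTS (continuous_measurable_fun cg).
rewrite (continuous_FTC2 (F := fun x => f (pcons x (cvec y))) s1)//.
- by apply: continuous_subspaceT => x; exact: cg.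
- split; first by move=> x _; exact: ex_derive.
  + by apply: cvg_at_right_filter; exact: cf.
  + by apply: cvg_at_left_filter; exact: cf.
- by move=> x _; rewrite derive1E derive_val.
Qed.

End LintAffine.

Arguments rsimplex {R} m _.

(** * Barycentric coordinates *)

Section Frob.
Context {R : realType}.

Lemma frobE p q (A B : 'M[R]_(p, q)) : frob A B = \tr (A^T *m B).
Proof.
rewrite /frob exchange_big; apply: eq_bigr => j _; rewrite mxE.
by apply: eq_bigr => i _; rewrite mxE.
Qed.

Lemma frobC p q (A B : 'M[R]_(p, q)) : frob A B = frob B A.
Proof. by apply: eq_bigr => i _; apply: eq_bigr => j _; rewrite mulrC. Qed.

Lemma frob_is_linear p q (A : 'M[R]_(p, q)) : linear (frob A : _ -> R^o).
Proof. by move=> c B C; rewrite !frobE mulmxDr -scalemxAr mxtraceD mxtraceZ. Qed.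

HB.instance Definition _ p q (A : 'M[R]_(p, q)) :=
  GRing.isLinear.Build R 'M[R]_(p, q) R^o *:%R (frob A) (@frob_is_linear p q A).

Lemma frobDr p q (A B C : 'M[R]_(p, q)) : frob A (B + C) = frob A B + frob A C.
Proof. exact: linearD. Qed.
Lemma frobZr p q (A B : 'M[R]_(p, q)) c : frob A (c *: B) = c * frob A B.
Proof. exact: linearZ. Qed.
Lemma frobNr p q (A B : 'M[R]_(p, q)) : frob A (- B) = - frob A B.
Proof. exact: linearN. Qed.
Lemma frobBr p q (A B C : 'M[R]_(p, q)) : frob A (B - C) = frob A B - frob A C.
Proof. exact: linearB. Qed.
Lemma frob0r p q (A : 'M[R]_(p, q)) : frob A 0 = 0.
Proof. exact: linear0. Qed.
Lemma frob_sumr p q (A : 'M[R]_(p, q)) I (r : seq I) (P : pred I) F :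
  frob A (\sum_(i <- r | P i) F i) = \sum_(i <- r | P i) frob A (F i).
Proof. exact: linear_sum. Qed.
Lemma frobDl p q (A B C : 'M[R]_(p, q)) : frob (A + B) C = frob A C + frob B C.
Proof. by rewrite !(frobC _ C) frobDr. Qed.
Lemma frobZl p q (A B : 'M[R]_(p, q)) c : frob (c *: A) B = c * frob A B.
Proof. by rewrite !(frobC _ B) frobZr. Qed.
Lemma frobNl p q (A B : 'M[R]_(p, q)) : frob (- A) B = - frob A B.
Proof. by rewrite !(frobC _ B) frobNr. Qed.
Lemma frobBl p q (A B C : 'M[R]_(p, q)) : frob (A - B) C = frob A C - frob B C.
Proof. by rewrite !(frobC _ C) frobBr. Qed.
Lemma frob0l p q (A : 'M[R]_(p, q)) : frob 0 A = 0.
Proof. by rewrite frobC frob0r. Qed.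
Lemma frob_suml p q (A : 'M[R]_(p, q)) I (r : seq I) (P : pred I) F :
  frob (\sum_(i <- r | P i) F i) A = \sum_(i <- r | P i) frob (F i) A.
Proof. by rewrite frobC frob_sumr; apply: eq_bigr => i _; exact: frobC. Qed.

Lemma frob_mulmxl p q r (A : 'M[R]_(p, q)) (B : 'M[R]_(q, r)) C :
  frob (A *m B) C = frob B (A^T *m C).
Proof. by rewrite !frobE trmx_mul mulmxA. Qed.

Lemma frob_ge0 p q (A : 'M[R]_(p, q)) : 0 <= frob A A.
Proof. by apply: sumr_ge0 => i _; apply: sumr_ge0 => j _; rewrite -expr2 sqr_ge0. Qed.

Lemma frob_eq0 p q (A : 'M[R]_(p, q)) : (frob A A == 0) = (A == 0).
Proof.
apply/idP/eqP => [|->]; last by rewrite frob0r.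
rewrite psumr_eq0 => [/allP A0|i _]; last by apply: sumr_ge0 => j _; rewrite -expr2 sqr_ge0.
apply/matrixP => i j; rewrite mxE; have := A0 i; rewrite mem_index_enum => /(_ isT).
rewrite psumr_eq0 => [/allP/(_ j)|k _]; last by rewrite -expr2 sqr_ge0.
by rewrite mem_index_enum => /(_ isT); rewrite -expr2 sqrf_eq0 => /eqP.
Qed.

Lemma frob_col p (a b : 'cV[R]_p) : frob a b = \sum_i a i 0 * b i 0.
Proof. by apply: eq_bigr => i _; rewrite big_ord1. Qed.

Lemma frob_delta p (a : 'cV[R]_p) i : frob a (delta_mx i 0) = a i 0.
Proof.
rewrite frob_col (bigD1 i)//= mxE !eqxx mulr1 big1 ?addr0// => j /negbTE ji.
by rewrite mxE ji mulr0.
Qed.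

Lemma polyf_frob p q d (a : 'M[R]_(p, q)) (f : 'cV[R]_d -> 'M[R]_(p, q)) :
  (forall i j, polyf (fun x => f x i j)) -> polyf (fun x => frob a (f x)).
Proof.
move=> pf; rewrite /frob; apply: polyf_sum => i _; apply: polyf_sum => j _.
exact: polyfZ.
Qed.

End Frob.

Section SumDelta.
Context {R : realType} {I : finType}.

Lemma sum_delta (V : lmodType R) (F : I -> V) a : \sum_k (k == a)%:R *: F k = F a.
Proof.
rewrite (bigD1 a)//= eqxx scale1r big1 ?addr0// => j /negbTE ->.
by rewrite scale0r.
Qed.

Lemma sum_eq (a : I) : \sum_k (k == a)%:R = 1 :> R.
Proof. by rewrite (bigD1 a)//= eqxx big1 ?addr0// => j /negbTE ->. Qed.

End SumDelta.

Section Simplex.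
Context {R : realType} {m : nat}.

(** Gradient of the [k]-th barycentric coordinate of the reference simplex, whose vertex [ord0] is
    the origin: a basis vector for [lift ord0 j], the vector with all entries [-1] for [ord0]. *)
Definition rgrad (k : 'I_m.+1) : 'cV[R]_m :=
  \col_j ((k == lift ord0 j)%:R - (k == ord0)%:R).

Definition rcoord (s : 'cV[R]_m) k : R := (k == ord0)%:R + frob (rgrad k) s.

Lemma rcoord0 s : rcoord s ord0 = 1 - \sum_i s i 0.
Proof.
rewrite /rcoord eqxx frob_col; congr (_ + _); rewrite -sumrN; apply: eq_bigr => i _.
by rewrite mxE eqxx (negbTE (neq_lift _ _)) sub0r mulN1r.
Qed.

Lemma rcoord_lift s j : rcoord s (lift ord0 j) = s j 0.
Proof.
rewrite /rcoord eq_sym (negbTE (neq_lift _ _)) add0r frob_col (bigD1 j)//= mxE eqxx.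
rewrite eq_sym (negbTE (neq_lift _ _)) subr0 mul1r big1 ?addr0// => i /negbTE ij.
by rewrite mxE (inj_eq lift_inj) eq_sym ij eq_sym (negbTE (neq_lift _ _)) subr0 mul0r.
Qed.

Lemma sum_rcoord s : \sum_k rcoord s k = 1.
Proof.
rewrite big_ord_recl rcoord0; under [X in _ + X]eq_bigr do rewrite rcoord_lift.
by rewrite subrK.
Qed.

Lemma sum_rgrad : \sum_k rgrad k = 0.
Proof.
apply/colP => j; rewrite summxE mxE; under eq_bigr do rewrite mxE.
by rewrite sumrB !sum_eq subrr.
Qed.

Lemma rcoord_bary (l : 'I_m.+1 -> R) : \sum_k l k = 1 ->
  rcoord (\col_j l (lift ord0 j)) = l.
Proof.
move=> l1; apply/funext => k; case: (unliftP ord0 k) => [j|] ->.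
  by rewrite rcoord_lift mxE.
rewrite rcoord0 -l1 big_ord_recl; under [X in _ - X]eq_bigr do rewrite mxE.
by rewrite addrK.
Qed.

Lemma rsimplexP s : rsimplex m s <-> forall k, 0 < rcoord s k.
Proof.
split=> [[s0 s1] k|s0].
  case: (unliftP ord0 k) => [j|] ->; rewrite ?rcoord_lift ?rcoord0//.
  by rewrite subr_gt0.
split=> [i|]; first by rewrite -rcoord_lift.
by rewrite -subr_gt0 -rcoord0.
Qed.

Context {d : nat}.
Implicit Types v : 'I_m.+1 -> 'cV[R]_d.

Definition Fv v (s : 'cV[R]_m) : 'cV[R]_d := v ord0 + edges v *m s.

Lemma FvE v s : Fv v s = \sum_k rcoord s k *: v k.
Proof.
rewrite big_ord_recl rcoord0 scalerBl scale1r -addrA; congr (_ + _).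
under [X in _ = _ + X]eq_bigr do rewrite rcoord_lift.
apply/colP => i; rewrite !mxE summxE mulr_suml addrC -sumrB.
by apply: eq_bigr => j _; rewrite !mxE mulrBl mulrC (mulrC (v ord0 i 0)).
Qed.

Lemma osimplexP v x : osimplex v x <-> exists2 s, rsimplex m s & x = Fv v s.
Proof.
split=> [[l [l0 l1 ->]]|[s /rsimplexP s0 ->]].
  exists (\col_j l (lift ord0 j)); first by apply/rsimplexP => k; rewrite rcoord_bary.
  by rewrite FvE rcoord_bary.
by exists (rcoord s); split=> //; [exact: sum_rcoord|exact: FvE].
Qed.

Lemma osimplex_csimplex v : osimplex v `<=` csimplex v.
Proof.
move=> x [l [l0 l1 xE]]; exists l; split=> // [k|k]; first exact: ltW.
by rewrite inE.
Qed.

Lemma vertex_csimplex v k : csimplex v (v k).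
Proof.
exists (fun j => (j == k)%:R); split=> [j|j||].
- by rewrite ler0n.
- by rewrite inE.
- exact: sum_eq.
- by rewrite sum_delta.
Qed.

(** Affine independence of the vertices, expressed by the Gram matrix so that it covers full cells
    and surface elements of lower dimension alike. *)
Definition nondeg v := (edges v)^T *m edges v \in unitmx.

(* The gradient of the barycentric coordinate [bary v k]; it is tangent to [v], so
   that for [m < d] the point is first projected onto the affine hull of [v]. *)
Definition gbary v k : 'cV[R]_d :=
  edges v *m invmx ((edges v)^T *m edges v) *m rgrad k.

Definition bary v k (x : 'cV[R]_d) : R :=
  (k == ord0)%:R + frob (gbary v k) (x - v ord0).

Lemma baryD v k (x : 'cV[R]_d) (h : R) (w : 'cV[R]_d) :
  bary v k (h *: w + x) = bary v k x + h * frob (gbary v k) w.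
Proof. by rewrite /bary -(addrA (h *: w)) [in LHS]frobDr frobZr (addrC (h * _)) addrA. Qed.

Lemma bary_sum v k I (r : seq I) (a : I -> R) (x : I -> 'cV[R]_d) :
  \sum_(i <- r) a i = 1 ->
  bary v k (\sum_(i <- r) a i *: x i) = \sum_(i <- r) a i * bary v k (x i).
Proof.
move=> a1; rewrite /bary; under [RHS]eq_bigr do rewrite mulrDr -frobZr scalerBr.
rewrite big_split /= -mulr_suml a1 mul1r -frob_sumr sumrB -scaler_suml a1 scale1r.
by [].
Qed.

Lemma sum_gbary v : \sum_k gbary v k = 0.
Proof. by rewrite -mulmx_sumr sum_rgrad mulmx0. Qed.

Lemma sum_bary v x : \sum_k bary v k x = 1.
Proof.
by rewrite big_split /= -frob_suml sum_gbary frob0l addr0 sum_eq.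
Qed.

Lemma polyf_bary v k : polyf (bary v k).
Proof.
apply: polyfD; first exact: polyf_cst.
apply: polyf_frob => i j; rewrite ord1.
under eq_fun do rewrite mxE; apply: polyfD; first exact: polyf_coord.
exact: polyf_cst.
Qed.

Lemma bary_continuous v k : continuous (bary v k).
Proof. exact/polyf_continuous/polyf_bary. Qed.

Section Nondeg.
Variable v : 'I_m.+1 -> 'cV[R]_d.
Hypothesis nv : nondeg v.

Lemma bary_Fv s k : bary v k (Fv v s) = rcoord s k.
Proof.
rewrite /bary /rcoord /Fv (addrC (v ord0)) addrK; congr (_ + _); rewrite /gbary -mulmxA.
rewrite frob_mulmxl frob_mulmxl mulmxA trmx_inv trmx_mul trmxK mulmxA.
by rewrite -(mulmxA (invmx _)) mulVmx// mul1mx.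
Qed.

Lemma bary_comb l k : \sum_k l k = 1 -> bary v k (\sum_k l k *: v k) = l k.
Proof. by move=> l1; rewrite -{1}(rcoord_bary l1) -FvE bary_Fv rcoord_bary. Qed.

Lemma bary_vertex i k : bary v k (v i) = (k == i)%:R.
Proof.
by rewrite -(sum_delta v i) bary_comb// sum_eq.
Qed.

Lemma gbary_edge i j k : frob (gbary v k) (v i - v j) = (k == i)%:R - (k == j)%:R.
Proof.
have := bary_vertex i k; have := bary_vertex j k; rewrite /bary => <- <-.
by rewrite opprD addrACA subrr add0r -frobBr opprD addrACA opprK addNr addr0.
Qed.

(** The second condition places [x] in the affine hull: [bary] is blind to displacements normal to
    the simplex, so the signs alone do not locate [x]. In full dimension it is supplied by
    [bary_square]. *)
Lemma csimplexP x : csimplex v x <->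
  (forall k, 0 <= bary v k x) /\ x = \sum_k bary v k x *: v k.
Proof.
split=> [[l [l0 _ l1 ->]]|[b0 xE]].
  split=> [k|]; first by rewrite bary_comb.
  by apply: eq_bigr => k _; rewrite bary_comb.
by exists (bary v ^~ x); split=> //; [move=> k; rewrite inE|exact: sum_bary].
Qed.

Lemma osimplex_bary x : osimplex v x <->
  (forall k, 0 < bary v k x) /\ x = \sum_k bary v k x *: v k.
Proof.
split=> [[l [l0 l1 ->]]|[b0 xE]].
  split=> [k|]; first by rewrite bary_comb.
  by apply: eq_bigr => k _; rewrite bary_comb.
by exists (bary v ^~ x); split=> //; exact: sum_bary.
Qed.

Lemma face_bary J x : face v J x -> forall k, k \notin J -> bary v k x = 0.
Proof. by move=> [l [_ lJ l1 ->]] k kJ; rewrite bary_comb// lJ. Qed.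

Lemma nondeg_inj : injective v.
Proof.
move=> i j ij; have := bary_vertex i i; rewrite ij bary_vertex eqxx.
by case: eqP => // _ /eqP; rewrite eq_sym oner_eq0.
Qed.

End Nondeg.
End Simplex.

Section SquareSimplex.
Context {R : realType} {m : nat}.
Implicit Types v : 'I_m.+1 -> 'cV[R]_m.

Lemma nondeg_square v : nondeg v <-> edges v \in unitmx.
Proof. by rewrite /nondeg unitmx_mul unitmx_tr andbb. Qed.

Lemma invmx_gram v : nondeg v -> invmx ((edges v)^T *m edges v) *m (edges v)^T = invmx (edges v).
Proof.
move=> /nondeg_square uv; rewrite -[LHS]mulmx1 -(mulmxV uv) !mulmxA.
by rewrite -(mulmxA (invmx _)) mulVmx ?mul1mx// unitmx_mul unitmx_tr uv.
Qed.

Lemma bary_square v x : nondeg v -> x = \sum_k bary v k x *: v k.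
Proof.
move=> nv; have /nondeg_square uv := nv.
have xE : x = Fv v (invmx (edges v) *m (x - v ord0)).
  by rewrite /Fv mulmxA mulmxV// mul1mx addrC subrK.
by rewrite {1}xE FvE; apply: eq_bigr => k _; rewrite {2}xE bary_Fv.
Qed.

Lemma gbary_square v w : nondeg v -> \sum_k frob (gbary v k) w *: v k = w.
Proof.
move=> nv; rewrite [RHS](bary_square w nv).
have bE k : bary v k w = frob (gbary v k) w + bary v k 0.
  by rewrite -[w in LHS]addr0 -[w in w + _]scale1r baryD mul1r addrC.
under [RHS]eq_bigr do rewrite bE scalerDl.
by rewrite big_split /= -(bary_square 0 nv) addr0.
Qed.

(** The edges issuing from [v ord0] and the gradients of the other barycentric coordinates are dual
    bases, so their dyadic products sum to the identity. *)
Lemma gbary_edges v : nondeg v ->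
  \sum_j (v (lift ord0 j) - v ord0) *m (gbary v (lift ord0 j))^T = 1%:M.
Proof.
move=> nv; apply/matrixP => a b; rewrite summxE.
have := congr1 (fun z : 'cV_m => z a 0) (gbary_square (delta_mx b 0) nv).
rewrite /= big_ord_recl mxE summxE.
have := sum_gbary v; rewrite big_ord_recl => /eqP; rewrite addr_eq0 => /eqP ->.
rewrite frobNl frob_suml scaleNr scaler_suml -sumrN mxE summxE -big_split /=.
rewrite !mxE eqxx andbT => <-; apply: eq_bigr => j _.
by rewrite frob_delta !mxE big_ord1 !mxE; ring.
Qed.

End SquareSimplex.

(** * The divergence theorem on a simplex *)

Lemma perm_lift m (p : 'S_m.+1) (k : 'I_m.+1) :
  exists t : 'S_m, forall i, p (lift k i) = lift (p k) (t i).
Proof.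
have hP i : {j | p (lift k i) = lift (p k) j}.
  case: (unliftP (p k) (p (lift k i))) => [j ->|]; first by exists j.
  by move=> /perm_inj/eqP; rewrite eq_sym (negbTE (neq_lift _ _)).
have inj : injective (fun i => sval (hP i)).
  move=> i j; case: (hP i) => a /= Ha; case: (hP j) => b /= Hb ab.
  by apply: (@lift_inj _ k); apply: (@perm_inj _ p); rewrite Ha Hb ab.
by exists (perm inj) => i; rewrite permE; case: (hP i).
Qed.

Section Mean.
Context {R : realType}.
Local Notation rs m := (@rsimplex R m).

(* [m!^-1] times the mean of [f] over [v]: unlike the surface integral, it makes
   sense without the Gram determinant and for degenerate [v]. *)
Definition Psi {m d} (v : 'I_m.+1 -> 'cV[R]_d) (f : 'cV[R]_d -> R) : R :=
  Lint (rs m) (fun s => f (Fv v s)).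

Lemma polyf_Fv m d (v : 'I_m.+1 -> 'cV[R]_d) f : polyf f -> polyf (fun s => f (Fv v s)).
Proof.
move=> pf; apply: polyf_comp => // i; under eq_fun do rewrite mxE.
apply: polyfD; first exact: polyf_cst.
by apply: polyf_mulmx => j; exact: polyf_coord.
Qed.

Definition rvert {m} (k : 'I_m.+1) : 'cV[R]_m := \col_j (k == lift ord0 j)%:R.

Lemma Fv_rvert m (l : 'I_m.+1 -> R) : \sum_k l k = 1 -> rcoord (\sum_k l k *: rvert k) = l.
Proof.
move=> l1; rewrite -[in RHS](rcoord_bary l1); congr rcoord.
apply/colP => j; rewrite summxE mxE (bigD1 (lift ord0 j))//= !mxE eqxx mulr1.
by rewrite big1 ?addr0// => k /negbTE kj; rewrite !mxE kj mulr0.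
Qed.

Lemma rcoord_inj m : injective (@rcoord R m).
Proof. by move=> s t st; apply/colP => j; rewrite -!rcoord_lift st. Qed.

Section Perm.
Context {m : nat}.
Implicit Type p : 'S_m.+1.

Let P p s := Fv (rvert \o p) s : 'cV[R]_m.

Lemma rcoord_perm p s k : rcoord (P p s) (p k) = rcoord s k.
Proof.
rewrite /P FvE (reindex_inj (@perm_inj _ p^-1%g)) /=.
under eq_bigr do rewrite permKV.
rewrite (Fv_rvert (l := fun k => rcoord s (p^-1%g k))) ?permK//.
by rewrite -(sum_rcoord s) [RHS](reindex_inj (@perm_inj _ p^-1%g)).
Qed.

Lemma Fv_perm d p (v : 'I_m.+1 -> 'cV[R]_d) s : Fv (v \o p) s = Fv v (P p s).
Proof.
rewrite !FvE [RHS](reindex_inj (@perm_inj _ p)); apply: eq_bigr => k _.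
by rewrite rcoord_perm.
Qed.

Lemma rsimplex_perm p s : rs m (P p s) <-> rs m s.
Proof.
rewrite !rsimplexP; split=> H k; first by rewrite -(rcoord_perm p).
by rewrite -(permKV p k) rcoord_perm.
Qed.

Lemma edges_perm_unit p : edges (rvert \o p : _ -> 'cV[R]_m) \in unitmx.
Proof.
have PK s : P p (P p^-1%g s) = s.
  apply: rcoord_inj; apply/funext => k.
  by rewrite -{1}(permKV p k) !rcoord_perm.
suff /mulmx1_unit[] : edges (rvert \o p) *m edges (rvert \o p^-1%g) = 1%:M :> 'M[R]_m by [].
apply/matrixP => i j.
have := PK 0; rewrite /P /Fv mulmx0 addr0 => H0.
have := PK (delta_mx j 0); rewrite /P /Fv mulmxDr addrA H0 add0r mulmxA -colE.
by move=> /(congr1 (fun z : 'cV_m => z i 0)); rewrite !mxE eqxx andbT.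
Qed.

Hypothesis vol_pos : 0 < vol (rs m).

(** A measure argument in place of a determinant computation: the affine map permuting the vertices
    sends the reference simplex onto itself, so its scaling factor fixes a positive finite
    volume. *)
Lemma det_edges_perm p : `|\det (edges (rvert \o p : _ -> 'cV[R]_m))| = 1.
Proof.
have bD := @bmeas_rsimplex R m.
have := Lint_affine ((rvert \o p) ord0) (edges_perm_unit p) bD (polyf_cst 1).
have -> : [set s | rs m (edges (rvert \o p) *m s + (rvert \o p) ord0)] = rs m.
  by rewrite predeqE => s /=; rewrite addrC; exact: rsimplex_perm.
rewrite !Lint_cst// !mul1r => /eqP; rewrite -{1}[vol _]mul1r => /eqP H.
exact/esym/(mulIf _ H)/lt0r_neq0.
Qed.

Lemma Lint_rsimplex_perm p h : polyf h -> Lint (rs m) (fun s => h (P p s)) = Lint (rs m) h.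
Proof.
move=> ph; have bD := @bmeas_rsimplex R m.
rewrite (Lint_affine ((rvert \o p) ord0) (edges_perm_unit p) bD ph).
have -> : [set s | rs m (edges (rvert \o p) *m s + (rvert \o p) ord0)] = rs m.
  by rewrite predeqE => s /=; rewrite addrC; exact: rsimplex_perm.
rewrite det_edges_perm mul1r; apply: Lint_ext => s _.
by rewrite addrC.
Qed.

End Perm.

Lemma polyf_rcoord m k : polyf (fun s : 'cV[R]_m => rcoord s k).
Proof.
apply: polyfD; first exact: polyf_cst.
by apply: polyf_frob => i j; rewrite ord1; exact: polyf_coord.
Qed.

(** Integrating out one coordinate leaves the integral of the height [rcoord s ord0]. By symmetry
    all [m + 1] barycentric coordinates have the same integral, and they sum to 1, which yields the
    new factor [1 / (m + 1)]. The symmetry in dimension [m] needs a positive volume, which the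
    induction hypothesis provides. *)
Lemma vol_rsimplex m : vol (rs m) = m`!%:R^-1.
Proof.
elim: m => [|m IH].
  rewrite fact0 invr1 /vol (_ : _ @^-1` _ = setT); last first.
    by apply/seteqP; split=> t // _; split=> [[]//|]; rewrite big_ord0 ltr01.
  by rewrite (_ : leb 0 setT = 1%E)//; exact: diracT.
have vp : 0 < vol (rs m) by rewrite IH invr_gt0 ltr0n fact_gt0.
have bD := @bmeas_rsimplex R m; have bD' := @bmeas_rsimplex R m.+1.
have K k : Lint (rs m) (fun s => rcoord s k) = Lint (rs m) (fun s => rcoord s ord0).
  rewrite -(Lint_rsimplex_perm vp (tperm ord0 k) (polyf_rcoord k)).
  apply: Lint_ext => s _.
  by rewrite -[X in rcoord _ X](tpermL ord0 k) rcoord_perm.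
have KS : m.+1%:R * Lint (rs m) (fun s => rcoord s ord0) = vol (rs m).
  rewrite -[RHS]mul1r -Lint_cst// mulr_natl.
  transitivity (\sum_k Lint (rs m) (fun s => rcoord s k)).
    by under eq_bigr do rewrite K; rewrite sumr_const card_ord.
  rewrite -Lint_sum//; last by move=> k _; exact: polyf_rcoord.
  by apply: Lint_ext => s _; exact: sum_rcoord.
transitivity (Lint (rs m) (fun s => rcoord s ord0)).
  rewrite -[LHS]mul1r -Lint_cst//.
  have D (x : 'cV[R]_m.+1) : is_derive x (delta_mx ord0 0) (fun x => x ord0 0) (1 : R).
    apply: is_derive_near_affine; near=> h.
    by rewrite !mxE !eqxx /= addrC.
  rewrite (Lint_rsimplex_derive (polyf_coord ord0) (polyf_cst 1) D).
  by apply: Lint_ext => y _; rewrite /pcons !mxE unlift_none subr0 rcoord0.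
apply: (@mulfI _ m.+1%:R); first by rewrite pnatr_eq0.
by rewrite KS IH factS natrM invfM mulrA mulfV ?mul1r// pnatr_eq0.
Unshelve. all: by end_near. Qed.

Lemma vol_rsimplex_gt0 m : 0 < vol (rs m).
Proof. by rewrite vol_rsimplex invr_gt0 ltr0n fact_gt0. Qed.

Lemma Psi_perm m d (p : 'S_m.+1) (v : 'I_m.+1 -> 'cV[R]_d) f : polyf f -> Psi (v \o p) f = Psi v f.
Proof.
move=> pf; rewrite -[RHS](Lint_rsimplex_perm (vol_rsimplex_gt0 m) p); last exact: polyf_Fv.
by apply: Lint_ext => s _; rewrite Fv_perm.
Qed.

Lemma Psi_cst m d (v : 'I_m.+1 -> 'cV[R]_d) c : Psi v (fun=> c) = c / m`!%:R.
Proof. by rewrite -vol_rsimplex -Lint_cst//; exact: bmeas_rsimplex. Qed.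

Lemma Psi_ext m d (v : 'I_m.+1 -> 'cV[R]_d) f g :
  (forall x, osimplex v x -> f x = g x) -> Psi v f = Psi v g.
Proof. by move=> fg; apply: Lint_ext => s rss; apply: fg; apply/osimplexP; exists s. Qed.

Lemma PsiZ m d (v : 'I_m.+1 -> 'cV[R]_d) f c : polyf f ->
  Psi v (fun x => c * f x) = c * Psi v f.
Proof. by move=> pf; apply: LintZ; [exact: bmeas_rsimplex|exact: polyf_Fv]. Qed.

Lemma Psi_sum m d (v : 'I_m.+1 -> 'cV[R]_d) I (r : seq I) (P : pred I) f :
  (forall i, P i -> polyf (f i)) ->
  Psi v (fun x => \sum_(i <- r | P i) f i x) = \sum_(i <- r | P i) Psi v (f i).
Proof.
move=> pf; apply: (@Lint_sum _ _ _ _ _ _ (fun i s => f i (Fv v s))) => [|i Pi].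
  exact: bmeas_rsimplex.
by apply: polyf_Fv; exact: pf.
Qed.

Lemma is_derive_Fv m d (v : 'I_m.+2 -> 'cV[R]_d) (f : 'cV[R]_d -> R) (g : R) s :
  is_derive (Fv v s) (v (lift ord0 ord0) - v ord0) f g ->
  is_derive s (delta_mx ord0 0) (fun s => f (Fv v s)) g.
Proof.
move=> [df dE].
have E : (fun h : R => h^-1 *: (((fun s => f (Fv v s)) \o shift s) (h *: delta_mx ord0 0) - f (Fv v s)))
   = (fun h => h^-1 *: ((f \o shift (Fv v s)) (h *: (v (lift ord0 ord0) - v ord0)) - f (Fv v s))).
  apply/funext => h; congr (_ *: (f _ - _)).
  rewrite /= /Fv mulmxDr addrCA; congr (_ + _); rewrite -scalemxAr -colE.
  by congr (_ *: _); apply/colP => i; rewrite !mxE.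
by apply: DeriveDef; rewrite /derivable ?/derive E.
Qed.

(** Lines parallel to the edge enter the simplex through the facet opposite to the end of that edge
    and leave it through the facet opposite to [v ord0]; the first reference coordinate parametrises
    them. *)
Lemma Psi_derive1 m d (v : 'I_m.+2 -> 'cV[R]_d) (f g : 'cV[R]_d -> R) : polyf f -> polyf g ->
  (forall x, is_derive x (v (lift ord0 ord0) - v ord0) f (g x)) ->
  Psi v g = Psi (v \o lift ord0) f - Psi (v \o lift (lift ord0 ord0)) f.
Proof.
move=> pf pg dfg.
have D s : is_derive s (delta_mx ord0 0) (fun s => f (Fv v s)) (g (Fv v s)).
  exact: is_derive_Fv.
rewrite /Psi (Lint_rsimplex_derive (polyf_Fv v pf) (polyf_Fv v pg) D).
have E0 (y : 'cV[R]_m) : Fv v (pcons (1 - \sum_i y i 0) y) = Fv (v \o lift ord0) y.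
  rewrite !FvE big_ord_recl rcoord0 [X in 1 - X]big_ord_recl {1}/pcons mxE unlift_none.
  under [X in _ - (_ + X)]eq_bigr do rewrite mxE liftK.
  rewrite subrK subrr scale0r add0r; apply: eq_bigr => k _; rewrite rcoord_lift mxE.
  case: (unliftP ord0 k) => [j|] ->; first by rewrite rcoord_lift.
  by rewrite rcoord0.
have E1 (y : 'cV[R]_m) : Fv v (pcons 0 y) = Fv (v \o lift (lift ord0 ord0)) y.
  rewrite !FvE big_ord_recl rcoord0 [X in 1 - X]big_ord_recl {1}/pcons mxE unlift_none.
  under [X in _ - (_ + X)]eq_bigr do rewrite mxE liftK.
  rewrite add0r [X in _ + X]big_ord_recl rcoord_lift mxE unlift_none scale0r add0r.
  rewrite [RHS]big_ord_recl rcoord0 /=; congr (_ *: v _ + _).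
    by apply/val_inj.
  apply: eq_bigr => k _; rewrite !rcoord_lift mxE liftK; congr (_ *: v _).
  by apply/val_inj.
transitivity (Psi (v \o lift ord0) f + -1 * Psi (v \o lift (lift ord0 ord0)) f).
  rewrite -LintZ -?LintD; do ?[exact: polyf_Fv|exact: bmeas_rsimplex].
    by apply: Lint_ext => y _; rewrite E0 E1 mulN1r.
  by apply: polyfZ; exact: polyf_Fv.
by rewrite mulN1r.
Qed.

Lemma Psi_derive m d (v : 'I_m.+2 -> 'cV[R]_d) b (f g : 'cV[R]_d -> R) : polyf f -> polyf g -> b != ord0 ->
  (forall x, is_derive x (v b - v ord0) f (g x)) ->
  Psi v g = Psi (v \o lift ord0) f - Psi (v \o lift b) f.
Proof.
move=> pf pg b0 dfg; pose p := tperm b (lift ord0 ord0).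
have p0 : p ord0 = ord0 by rewrite tpermD.
have p1 : p (lift ord0 ord0) = b by rewrite tpermR.
have D x : is_derive x ((v \o p) (lift ord0 ord0) - (v \o p) ord0) f (g x).
  by rewrite /= p0 p1.
rewrite -(Psi_perm p v pg) (Psi_derive1 pf pg D).
have [t0 ht0] := perm_lift p ord0; have [t1 ht1] := perm_lift p (lift ord0 ord0).
have -> : (v \o p) \o lift ord0 = (v \o lift ord0) \o t0.
  by apply/funext => i /=; rewrite ht0 p0.
have -> : (v \o p) \o lift (lift ord0 ord0) = (v \o lift b) \o t1.
  by apply/funext => i /=; rewrite ht1 p1.
by rewrite !Psi_perm.
Qed.

End Mean.

Section Flux.
Context {R : realType}.

Lemma bmeas_osimplex m (v : 'I_m.+1 -> 'cV[R]_m) : nondeg v -> bmeas (osimplex v).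
Proof.
move=> nv; split; last first.
  exists (\sum_k \sum_i `|v k i 0|) => x [l [l0 l1 ->]] i.
  rewrite summxE; apply: le_trans (ler_norm_sum _ _ _) _; apply: ler_sum => k _.
  rewrite mxE normrM; apply: (@le_trans _ _ `|v k i 0|).
    rewrite ler_piMl// gtr0_norm// -l1 (bigD1 k)//= lerDl sumr_ge0// => j _.
    exact: ltW.
  by rewrite (bigD1 i)//= lerDl sumr_ge0.
rewrite (_ : _ @^-1` _ = \big[setI/setT]_(k < m.+1) [set t | 0 < bary v k (cvec t)]).
  apply: bigsetI_measurable => k _; rewrite -[X in measurable X]setTI.
  by apply: (measurable_fun_ltr _ _ measurableT) => //; exact: (measurable_polyf (polyf_bary v k)).
rewrite -bigcap_seq; apply/seteqP; split => t /= => [/osimplex_bary-/(_ nv)[b0 _] k _|b0].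
  exact: b0.
apply/osimplex_bary => //; split; last exact: bary_square.
by move=> k; apply: b0; rewrite /= mem_index_enum.
Qed.

Lemma Lint_osimplex m (v : 'I_m.+1 -> 'cV[R]_m) f : nondeg v -> polyf f ->
  Lint (osimplex v) f = `|\det (edges v)| * Psi v f.
Proof.
move=> nv pf; have /nondeg_square uv := nv.
rewrite (Lint_affine (v ord0) uv (bmeas_osimplex nv) pf) /Psi; congr (_ * _).
have -> : [set s | osimplex v (edges v *m s + v ord0)] = rsimplex m.
  rewrite predeqE => s /=; rewrite addrC -/(Fv v s) rsimplexP; split.
    by move=> /osimplex_bary-/(_ nv)[b0 _] k; rewrite -(bary_Fv nv).
  by move=> s0; apply/osimplexP; exists s => //; exact/rsimplexP.
by apply: Lint_ext => s _; rewrite addrC.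
Qed.

Lemma edges_perm m d (p : 'S_m.+1) (v : 'I_m.+1 -> 'cV[R]_d) :
  edges (v \o p) = edges v *m edges (rvert \o p).
Proof.
have F0 : (v \o p) ord0 = v ord0 + edges v *m (rvert \o p) ord0.
  by have := Fv_perm p v 0; rewrite /Fv !mulmx0 !addr0.
apply/matrixP => i j; have := Fv_perm p v (delta_mx j 0).
rewrite /Fv F0 -!addrA => /addrI; rewrite mulmxDr mulmxA => /addrI.
by rewrite -!colE => /(congr1 (fun z : 'cV_d => z i 0)); rewrite !mxE.
Qed.

Lemma norm_det_edges_perm m (p : 'S_m.+1) (v : 'I_m.+1 -> 'cV[R]_m) :
  `|\det (edges (v \o p))| = `|\det (edges v)|.
Proof.
by rewrite edges_perm det_mulmx normrM det_edges_perm ?mulr1// vol_rsimplex_gt0.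
Qed.

(** By the duality [gbary_edges], the divergence is the sum over edges at [v ord0] of the derivative
    along the edge of the component of [w] against the matching gradient. Each summand is a
    difference of two facet means; the terms on the facet opposite to [ord0] combine because all
    gradients sum to zero. *)
Lemma Psi_div m (v : 'I_m.+2 -> 'cV[R]_m.+1) (w : 'cV[R]_m.+1 -> 'cV[R]_m.+1)
    (G : 'I_m.+1 -> 'I_m.+1 -> 'cV[R]_m.+1 -> R) : nondeg v ->
  (forall i, polyf (fun x => w x i 0)) -> (forall i l, polyf (G i l)) ->
  (forall i x u, is_derive x u (fun x => w x i 0) (\sum_l u l 0 * G i l x)) ->
  Psi v (fun x => \sum_i G i i x) =
  - \sum_k Psi (v \o lift k) (fun x => frob (gbary v k) (w x)).
Proof.
move=> nv pw pG dw.
pose c j x := frob (gbary v (lift ord0 j)) (w x).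
pose u j := v (lift ord0 j) - v ord0.
pose g j x := \sum_i gbary v (lift ord0 j) i 0 * \sum_l u j l 0 * G i l x.
have pc k : polyf (fun x => frob (gbary v k) (w x)).
  by apply: polyf_frob => i j; rewrite ord1.
have pg j : polyf (g j).
  by apply: polyf_sum => i _; apply: polyfZ; apply: polyf_sum => l _; exact: polyfZ.
have dc j x : is_derive x (u j) (c j) (g j x).
  rewrite /c /g (_ : (fun x => _) =
     \sum_i (gbary v (lift ord0 j) i 0 \*: (fun x => w x i 0))); last first.
    by apply/funext => y; rewrite frob_col fct_sumE.
  by apply: is_derive_sum => i; apply: is_deriveZ.
have gE x : \sum_j g j x = \sum_i G i i x.
  have E l i : \sum_j u j l 0 * gbary v (lift ord0 j) i 0 = (l == i)%:R.
    have := gbary_edges nv => /matrixP/(_ l i); rewrite summxE [X in _ = X]mxE => <-.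
    by apply: eq_bigr => j _; rewrite [RHS]mxE big_ord1; congr (_ * _); rewrite [RHS]mxE.
  transitivity (\sum_i \sum_l (\sum_j u j l 0 * gbary v (lift ord0 j) i 0) * G i l x).
    rewrite exchange_big; apply: eq_bigr => i _.
    under eq_bigr do rewrite mulr_sumr; rewrite exchange_big; apply: eq_bigr => l _.
    by rewrite mulr_suml; apply: eq_bigr => j _; ring.
  apply: eq_bigr => i _; under eq_bigr do rewrite E.
  exact: (sum_delta (V := R^o) (fun l => G i l x) i).
rewrite -(Psi_ext (f := fun x => \sum_j g j x)); last by move=> x _; exact: gE.
rewrite Psi_sum//.
rewrite (eq_bigr (fun j => Psi (v \o lift ord0) (c j) - Psi (v \o lift (lift ord0 j)) (c j))); last first.
  move=> j _; apply: (Psi_derive (pc _) (pg j) _ (dc j)).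
  by rewrite eq_sym neq_lift.
rewrite sumrB [in RHS]big_ord_recl opprD; congr (_ - _).
rewrite -Psi_sum//; last by move=> j _; exact: pc.
rewrite -mulN1r -PsiZ//; apply: Psi_ext => x _.
have := sum_gbary v; rewrite big_ord_recl => /eqP; rewrite addr_eq0 => /eqP ->.
by rewrite frobNl mulN1r opprK frob_suml.
Qed.

End Flux.

(** * Facets of the bulk mesh *)

Section Replace.
Context {R : realType}.

Lemma nondeg_perm m (p : 'S_m.+1) (v : 'I_m.+1 -> 'cV[R]_m) : nondeg v -> nondeg (v \o p).
Proof.
move=> /nondeg_square; rewrite unitmxE unitfE -normr_gt0 => dv.
by apply/nondeg_square; rewrite unitmxE unitfE -normr_gt0 norm_det_edges_perm.
Qed.

Lemma bary_perm m (p : 'S_m.+1) (v : 'I_m.+1 -> 'cV[R]_m) k x : nondeg v ->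
  bary (v \o p) k x = bary v (p k) x.
Proof.
move=> nv; have nvp := nondeg_perm p nv.
rewrite [x in LHS](bary_square x nv) (reindex_inj (@perm_inj _ p)) /=.
apply: (bary_comb nvp (l := fun k => bary v (p k) x)).
by rewrite -(sum_bary v x) [RHS](reindex_inj (@perm_inj _ p)).
Qed.

Lemma csimplex_perm m d (p : 'S_m.+1) (v : 'I_m.+1 -> 'cV[R]_d) :
  csimplex (v \o p) = csimplex v.
Proof.
suff H (q : 'S_m.+1) (w : 'I_m.+1 -> 'cV[R]_d) : csimplex (w \o q) `<=` csimplex w.
  apply/seteqP; split; first exact: H.
  have E : (v \o p) \o p^-1%g = v by apply/funext => i /=; rewrite permKV.
  by rewrite -{1}E; exact: H.
move=> x [l [l0 _ l1 ->]]; exists (l \o (q^-1)%g); split=> /= [k|k||].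
- exact: l0.
- by rewrite inE.
- by rewrite -l1 [RHS](reindex_inj (@perm_inj _ (q^-1)%g)).
- rewrite (reindex_inj (@perm_inj _ (q^-1)%g)) /=; apply: eq_bigr => k _.
  by rewrite permKV.
Qed.

(** Cramer's rule: in barycentric coordinates of [v] the new edge matrix is the identity except for
    its first column, so its determinant is a single entry, the coordinate of the moved vertex. *)
Lemma det_edges_replace m (v v' : 'I_m.+2 -> 'cV[R]_m.+1) : nondeg v ->
  (forall j, j != lift ord0 ord0 -> v' j = v j) ->
  \det (edges v') = \det (edges v) * bary v (lift ord0 ord0) (v' (lift ord0 ord0)).
Proof.
move=> nv vv'.
have v0 : v' ord0 = v ord0 by apply: vv'; rewrite neq_lift.
pose T : 'M[R]_m.+1 := \matrix_(i, j) bary v (lift ord0 i) (v' (lift ord0 j)).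
have TE j i : j != ord0 -> T i j = (i == j)%:R.
  move=> j0; rewrite mxE vv'; last by rewrite (inj_eq lift_inj).
  by rewrite bary_vertex// (inj_eq lift_inj).
have -> : edges v' = edges v *m T.
  apply/matrixP => i j; rewrite mxE [in RHS]mxE v0.
  rewrite {1}(bary_square (v' (lift ord0 j)) nv) big_ord_recl !mxE summxE.
  have := sum_bary v (v' (lift ord0 j)); rewrite big_ord_recl => /eqP.
  rewrite eq_sym -subr_eq => /eqP <-.
  have aux (a b c : R) : (1 - a) * c + b - c = b - a * c by ring.
  rewrite aux mulr_suml -sumrB.
  by apply: eq_bigr => l _; rewrite !mxE; ring.
rewrite det_mulmx; congr (_ * _); rewrite det_trig; last first.
  apply/is_trig_mxP => i j ij; rewrite TE; last by case: j ij => -[].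
  by rewrite (_ : (i == j) = false)//; apply/negbTE; rewrite neq_ltn ij.
rewrite big_ord_recl mxE big1 ?mulr1// => i _; rewrite TE ?eqxx//.
Qed.

Lemma norm_det_edges_replace m k (v v' : 'I_m.+2 -> 'cV[R]_m.+1) : nondeg v ->
  (forall j, j != k -> v' j = v j) ->
  `|\det (edges v')| = `|\det (edges v)| * `|bary v k (v' k)|.
Proof.
move=> nv vv'; pose q := tperm k (lift ord0 ord0) : 'S_m.+2.
have q1 : q (lift ord0 ord0) = k by rewrite tpermR.
rewrite -(norm_det_edges_perm q v') -(norm_det_edges_perm q v) -normrM.
rewrite (det_edges_replace (nondeg_perm q nv)) ?bary_perm//= ?q1// => j jk /=.
by rewrite vv'// -q1 (inj_eq perm_inj).
Qed.

Lemma extend_perm m (k : 'I_m.+1) (f : 'I_m.+1 -> 'I_m.+1) :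
  (forall i j, i != k -> j != k -> f i = f j -> i = j) ->
  exists p : 'S_m.+1, forall j, j != k -> p j = f j.
Proof.
move=> finj; pose A := [set f j | j in [set~ k]]%SET.
have cA : #|A| = m.
  rewrite card_in_imset; last by move=> i j; rewrite !inE => ik jk; exact: finj.
  by rewrite cardsC1 card_ord.
have /set0Pn[k' k'A] : (~: A != finset.set0)%SET.
  by rewrite -card_gt0 cardsCs finset.setCK cA card_ord subSnn.
pose g j := if j == k then k' else f j.
have ginj : injective g.
  have fk' j : j != k -> f j != k'.
    move=> jk; apply: contraTN k'A => /eqP <-; rewrite inE negbK.
    by apply: imset_f; rewrite !inE.
  move=> i j; rewrite /g; case: (eqVneq i k) => [->|ik]; case: (eqVneq j k) => [->|jk]//.
  - by move/eqP; rewrite eq_sym (negbTE (fk' _ jk)).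
  - by move/eqP; rewrite (negbTE (fk' _ ik)).
  - exact: finj.
by exists (perm ginj) => j jk; rewrite permE /g (negbTE jk).
Qed.

Lemma line_near d (A : set 'cV[R]_d) (x w : 'cV[R]_d) : nbhs x A ->
  \forall e \near (0 : R)^'+, A (x + e *: w).
Proof.
move=> Ax.
have : (fun e : R => x + e *: w) @ (0 : R)^'+ --> x.
  rewrite -[X in _ --> X]addr0 -[X in _ + X](scale0r w).
  apply: cvgD; first exact: cvg_cst.
  apply: cvgZl; exact: cvg_at_right_filter.
exact.
Qed.

Lemma csimplex_closed m d (v : 'I_m.+1 -> 'cV[R]_d) : nondeg v -> closed (csimplex v).
Proof.
move=> nv.
pose g i (x : 'cV[R]_d) := x i 0 - \sum_k bary v k x * v k i 0.
have pg i : polyf (g i).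
  apply: polyfB; first exact: polyf_coord.
  apply: polyf_sum => k _; apply: polyfM; [exact: polyf_bary|exact: polyf_cst].
have -> : csimplex v = \bigcap_(k in setT) (bary v k @^-1` [set x | 0 <= x]) `&`
    \bigcap_(i in setT) (g i @^-1` [set x | x = 0]).
  apply/seteqP; split => x /= => [/(csimplexP nv)[b0 xE]|[b0 gx]].
    split=> [k _|i _]; first exact: b0.
    by rewrite /= /g {1}xE summxE -sumrB big1// => k _; rewrite mxE subrr.
  apply/(csimplexP nv); split=> [k|]; first exact: b0.
  apply/colP => i; have /eqP := gx i I; rewrite /g subr_eq0 => /eqP ->.
  by rewrite summxE; apply: eq_bigr => k _; rewrite mxE.
apply: closedI; apply: closed_bigI => k _; apply: preimage_closed.
- by move=> x _; exact: bary_continuous.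
- exact: closed_ge.
- by move=> x _; exact: polyf_continuous.
- exact: closed_eq.
Qed.

End Replace.

Section Facets.
Context {R : realType} {n : nat}.
Local Notation d := n.+1.
Local Notation pt := 'cV[R]_d.
Variables (Om : set pt) (M : @mesh R n).
Hypothesis oOm : open Om.
Hypothesis hM : regular_partition Om M.
Local Notation K_ := (@cell _ _ M).
Local Notation facet_id := ('I_(ncell M) * 'I_d.+1)%type.
Implicit Types F : facet_id.

Lemma mesh_nondeg K : nondeg (K_ K).
Proof. by apply/nondeg_square; rewrite unitmxE unitfE; case: hM. Qed.

Lemma osimplex_disjoint K K' x : osimplex (K_ K) x -> osimplex (K_ K') x -> K = K'.
Proof. by case: hM => _ _ tI _ _ xK xK'; apply: tI => //; exists x. Qed.

Lemma csimplex_closure K : csimplex (K_ K) `<=` closure Om.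
Proof. by case: hM => _ _ _ -> _ x xK; exists K. Qed.

(* [F] is a cell with a marked vertex, standing for the facet opposite to it. *)
Definition share F F' : Prop := F.1 <> F'.1 /\ exists2 p : 'S_d.+1, p F.2 = F'.2 &
  forall j, j != F.2 -> K_ F.1 j = K_ F'.1 (p j).

Lemma share_sym F F' : share F F' -> share F' F.
Proof.
move=> [KK' [p pk pE]]; split; first by move/esym.
exists p^-1%g; first by rewrite -pk permK.
move=> j jk; rewrite pE ?permKV//; apply: contraNneq jk => jF.
by rewrite -pk -jF permKV.
Qed.

(* The cells [F.1] and [F'.1] lie on different sides of their common facet when
   this is negative. *)
Definition crossing F F' := bary (K_ F'.1) F'.2 (K_ F.1 F.2).

(** Both sides are affine in [x] and vanish at the vertices of the common facet; they agree at the
    remaining vertex of [F.1] by definition of [crossing]. *)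
Lemma share_bary F F' x : share F F' ->
  bary (K_ F'.1) F'.2 x = crossing F F' * bary (K_ F.1) F.2 x.
Proof.
move=> [_ [p pk pE]].
rewrite {1}(bary_square x (mesh_nondeg F.1)) bary_sum ?sum_bary//.
rewrite (bigD1 F.2)//= mulrC big1 ?addr0// => j jF.
rewrite pE// bary_vertex; last exact: mesh_nondeg.
by rewrite -pk (inj_eq perm_inj) eq_sym (negbTE jF) mulr0.
Qed.

Lemma share_gbary F F' : share F F' ->
  gbary (K_ F'.1) F'.2 = crossing F F' *: gbary (K_ F.1) F.2.
Proof.
move=> sF; apply/colP => i; rewrite -[LHS]frob_delta -[RHS]frob_delta frobZl.
have E (K : 'I_(ncell M)) k w : frob (gbary (K_ K) k) w = bary (K_ K) k w - bary (K_ K) k 0.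
  by rewrite /bary opprD addrACA subrr add0r -frobBr sub0r opprK subrK.
by rewrite !E !(share_bary _ sF) mulrBr.
Qed.


Definition facet_weight F j : R := (j != F.2)%:R / n.+1%:R.

Definition facet_center F : pt := \sum_j facet_weight F j *: K_ F.1 j.

Lemma sum_facet_weight F : \sum_j facet_weight F j = 1.
Proof.
rewrite -mulr_suml (eq_bigr (fun j => 1 - (j == F.2)%:R)); last first.
  by move=> j _; case: eqP => _; rewrite ?subrr ?subr0.
rewrite sumrB sumr_const card_ord sum_eq -[X in X - 1]natr1 addrK.
by rewrite divff// pnatr_eq0.
Qed.

Lemma facet_weight_gt0 F j : j != F.2 -> 0 < facet_weight F j.
Proof. by move=> jF; rewrite /facet_weight jF mul1r invr_gt0 ltr0n. Qed.

Lemma bary_gt0_near m e' (v : 'I_m.+1 -> 'cV[R]_e') k (x w : 'cV[R]_e') : 0 < bary v k x ->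
  \forall e \near (0 : R)^'+, 0 < bary v k (x + e *: w).
Proof.
move=> x0; apply: (@line_near _ _ (bary v k @^-1` [set y | 0 < y])).
have N0 : nbhs (bary v k x) [set y | 0 < y] by apply: open_nbhs_nbhs; split=> //; exact: open_gt.
exact: (bary_continuous N0).
Qed.

(** The ratio is nonzero, since the coordinate is 1 at its own vertex. Were it positive, a point
    slightly off the facet centre towards the opposite vertex would lie in both open cells, which
    are disjoint. *)
Lemma crossing_lt0 F F' : share F F' -> crossing F F' < 0.
Proof.
move=> sF; have sb x := share_bary x sF; have [KK' [p pk pE]] := sF.
have nK := mesh_nondeg F.1; have nK' := mesh_nondeg F'.1.
rewrite lt_neqAle; apply/andP; split.
  apply/eqP => c0; have := sb (K_ F'.1 F'.2).
  by rewrite c0 mul0r bary_vertex// eqxx => /eqP; rewrite oner_eq0.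
rewrite leNgt; apply/negP => c0; apply: KK'.
pose x := facet_center F; pose w := K_ F.1 F.2 - x.
have bx j : bary (K_ F.1) j x = facet_weight F j.
  by rewrite /x /facet_center bary_comb// sum_facet_weight.
have bx' j : bary (K_ F'.1) (p j) x = facet_weight F j * (j != F.2)%:R
    + facet_weight F F.2 * bary (K_ F'.1) (p j) (K_ F.1 F.2).
  rewrite /x /facet_center bary_sum ?sum_facet_weight// (bigD1 F.2)//= addrC.
  congr (_ + _); rewrite (eq_bigr (fun i => (i == j)%:R *: facet_weight F i)); last first.
    move=> i iF; rewrite pE// bary_vertex// (inj_eq perm_inj) mulrC eq_sym.
    by [].
  rewrite big_mkcond /= (eq_bigr (fun i => (i == j)%:R *: (facet_weight F i * (i != F.2)%:R))).
    exact: (sum_delta (V := R^o) (fun i => facet_weight F i * (i != F.2)%:R)).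
  by move=> i _; case: eqP => /= _; rewrite ?mulr1// mulr0 scaler0.
have w0 : facet_weight F F.2 = 0 by rewrite /facet_weight eqxx mul0r.
have xk e : bary (K_ F.1) F.2 (x + e *: w) = e.
  rewrite addrC baryD bx w0 add0r /w.
  have -> : frob (gbary (K_ F.1) F.2) (K_ F.1 F.2 - x) =
    bary (K_ F.1) F.2 (K_ F.1 F.2) - bary (K_ F.1) F.2 x.
    by rewrite /bary opprD addrACA subrr add0r -frobBr opprB addrA subrK.
  by rewrite bx w0 subr0 bary_vertex// eqxx mulr1.
have H1 : \forall e \near (0 : R)^'+, forall j, j != F.2 -> 0 < bary (K_ F.1) j (x + e *: w).
  apply: filter_forall => j; case: (eqVneq j F.2) => [_|jF]; first by near=> e.
  near=> e => _; near: e; apply: bary_gt0_near; rewrite bx; exact: facet_weight_gt0.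
have H2 : \forall e \near (0 : R)^'+, forall j, j != F.2 -> 0 < bary (K_ F'.1) (p j) (x + e *: w).
  apply: filter_forall => j; case: (eqVneq j F.2) => [_|jF]; first by near=> e.
  near=> e => _; near: e; apply: bary_gt0_near; rewrite bx' w0 mul0r addr0 jF mulr1.
  exact: facet_weight_gt0.
have [e [[h1 h2] e0]] : exists e : R, ((forall j, j != F.2 -> 0 < bary (K_ F.1) j (x + e *: w)) /\
   (forall j, j != F.2 -> 0 < bary (K_ F'.1) (p j) (x + e *: w))) /\ 0 < e.
  apply: (@filter_ex _ (0 : R)^'+); near=> e; split; last by near: e; exact: nbhs_right_gt.
  by split; [exact: (near H1 e)|exact: (near H2 e)].
apply: (@osimplex_disjoint _ _ (x + e *: w)).
  apply/osimplex_bary => //; split; last exact: bary_square.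
  by move=> j; have [->|/h1//] := eqVneq j F.2; rewrite xk.
apply/osimplex_bary => //; split; last exact: bary_square.
move=> j; rewrite -(permKV p j); have [E|/h2//] := eqVneq (p^-1%g j) F.2.
by rewrite E pk sb xk mulr_gt0.
Unshelve. all: by end_near. Qed.

(** Three distinct cells cannot meet in one facet: crossing ratios multiply, so two negative ratios
    would make the third one positive. Once the cells agree, injectivity of the vertices forces the
    marked vertices to agree. *)
Lemma share_unique F F1 F2 : share F F1 -> share F F2 -> F1 = F2.
Proof.
move=> s1 s2; have [K1 [p1 p1k p1E]] := s1; have [K2 [p2 p2k p2E]] := s2.
case: F1 F2 s1 s2 K1 p1k p1E K2 p2k p2E => [L1 k1] [L2 k2] /= s1 s2 K1 p1k p1E K2 p2k p2E.
have [LL|/eqP LL] := eqVneq L1 L2; last first.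
  have s12 : share (L1, k1) (L2, k2).
    split=> //=; exists (p1^-1 * p2)%g; first by rewrite permM -p1k permK.
    move=> j jk /=; rewrite permM -p2E; last first.
      by apply: contraNneq jk => jF; rewrite -p1k -jF permKV.
    rewrite p1E ?permKV//.
    by apply: contraNneq jk => jF; rewrite -p1k -jF permKV.
  have c1 := crossing_lt0 s1; have c2 := crossing_lt0 s2; have c12 := crossing_lt0 s12.
  have := share_bary (K_ F.1 F.2) s12; rewrite (share_bary _ s1) (share_bary _ s2) /=.
  rewrite bary_vertex ?eqxx ?mulr1; last exact: mesh_nondeg.
  move=> E; have : 0 < crossing F (L2, k2) by rewrite E nmulr_rgt0.
  by rewrite ltNge ltW.
congr pair => //; rewrite {}LL {L1} in s1 p1E K1 *; apply/eqP/negPn/negP => kk.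
have q2 : p2^-1%g k1 != F.2.
  by apply: contraNneq kk => E; rewrite -p2k -E permKV.
have := p1E _ q2; rewrite p2E// permKV => /(nondeg_inj (mesh_nondeg L2)).
by rewrite -p1k => /perm_inj E; move: q2; rewrite -p1k -E eqxx.
Qed.

End Facets.

Section FacetSum.
Context {R : realType} {n : nat}.
Local Notation d := n.+1.
Local Notation pt := 'cV[R]_d.
Variables (Om : set pt) (M : @mesh R n).
Hypothesis oOm : open Om.
Hypothesis hM : regular_partition Om M.
Local Notation K_ := (@cell _ _ M).
Local Notation facet_id := ('I_(ncell M) * 'I_d.+1)%type.
Local Notation mesh_nondeg := (mesh_nondeg hM).
Implicit Types F : facet_id.

Lemma csimplex_side F x : csimplex (side F) x <->
  csimplex (K_ F.1) x /\ bary (K_ F.1) F.2 x = 0.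
Proof.
have nK := mesh_nondeg F.1; split.
  move=> [l [l0 _ l1 ->]].
  pose l' k := if unlift F.2 k is Some j then l j else 0.
  have l'F : l' F.2 = 0 by rewrite /l' unlift_none.
  have l'l j : l' (lift F.2 j) = l j by rewrite /l' liftK.
  have sl' : \sum_k l' k = 1.
    by rewrite (bigD1_ord F.2)//= l'F add0r -l1; apply: eq_bigr => j _; rewrite l'l.
  have -> : \sum_k l k *: side F k = \sum_k l' k *: K_ F.1 k.
    rewrite [RHS](bigD1_ord F.2)//= l'F scale0r add0r.
    by apply: eq_bigr => j _; rewrite l'l.
  split; last by rewrite bary_comb.
  exists l'; split=> // k; last by rewrite inE.
  by rewrite /l'; case: unliftP => [j|] _.
move=> [/(csimplexP nK)[b0 xE] bF].
exists (fun j => bary (K_ F.1) (lift F.2 j) x); split=> //.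
- by move=> k; rewrite inE.
- by rewrite -(sum_bary (K_ F.1) x) [RHS](bigD1_ord F.2)//= bF add0r.
- by rewrite {1}xE (bigD1_ord F.2)//= bF scale0r add0r.
Qed.

Lemma share_csimplex_side F F' : share F F' -> csimplex (side F) = csimplex (side F').
Proof.
move=> [_ [p pk pE]]; have [t tE] := perm_lift p F.2.
rewrite -(csimplex_perm t (side F')); congr csimplex.
apply/funext => j; rewrite /side /= pE; last by rewrite eq_sym neq_lift.
by rewrite tE pk.
Qed.

(* Moving from an interior point of the facet out of [F.1], one stays in [Om] and
   hence in a single other cell, which meets [F.1] in that facet. *)
Lemma facet_neighbour F : ~ boundary_side Om F -> exists F', share F F'.
Proof.
move=> nbF; have nK := mesh_nondeg F.1.
have [y yF yOm] : exists2 y, csimplex (side F) y & Om y.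
  apply: contrapT => H; apply: nbF => x xF; split.
    by apply: (csimplex_closure hM); exact: ((csimplex_side F x).1 xF).1.
  by move=> xOm; apply: H; exists x.
have [/(csimplexP nK)[yb _] yF0] := (csimplex_side F y).1 yF.
pose c := facet_center F.
have cb j : bary (K_ F.1) j c = facet_weight F j.
  by rewrite /c /facet_center bary_comb// sum_facet_weight.
(* Moving [y] a little towards the facet centre keeps it in the open set [Om] and makes all
   coordinates of the facet positive. The resulting point lies in no smaller face, so any cell
   sharing it must share the whole facet. *)
have [e [[e0 e1] xOm]] : exists e : R, (0 < e /\ e < 1) /\ Om (y + e *: (c - y)).
  apply: (@filter_ex _ (0 : R)^'+); near=> e; split; last first.
    by near: e; apply: line_near; apply: open_nbhs_nbhs; split.
  split; first by near: e; exact: nbhs_right_gt.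
  by near: e; apply: nbhs_right_lt.
pose x := y + e *: (c - y).
have bx j : bary (K_ F.1) j x = (1 - e) * bary (K_ F.1) j y + e * facet_weight F j.
  rewrite /x addrC baryD.
  have -> : frob (gbary (K_ F.1) j) (c - y) = bary (K_ F.1) j c - bary (K_ F.1) j y.
    by rewrite /bary opprD addrACA subrr add0r -frobBr opprB addrA subrK.
  by rewrite cb; ring.
have w0 : facet_weight F F.2 = 0 by rewrite /facet_weight eqxx mul0r.
have bxF : bary (K_ F.1) F.2 x = 0 by rewrite bx yF0 w0 !mulr0 addr0.
have bxj j : j != F.2 -> 0 < bary (K_ F.1) j x.
  move=> jF; rewrite bx; apply: ltr_wpDl; last by rewrite mulr_gt0// facet_weight_gt0.
  by rewrite mulr_ge0// subr_ge0 ltW.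
pose w := x - K_ F.1 F.2.
have nz h : 0 < h -> ~ csimplex (K_ F.1) (x + h *: w).
  move=> h0 /(csimplexP nK)[/(_ F.2) + _]; rewrite addrC baryD bxF add0r.
  have -> : frob (gbary (K_ F.1) F.2) w = bary (K_ F.1) F.2 x - bary (K_ F.1) F.2 (K_ F.1 F.2).
    by rewrite /bary opprD addrACA subrr add0r -frobBr opprB addrA subrK.
  by rewrite bxF bary_vertex// eqxx sub0r mulrN1 oppr_ge0 leNgt h0.
(* There are finitely many cells and the outward ray starts inside [Om], so one cell is met by
   points of the ray arbitrarily close to [x]. Being closed, it also contains [x]. *)
have [K' HK'] : exists K', ~ \forall h \near (0 : R)^'+, ~ csimplex (K_ K') (x + h *: w).
  apply: contrapT => H.
  have {}H : \forall h \near (0 : R)^'+, forall K', ~ csimplex (K_ K') (x + h *: w).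
    apply: filter_forall => K'; apply: contrapT => H'; apply: H; exists K'.
    exact: H'.
  have H2 : \forall h \near (0 : R)^'+, Om (x + h *: w).
    by apply: line_near; apply: open_nbhs_nbhs; split.
  have [h [h1 h2]] := filter_ex (filterI H H2).
  have := @subset_closure _ Om _ h2.
  by case: hM => _ _ _ -> _ [K' _ xK]; exact: (h1 K').
have xK' : csimplex (K_ K') x.
  apply: contrapT => xK'; apply: HK'; apply: (@line_near _ _ (~` csimplex (K_ K'))).
  apply: open_nbhs_nbhs; split=> //.
  by apply: closed_openC; exact/csimplex_closed/mesh_nondeg.
have KK' : F.1 <> K'.
  move=> E; apply: HK'; near=> h; rewrite -E; apply: nz.
  by near: h; exact: nbhs_right_gt.
have xK : csimplex (K_ F.1) x.
  apply/(csimplexP nK); split; last exact: bary_square.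
  by move=> j; have [->|/bxj/ltW//] := eqVneq j F.2; rewrite bxF.
have [_ _ _ _ /(_ F.1 K' x (conj xK xK'))] := hM => /face_bary-/(_ nK) fx.
have hf j : exists k', j != F.2 -> K_ F.1 j = K_ K' k'.
  have [->|jF] := eqVneq j F.2; first by exists ord0.
  have : j \in [set k | [exists k', K_ F.1 k == K_ K' k']]%SET.
    by apply/negPn/negP => /fx E; have := bxj _ jF; rewrite E ltxx.
  by rewrite inE => /existsP[k' /eqP E]; exists k'.
have [f fE] := choice hf.
have [p pE] : exists p : 'S_d.+1, forall j, j != F.2 -> p j = f j.
  apply: extend_perm => i j iF jF E; apply: (nondeg_inj nK).
  by rewrite fE// fE// E.
exists (K', p F.2); split => //; exists p => // j jF /=.
by rewrite fE// pE.
Unshelve. all: by end_near. Qed.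

Section Flux.
Variables (w : 'I_(ncell M) -> pt -> pt).
Hypothesis pw : forall K i, polyf (fun x => w K x i 0).
Hypothesis w_agree : forall K K' x, csimplex (K_ K) x -> csimplex (K_ K') x -> w K x = w K' x.
Hypothesis w_bnd : forall F x, boundary_side Om F -> csimplex (side F) x ->
  frob (gbary (K_ F.1) F.2) (w F.1 x) = 0.

(** The flux of [w] through the facet into the cell: [|det|] times [gbary] is [n!] times the facet
    area times the inner unit normal, and [Psi] carries the factor [1 / n!]. *)
Let flux F := `|\det (edges (K_ F.1))| *
  Psi (side F) (fun x => frob (gbary (K_ F.1) F.2) (w F.1 x)).

Let polyf_flux F : polyf (fun x => frob (gbary (K_ F.1) F.2) (w F.1 x)).
Proof. by apply: polyf_frob => i j; rewrite ord1. Qed.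

(** Passing from [F'.1] to [F.1] multiplies the cell determinant by minus the crossing ratio, while
    the gradients differ by the ratio itself; the means over the facet agree because vertex order is
    immaterial. Only the sign remains. *)
Lemma flux_share F F' : share F F' -> flux F' = - flux F.
Proof.
move=> sF; have c0 := crossing_lt0 hM sF; have [_ [p pk pE]] := sF.
have [t tE] := perm_lift p F.2.
have sideE : side F = side F' \o t.
  apply/funext => j; rewrite /side /= pE; last by rewrite eq_sym neq_lift.
  by rewrite tE pk.
have detE : `|\det (edges (K_ F.1))| = `|\det (edges (K_ F'.1))| * - crossing F F'.
  rewrite -(ltr0_norm c0) -(norm_det_edges_perm p (K_ F'.1)).
  have nKp := nondeg_perm p (mesh_nondeg F'.1).
  rewrite (norm_det_edges_replace (k := F.2) nKp)//.
  by rewrite bary_perm ?pk//; exact: mesh_nondeg.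
rewrite /flux detE mulrN mulNr opprK -mulrA; congr (_ * _).
rewrite -PsiZ// sideE Psi_perm; last exact: polyfZ.
apply: Psi_ext => x /osimplex_csimplex xF'.
rewrite (share_gbary hM sF) frobZl; congr (_ * frob _ _).
have [xK' _] := (csimplex_side F' x).1 xF'.
have xF : csimplex (side F) x by rewrite (share_csimplex_side sF).
by have [xK _] := (csimplex_side F x).1 xF; exact: w_agree.
Qed.

Lemma flux_boundary F : boundary_side Om F -> flux F = 0.
Proof.
move=> bF; rewrite /flux (Psi_ext (g := fun=> 0)) ?Psi_cst ?mul0r ?mulr0// => x /osimplex_csimplex.
exact: w_bnd.
Qed.

(** Sending each facet to its neighbour, and each boundary facet to itself, is an involution that
    reverses the flux. Reindexing by it shows that the sum equals its own negative. *)
Lemma sum_flux : \sum_F flux F = 0.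
Proof.
have hs F : exists F', if `[< boundary_side Om F >] then F' = F else share F F'.
  by case: asboolP => [_|/facet_neighbour//]; exists F.
have [s sE] := choice hs.
have sK : involutive s.
  move=> F; have := sE F; case: asboolP => [bF ->|nbF sF].
    by have := sE F; case: asboolP.
  have := sE (s F); case: asboolP => [bsF|_ ssF].
    by exfalso; apply: nbF; rewrite /boundary_side (share_csimplex_side sF).
  by apply: (share_unique hM ssF); exact: share_sym.
have fs F : flux (s F) = - flux F.
  have := sE F; case: asboolP => [bF ->|_]; last exact: flux_share.
  by rewrite flux_boundary// oppr0.
have : \sum_F flux F = - \sum_F flux F.
  rewrite {1}(reindex_inj (inv_inj sK)) /= -sumrN; apply: eq_bigr => F _.
  exact: fs.
lra.
Qed.

Lemma mesh_div_zero (G : 'I_(ncell M) -> 'I_d -> 'I_d -> pt -> R) :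
  (forall K i l, polyf (G K i l)) ->
  (forall K i x u, is_derive x u (fun x => w K x i 0) (\sum_l u l 0 * G K i l x)) ->
  \sum_K Lint (osimplex (K_ K)) (fun x => \sum_i G K i i x) = 0.
Proof.
move=> pG dG; rewrite -[RHS]oppr0 -[X in _ = - X]sum_flux -sumrN.
transitivity (\sum_K \sum_k - flux (K, k)); last first.
  by rewrite pair_bigA; apply: eq_bigr => -[].
apply: eq_bigr => K _.
rewrite Lint_osimplex; [|exact: mesh_nondeg|by apply: polyf_sum].
rewrite (Psi_div (w := w K))//; last exact: mesh_nondeg.
by rewrite mulrN mulr_sumr -sumrN.
Qed.

End Flux.
End FacetSum.

(** * Symmetric positive definite matrices *)

Section RealEigen.
Import complex.
Context {R : realType}.
Local Notation C := (complex R).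

Lemma ReD (x y : C) : Re (x + y) = Re x + Re y. Proof. by case: x y => [a b] [c e]. Qed.
Lemma ImD (x y : C) : Im (x + y) = Im x + Im y. Proof. by case: x y => [a b] [c e]. Qed.

(** Over the complex numbers an eigenvector [x + i y] exists. Comparing [x A . y] with [x . y A]
    gives [Im a (|x|^2 + |y|^2) = 0], so the eigenvalue is real and whichever of [x], [y] is nonzero
    is a real eigenvector. *)
Lemma symmetric_eigenvector p (A : 'M[R]_p.+1) : A^T = A ->
  exists a (q : 'rV[R]_p.+1), q != 0 /\ q *m A = a *: q.
Proof.
move=> As; pose f : R -> C := fun x => Complex x 0.
have [a /eigenvalueP[v vA v0]] := @eigenvalue_closed C p.+1 (map_mx f A) isT.
pose x : 'rV[R]_p.+1 := \row_j Re (v 0 j); pose y : 'rV[R]_p.+1 := \row_j Im (v 0 j).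
have xA : x *m A = Re a *: x - Im a *: y.
  apply/rowP => k; have := congr1 (fun z : 'rV_p.+1 => Re (z 0 k)) vA.
  rewrite !mxE (big_morph _ ReD (erefl : Re (0 : C) = 0)) => E.
  transitivity (Re (a * v 0 k)); last by case: a (v 0 k) {vA E} => [? ?] [? ?].
  rewrite -E; apply: eq_bigr => j _; rewrite !mxE.
  by case: (v 0 j) => [b c] /=; rewrite mulr0 subr0.
have yA : y *m A = Im a *: x + Re a *: y.
  apply/rowP => k; have := congr1 (fun z : 'rV_p.+1 => Im (z 0 k)) vA.
  rewrite !mxE (big_morph _ ImD (erefl : Im (0 : C) = 0)) => E.
  transitivity (Im (a * v 0 k)); last first.
    by case: a (v 0 k) {vA E xA} => [? ?] [? ?] /=; rewrite addrC.
  rewrite -E; apply: eq_bigr => j _; rewrite !mxE.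
  by case: (v 0 j) => [b c] /=; rewrite mulr0 add0r.
have frobT (u w : 'rV[R]_p.+1) : frob (u *m A) w = frob u (w *m A).
  by rewrite !frobE trmx_mul As [in RHS]mulmxA [RHS]mxtrace_mulC mulmxA.
have : Im a * (frob x x + frob y y) = 0.
  have := frobT x y; rewrite xA yA frobBl !frobZl frobDr !frobZr => H.
  by lra.
move/eqP; rewrite mulf_eq0 => /orP[/eqP Ia|].
  move: xA yA; rewrite Ia !scale0r subr0 add0r => xA yA.
  exists (Re a); have [x0|x0] := eqVneq x 0; last by exists x.
  exists y; split=> //; apply: contraNneq v0 => y0; apply/eqP/rowP => j.
  move/rowP/(_ j): x0; move/rowP/(_ j): y0; rewrite !mxE.
  by case: (v 0 j) => [b c] /= -> ->.
rewrite paddr_eq0 ?frob_ge0// !frob_eq0 => /andP[/eqP x0 /eqP y0].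
exfalso; move/eqP: v0; apply; apply/rowP => j.
move/rowP/(_ j): x0; move/rowP/(_ j): y0; rewrite !mxE.
by case: (v 0 j) => [b c] /= -> ->.
Qed.

End RealEigen.

Section RealSpectral.
Context {R : realType}.

Lemma mul_rV_tr p (u w : 'rV[R]_p) : u *m w^T = (frob u w)%:M.
Proof.
rewrite [LHS]mx11_scalar; congr _%:M; rewrite mxE /frob big_ord1.
by apply: eq_bigr => j _; rewrite mxE.
Qed.

(** The reflection in the hyperplane orthogonal to [q - e], with [e] the first basis vector; it
    exchanges the two because both have length 1. *)
Lemma householder p (q : 'rV[R]_p.+1) : frob q q = 1 ->
  exists H : 'M[R]_p.+1, [/\ H^T = H, H *m H = 1%:M & delta_mx 0 0 *m H = q].
Proof.
move=> q1; pose e : 'rV[R]_p.+1 := delta_mx 0 0; pose w := q - e.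
have e1 : frob e e = 1.
  rewrite /frob big_ord1 (bigD1 0)//= mxE !eqxx mulr1 big1 ?addr0// => j /negbTE j0.
  by rewrite !mxE j0 mul0r.
have [w0|w0] := eqVneq w 0.
  exists 1%:M; split; rewrite ?trmx1 ?mulmx1//.
  by apply/eqP; rewrite eq_sym -subr_eq0 -/e -/w w0.
have ww : frob w w != 0 by rewrite frob_eq0.
have wTw := mul_rV_tr w w; have eTw := mul_rV_tr e w.
exists (1%:M - (2 / frob w w) *: (w^T *m w)); split.
- by rewrite linearB /= trmx1 linearZ /= trmx_mul trmxK.
- set W := w^T *m w; set c := 2 / _.
  have WW : W *m W = frob w w *: W.
    by rewrite /W mulmxA -(mulmxA w^T) wTw mul_mx_scalar scalemxAl.
  rewrite mulmxBl mul1mx mulmxBr mulmx1 -scalemxAl -scalemxAr WW !scalerA.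
  rewrite -[RHS]subr0 -addrA -opprD; congr (_ - _).
  rewrite -scalerBl -scalerDl (_ : _ + _ = 0) ?scale0r//.
  by rewrite /c; field.
- rewrite mulmxBr mulmx1 -scalemxAr mulmxA eTw mul_scalar_mx scalerA.
  rewrite -/e (_ : 2 / frob w w * frob e w = -1); first by rewrite scaleN1r opprK addrC subrK.
  have -> : frob e w = - (frob w w / 2).
    by rewrite /w frobBr !frobBl !frobBr e1 q1 (frobC q e); lra.
  by field.
Qed.

(** Deflation: conjugation by a reflection that takes the first basis vector to a unit eigenvector
    splits off a [1 x 1] block, by symmetry in both row and column, and the induction hypothesis
    treats the remaining block. *)
Lemma real_spectral p (A : 'M[R]_p) : A^T = A ->
  exists (Q : 'M[R]_p) (l : 'rV[R]_p), Q *m Q^T = 1%:M /\ A = Q^T *m diag_mx l *m Q.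
Proof.
elim: p A => [A _|p IH A As].
  by exists 1%:M, 0; split; apply/matrixP => -[].
have [a [q' [q'0 q'A]]] := symmetric_eigenvector As.
pose s := Num.sqrt (frob q' q'); pose q := s^-1 *: q'.
have q'p : 0 < frob q' q' by rewrite lt_neqAle frob_ge0 eq_sym frob_eq0 q'0.
have s0 : s != 0 by rewrite sqrtr_eq0 -ltNge.
have q1 : frob q q = 1.
  by rewrite frobZl frobZr -(sqr_sqrtr (ltW q'p)) -/s; field.
have qA : q *m A = a *: q by rewrite -scalemxAl q'A !scalerA mulrC.
have [H [Hs HH eH]] := householder q1.
pose B := H *m A *m H.
have Bs : B^T = B by rewrite /B !trmx_mul Hs As mulmxA.
have eB : delta_mx 0 0 *m B = a *: (delta_mx 0 0 : 'rV_p.+1).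
  by rewrite /B !mulmxA eH qA -scalemxAl -eH -mulmxA HH mulmx1.
have B0 j : B 0 j = a * (j == 0)%:R.
  have := congr1 (fun z : 'rV_p.+1 => z 0 j) eB.
  by rewrite -rowE !mxE eqxx.
have AE : A = H *m B *m H by rewrite /B !mulmxA HH mul1mx -mulmxA HH mulmx1.
clearbody B.
pose B' : 'M[R]_(1 + p) := B.
have l0 (i : 'I_1) : lshift p i = ord0 by apply/val_inj; rewrite /= ord1.
have BE : B' = block_mx a%:M 0 0 (drsubmx B').
  rewrite -[LHS](@submxK _ 1 p 1 p); congr block_mx; apply/matrixP => i j; rewrite !mxE.
  - by rewrite !l0 [LHS]B0 !ord1 !eqxx mulr1 mulr1n.
  - by rewrite !l0 [LHS]B0 mulr0.
  - by rewrite -[B']Bs mxE !l0 [LHS]B0 mulr0.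
have Ds : (drsubmx B')^T = drsubmx B' by apply/matrixP => i j; rewrite !mxE -{1}[B']Bs mxE.
have [Q [l [QQ DE]]] := IH _ Ds.
pose Q' : 'M[R]_(1 + p) := block_mx 1%:M 0 0 Q.
pose l' : 'rV[R]_(1 + p) := row_mx a%:M l.
have Q'Q' : Q' *m Q'^T = 1%:M.
  rewrite /Q' tr_block_mx mulmx_block !trmx0 !mulmx0 !mul0mx !addr0 add0r trmx1 mulmx1 QQ.
  by rewrite -scalar_mx_block.
have BE' : B' = Q'^T *m diag_mx l' *m Q'.
  rewrite BE DE /Q' /l' diag_mx_row tr_block_mx !mulmx_block.
  rewrite ?(trmx0, mulmx0, mul0mx, addr0, add0r, trmx1, mul1mx, mulmx1).
  congr block_mx; apply/matrixP => i j; rewrite !ord1 !mxE.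
  by rewrite !eqxx.
exists ((Q' : 'M[R]_p.+1) *m H), l'; split.
  by rewrite trmx_mul Hs mulmxA -(mulmxA Q') HH mulmx1.
rewrite trmx_mul Hs !mulmxA.
rewrite AE; have -> : B = Q'^T *m diag_mx l' *m Q' by exact: BE'.
by rewrite !mulmxA.
Qed.

End RealSpectral.

(** * Scalar inequalities for the logarithm *)

Section ScalarLn.
Context {R : realType}.

(** Mean value theorem: the derivative [expR x + expR (- x)] is at least 2, since the difference is
    the square of [expR (x / 2) - expR (- (x / 2))]. *)
Lemma sinh_ge (t : R) : 0 <= t -> 2 * t <= expR t - expR (- t).
Proof.
rewrite le_eqVlt => /predU1P[<-|t0]; first by rewrite mulr0 oppr0 subrr.
pose f (x : R) := expR x - expR (- x).
have df (x : R) : is_derive x 1 f (expR x + expR (- x)).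
  have H : is_derive x 1 (fun x => expR (- x)) (- expR (- x)).
    rewrite -[X in is_derive _ _ _ X]mulrN1.
    exact: (is_derive1_comp (is_derive_expR (- x)) (is_deriveNid x 1)).
  rewrite -[X in _ + X]opprK; exact: is_deriveB.
have cf : {within `[0, t], continuous f}.
  apply: continuous_subspaceT => x.
  by apply/differentiable_continuous/derivable1_diffP; exact: ex_derive.
have [c _ ] := MVT_segment (ltW t0) (fun x _ => df x) cf.
rewrite /f oppr0 subrr subr0 addr0 => ->; rewrite ler_pM2r//.
have := sqr_ge0 (expR (c / 2) - expR (- (c / 2))).
rewrite sqrrB -!expRM_natl -expRD subrr expR0.
rewrite (_ : 2 * (c / 2) = c); last by field.
by rewrite (_ : 2 * - (c / 2) = - c); [lra|field].
Qed.

(** With [s = ln m] the right-hand side is [(2 sinh (s / 2))^2], and [2 sinh (s / 2) >= s] for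
    [s >= 0]. Both sides are even in [s]. *)
Lemma ln_sqr_le (m : R) : 0 < m -> (ln m) ^+ 2 <= m + m^-1 - 2.
Proof.
move=> m0; pose s := ln m; have mE : m = expR s by rewrite lnK// posrE.
suff H (t : R) : 0 <= t -> t ^+ 2 <= expR t + expR (- t) - 2.
  rewrite -/s mE -expRN; have [/H//|/ltW s0] := leP 0 s.
  by have := H (- s); rewrite oppr_ge0 sqrrN opprK (addrC (expR (- s))); apply.
move=> t0; have := @sinh_ge (t / 2); rewrite divr_ge0// => /(_ isT).
rewrite (_ : 2 * (t / 2) = t) => [H|]; last by field.
have -> : expR t + expR (- t) - 2 = (expR (t / 2) - expR (- (t / 2))) ^+ 2.
  rewrite sqrrB -!expRM_natl -expRD subrr expR0.
  rewrite (_ : 2 * (t / 2) = t); last by field.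
  by rewrite (_ : 2 * - (t / 2) = - t); [ring|field].
by rewrite lerXn2r// nnegrE; exact: le_trans H.
Qed.

Lemma inv_gap_gt0 (m : R) : 0 < m -> m != 1 -> 0 < m + m^-1 - 2.
Proof.
move=> m0 m1; have -> : m + m^-1 - 2 = (m - 1) ^+ 2 / m by field; exact: lt0r_neq0.
by rewrite divr_gt0// lt_neqAle sqr_ge0 eq_sym sqrf_eq0 subr_eq0 m1.
Qed.

Lemma ln_prod I (r : seq I) (f : I -> R) : (forall i, 0 < f i) ->
  ln (\prod_(i <- r) f i) = \sum_(i <- r) ln (f i).
Proof.
move=> f0; elim: r => [|a r IH]; first by rewrite !big_nil ln1.
by rewrite !big_cons lnM ?IH// posrE// prodr_gt0.
Qed.

(** Cauchy-Schwarz against the vector of ones, obtained from the sum of all squared differences.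
    Applied to [d] eigenvalues it is the origin of the factor [1 / d] in the diffusive
    dissipation. *)
Lemma sqr_sum_le p (a : 'I_p -> R) : (\sum_i a i) ^+ 2 <= p%:R * \sum_i a i ^+ 2.
Proof.
have : 0 <= \sum_i \sum_j (a i - a j) ^+ 2.
  by apply: sumr_ge0 => i _; apply: sumr_ge0 => j _; exact: sqr_ge0.
have -> : \sum_i \sum_j (a i - a j) ^+ 2 =
    2 * (p%:R * \sum_i a i ^+ 2) - 2 * (\sum_i a i) ^+ 2.
  set S := \sum_i a i; set S2 := \sum_i a i ^+ 2.
  transitivity (\sum_i (p%:R * a i ^+ 2 + (S2 - 2 * S * a i))).
    apply: eq_bigr => i _; transitivity (\sum_j (a i ^+ 2 + (a j ^+ 2 - 2 * a i * a j))).
      by apply: eq_bigr => j _; ring.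
    rewrite big_split sumrB /= sumr_const card_ord -mulr_sumr -[_ *+ p]mulr_natl -/S -/S2.
    by ring.
  rewrite big_split sumrB /= sumr_const card_ord -!mulr_sumr -[_ *+ p]mulr_natl -/S -/S2.
  by ring.
lra.
Qed.

End ScalarLn.

Section Posdef.
Context {R : realType} {p : nat}.
Implicit Types A B Q : 'M[R]_p.

Lemma spectral_posdef Q (l : 'rV[R]_p) : Q *m Q^T = 1%:M -> (forall i, 0 < l 0 i) ->
  posdef (Q^T *m diag_mx l *m Q).
Proof.
move=> QQ l0; split; first by rewrite !trmx_mul trmxK tr_diag_mx mulmxA.
move=> x x0; rewrite -!mulmxA frobC frob_mulmxl trmxK frobC.
have y0 : Q *m x != 0.
  apply: contraNneq x0 => y0; rewrite -[x]mul1mx -(mulmx1C QQ) -mulmxA y0.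
  by rewrite mulmx0.
move: (Q *m x) y0 => y y0; rewrite frob_col.
have [i yi] : exists i, y i 0 != 0.
  apply: contrapT => H; move/eqP: y0; apply; apply/colP => i; rewrite mxE.
  by apply/eqP/negPn/negP => yi; apply: H; exists i.
apply: (@lt_le_trans _ _ (l 0 i * y i 0 ^+ 2)).
  by rewrite mulr_gt0// lt_neqAle sqr_ge0 eq_sym sqrf_eq0 yi.
rewrite (bigD1 i)//= mul_diag_mx mxE.
rewrite (_ : y i 0 * (l 0 i * y i 0) = l 0 i * y i 0 ^+ 2); last by ring.
rewrite lerDl sumr_ge0// => j _; rewrite mxE.
rewrite (_ : y j 0 * (l 0 j * y j 0) = l 0 j * y j 0 ^+ 2); last by ring.
by rewrite mulr_ge0 ?sqr_ge0// ltW.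
Qed.

Lemma spectral_gt0 A Q (l : 'rV[R]_p) : posdef A -> Q *m Q^T = 1%:M ->
  A = Q^T *m diag_mx l *m Q -> forall i, 0 < l 0 i.
Proof.
move=> [As A0] QQ AE i; pose x := Q^T *m delta_mx i 0 : 'cV[R]_p.
have x0 : x != 0.
  apply: contraTneq isT => x0; have : Q *m x = 0 by rewrite x0 mulmx0.
  rewrite /x mulmxA QQ mul1mx => /colP/(_ i); rewrite !mxE !eqxx => /eqP.
  by rewrite oner_eq0.
have := A0 x x0; rewrite AE /x !mulmxA -(mulmxA _ Q) QQ mulmx1 frob_mulmxl trmxK.
rewrite !mulmxA QQ mul1mx frobC frob_delta mul_diag_mx mxE.
by rewrite mxE !eqxx mulr1.
Qed.

Lemma posdef_spectral A : posdef A -> exists Q (l : 'rV[R]_p),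
  [/\ Q *m Q^T = 1%:M, A = Q^T *m diag_mx l *m Q & forall i, 0 < l 0 i].
Proof.
move=> pA; have [Q [l [QQ AE]]] := real_spectral pA.1.
by exists Q, l; split=> //; exact: spectral_gt0 AE.
Qed.

Lemma mxtrace_spectral Q (l : 'rV[R]_p) : Q *m Q^T = 1%:M ->
  \tr (Q^T *m diag_mx l *m Q) = \sum_i l 0 i.
Proof. by move=> QQ; rewrite mxtrace_mulC mulmxA QQ mul1mx mxtrace_diag. Qed.

Lemma det_spectral Q (l : 'rV[R]_p) : Q *m Q^T = 1%:M ->
  \det (Q^T *m diag_mx l *m Q) = \prod_i l 0 i.
Proof.
move=> QQ; rewrite det_mulmx mulrC -det_mulmx mulmxA QQ mul1mx.
by rewrite det_diag.
Qed.

Lemma inv_spectral Q (l : 'rV[R]_p) : Q *m Q^T = 1%:M -> (forall i, 0 < l 0 i) ->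
  (Q^T *m diag_mx l *m Q) *m (Q^T *m diag_mx (map_mx GRing.inv l) *m Q) = 1%:M.
Proof.
move=> QQ l0; rewrite !mulmxA -(mulmxA _ Q) QQ mulmx1 -(mulmxA _ (diag_mx l)).
rewrite mulmx_diag (_ : diag_mx _ = 1%:M) ?mulmx1 ?(mulmx1C QQ)//.
rewrite -diag_const_mx; congr diag_mx; apply/rowP => i; rewrite !mxE.
by rewrite mulfV// lt0r_neq0.
Qed.

Lemma posdef_det_gt0 A : posdef A -> 0 < \det A.
Proof.
by move=> /posdef_spectral[Q [l [QQ -> l0]]]; rewrite det_spectral// prodr_gt0.
Qed.

Lemma posdef_unit A : posdef A -> A \in unitmx.
Proof. by move=> /posdef_det_gt0 dA; rewrite unitmxE unitfE lt0r_neq0. Qed.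

(** [specfun] picks an unspecified diagonalisation. The trace of the result is the sum of the
    logarithms of the eigenvalues found, hence the logarithm of the determinant whichever one is
    picked. *)
Lemma tr_mxln A : posdef A -> \tr (mxln A) = ln (\det A).
Proof.
move=> pA; have [Q [l [QQ AE l0]]] := posdef_spectral pA; rewrite /mxln /specfun.
case: xgetP => [B _ [Q' [l' [QQ' AE' ->]]]|]; last first.
  move=> /(_ (Q^T *m diag_mx (map_mx (@ln R) l) *m Q)) H; exfalso; apply: H.
  by exists Q, l.
have l'0 := spectral_gt0 pA QQ' AE'.
rewrite mxtrace_spectral// {1}AE' det_spectral// ln_prod//.
by apply: eq_bigr => i _; rewrite mxE.
Qed.

Lemma mulmx1_invmx A B : A *m B = 1%:M -> invmx A = B.
Proof.
move=> AB; have [uA _] := mulmx1_unit AB.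
by rewrite -[RHS]mul1mx -(mulVmx uA) -mulmxA AB mulmx1.
Qed.

Lemma posdef_inv A : posdef A -> posdef (invmx A).
Proof.
move=> pA; have [Q [l [QQ AE l0]]] := posdef_spectral pA.
rewrite (_ : invmx A = Q^T *m diag_mx (map_mx GRing.inv l) *m Q).
  by apply: spectral_posdef => // i; rewrite mxE invr_gt0.
by apply: mulmx1_invmx; rewrite AE; exact: inv_spectral.
Qed.

(* [m] lists the eigenvalues of [B^(-1/2) A B^(-1/2)]. *)
Lemma posdef_pair A B : posdef A -> posdef B -> exists m : 'I_p -> R,
  [/\ forall i, 0 < m i, \tr (A *m invmx B) = \sum_i m i,
      \tr (B *m invmx A) = \sum_i (m i)^-1,
      ln (\det A) - ln (\det B) = \sum_i ln (m i) &
      (forall i, m i = 1) -> A = B].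
Proof.
move=> pA pB; have [Q [l [QQ BE l0]]] := posdef_spectral pB.
(* No symmetric square root is formed: all that matters is [S B S^T = 1]. Here [S] is [B^(-1/2)]
   followed by a rotation, so [S A S^T] has the required spectrum. *)
pose r : 'rV[R]_p := \row_i (Num.sqrt (l 0 i))^-1.
pose S := diag_mx r *m Q.
have rlr : diag_mx r *m diag_mx l *m diag_mx r = 1%:M.
  rewrite !mulmx_diag -diag_const_mx; congr diag_mx; apply/rowP => i; rewrite !mxE.
  have li : Num.sqrt (l 0 i) != 0 by rewrite sqrtr_eq0 -ltNge.
  by rewrite -{2}(sqr_sqrtr (ltW (l0 i))); field.
have SBS : S *m (B *m S^T) = 1%:M.
  rewrite BE /S trmx_mul tr_diag_mx !mulmxA -(mulmxA _ Q Q^T) QQ mulmx1.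
  by rewrite -(mulmxA _ Q Q^T) QQ mulmx1.
clearbody S; have BSS : B *m S^T *m S = 1%:M := mulmx1C SBS.
have iB : invmx B = S^T *m S.
  by apply: mulmx1_invmx; rewrite mulmxA.
pose A1 := S *m A *m S^T.
have pA1 : posdef A1.
  have [As A0] := pA; split; first by rewrite /A1 !trmx_mul trmxK As mulmxA.
  move=> x x0; rewrite /A1 -!mulmxA frobC frob_mulmxl frobC.
  apply: A0; apply: contraNneq x0 => y0.
  by rewrite -[x]mul1mx -SBS -!mulmxA y0 !mulmx0.
have AE : A = B *m S^T *m A1 *m (S *m B).
  rewrite /A1 !mulmxA BSS mul1mx -!mulmxA (mulmxA S^T) -iB mulVmx ?mulmx1//.
  exact: posdef_unit.
have tA : \tr (A *m invmx B) = \tr A1 by rewrite iB mulmxA mxtrace_mulC mulmxA.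
have dA1 : \det A1 = \det S ^+ 2 * \det A by rewrite /A1 !det_mulmx det_tr; ring.
clearbody A1; have [P [m [PP A1E m0]]] := posdef_spectral pA1.
have A1I := inv_spectral PP m0; rewrite -A1E in A1I.
have tA1i : \tr (P^T *m diag_mx (map_mx GRing.inv m) *m P) = \sum_i (m 0 i)^-1.
  by rewrite mxtrace_spectral//; apply: eq_bigr => i _; rewrite mxE.
move: (P^T *m diag_mx (map_mx GRing.inv m) *m P) A1I tA1i => A1i A1I tA1i.
have iA : invmx A = S^T *m A1i *m S.
  apply: mulmx1_invmx.
  transitivity (B *m S^T *m A1 *m (S *m (B *m S^T)) *m A1i *m S).
    by rewrite {1}AE !mulmxA.
  by rewrite SBS mulmx1 -(mulmxA _ A1) A1I mulmx1.
have tB : \tr (B *m invmx A) = \tr A1i.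
  by rewrite iA !mulmxA mxtrace_mulC !mulmxA -(mulmxA S) SBS mul1mx.
have detS : \det S ^+ 2 * \det B = 1.
  have := congr1 determinant SBS; rewrite !det_mulmx det_tr det1 => <-; ring.
exists (fun i => m 0 i); split=> //.
- by rewrite tA A1E mxtrace_spectral.
- by rewrite tB.
- rewrite -ln_prod// -(det_spectral m PP) -A1E dA1.
  have dB := posdef_det_gt0 pB; have dA := posdef_det_gt0 pA.
  rewrite -ln_div ?posrE//; congr ln.
  apply: (mulIf (lt0r_neq0 dB)); rewrite divfK ?lt0r_neq0//.
  by rewrite -[LHS]mul1r -detS; ring.
- move=> m1; have A11 : A1 = 1%:M.
    rewrite A1E (_ : diag_mx m = 1%:M) ?mulmx1 ?(mulmx1C PP)//.
    by rewrite -diag_const_mx; congr diag_mx; apply/rowP => i; rewrite !mxE.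
  by rewrite AE A11 mulmx1 mulmxA BSS mul1mx.
Qed.

Lemma frob_gap A B : posdef A -> posdef B ->
  frob (A - B) (invmx B - invmx A) = \tr (A *m invmx B) + \tr (B *m invmx A) - 2 * p%:R.
Proof.
move=> pA pB; have [As _] := pA; have [Bs _] := pB.
rewrite frobE (_ : (A - B)^T = A - B); last by rewrite [LHS]linearB /= As Bs.
rewrite mulmxBl !mulmxBr.
rewrite !mulmxV ?posdef_unit// !mxtraceD !raddfN /= !mxtraceD !raddfN /= mxtrace1; ring.
Qed.

(** Each [m + 1/m - 2] is nonnegative and vanishes only for [m = 1]; if all vanish, then [A = B].
    This keeps the denominator of [lam_coef] away from zero. *)
Lemma frob_gap_gt0 A B : posdef A -> posdef B -> A != B ->
  0 < frob (A - B) (invmx B - invmx A).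
Proof.
move=> pA pB AB; have [m [m0 tA tB _ m1]] := posdef_pair pA pB.
rewrite frob_gap// tA tB.
have -> : \sum_i m i + \sum_i (m i)^-1 - 2 * p%:R = \sum_i (m i + (m i)^-1 - 2).
  by rewrite sumrB big_split /= sumr_const card_ord -[2 *+ p]mulr_natr.
have g0 i : 0 <= m i + (m i)^-1 - 2.
  by apply: le_trans (ln_sqr_le (m0 i)); exact: sqr_ge0.
rewrite lt_neqAle sumr_ge0// andbT; apply/negP; rewrite eq_sym psumr_eq0// => /allP H.
move/eqP: AB; apply; apply: m1 => i; apply/eqP/negPn/negP => mi.
have := H i; rewrite mem_index_enum => /(_ isT) /eqP E.
by have := inv_gap_gt0 (m0 i) mi; rewrite E ltxx.
Qed.

(** In terms of the eigenvalues the gap is the sum of [m + 1/m - 2], which dominates the sum of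
    [(ln m)^2]; the difference of log-determinants is the sum of the [ln m], and Cauchy-Schwarz
    compares the two. *)
Lemma frob_gap_ge_ln A B : posdef A -> posdef B ->
  (ln (\det A) - ln (\det B)) ^+ 2 <= p%:R * frob (A - B) (invmx B - invmx A).
Proof.
move=> pA pB; have [m [m0 tA tB dAB _]] := posdef_pair pA pB.
rewrite frob_gap// tA tB dAB.
have -> : \sum_i m i + \sum_i (m i)^-1 - 2 * p%:R = \sum_i (m i + (m i)^-1 - 2).
  by rewrite sumrB big_split /= sumr_const card_ord -[2 *+ p]mulr_natr.
apply: le_trans (sqr_sum_le _) _; apply: ler_wpM2l => //.
by apply: ler_sum => i _; exact: ln_sqr_le.
Qed.

End Posdef.

(** * Piecewise affine functions *)

Section MatrixLimits.
Context {R : realType}.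

Lemma cvg_sumr {V : normedModType R} {T : Type} (F : set_system T) {FF : Filter F}
    I (r : seq I) (P : pred I) (f : I -> T -> V) (l : I -> V) :
  (forall i, P i -> f i @ F --> l i) ->
  (\sum_(i <- r | P i) f i x) @[x --> F] --> \sum_(i <- r | P i) l i.
Proof.
move=> H; elim: r => [|a r IH].
  rewrite big_nil (funext (fun x => big_nil _ _ P (f ^~ x))); exact: cvg_cst.
rewrite big_cons (funext (fun x => big_cons _ _ a r P (f ^~ x))).
case Pa: (P a) => //; apply: cvgD => //; exact: H.
Qed.

Lemma cvg_mx {T : Type} (F : set_system T) {FF : Filter F} p q (f : T -> 'M[R]_(p, q)) (l : 'M[R]_(p, q)) :
  (forall i j, f x i j @[x --> F] --> l i j) -> f @ F --> l.
Proof.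
move=> H; rewrite [l]matrix_sum_delta.
rewrite (_ : f = fun x => \sum_i \sum_j f x i j *: delta_mx i j); last first.
  by apply/funext => x; exact: matrix_sum_delta.
apply: cvg_sumr => i _; apply: cvg_sumr => j _.
by apply: cvgZl; exact: H.
Qed.

Lemma is_derive_mx {V : normedModType R} p q (f : V -> 'M[R]_(p, q)) (x v : V) (l : 'M[R]_(p, q)) :
  (forall i j, is_derive x v (fun y => f y i j) (l i j)) -> is_derive x v f l.
Proof.
move=> H.
have cvl : (fun h => h^-1 *: ((f \o shift x) (h *: v) - f x)) @ 0^' --> l.
  apply: cvg_mx => i j; have [df <-] := H i j.
  rewrite (_ : (fun h => _) = (fun h => h^-1 *: (((fun y => f y i j) \o shift x) (h *: v) - f x i j))).
    exact: df.
  by apply/funext => h; rewrite !mxE.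
by apply: DeriveDef; [apply/cvg_ex; exists l|apply: cvg_lim].
Qed.

End MatrixLimits.

Section SimplexLimits.
Context {R : realType} {m d : nat}.
Implicit Types v : 'I_m.+1 -> 'cV[R]_d.

Lemma osimplex_near v x (c : 'I_m.+1 -> R) : osimplex v x -> \sum_k c k = 0 ->
  \forall h \near (0 : R), osimplex v (h *: (\sum_k c k *: v k) + x).
Proof.
move=> [l [l0 l1 ->]] c0.
have H : \forall h \near (0 : R), forall k, 0 < h * c k + l k.
  apply: (@filter_forall _ _ (fun k (h : R) => is_true (0 < h * c k + l k)) _
    (nbhs_filter (0 : R))) => k.
  have cH : (fun h : R => h * c k + l k) @ (0 : R) --> 0 * c k + l k.
    by apply: cvgD; [apply: cvgMl; exact: cvg_id|exact: cvg_cst].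
  rewrite mul0r add0r in cH.
  have N : nbhs (l k : R) [set y : R | 0 < y] by apply: open_nbhs_nbhs; split; [exact: open_gt|exact: l0].
  exact: (cH _ N).
near=> h; exists (fun k => h * c k + l k); split.
- exact: (near H h).
- by rewrite big_split /= -mulr_sumr c0 mulr0 add0r.
- rewrite scaler_sumr -big_split; apply: eq_bigr => k _.
  by rewrite scalerDl scalerA.
Unshelve. all: by end_near. Qed.

Definition barycenter v : 'cV[R]_d := \sum_k m.+1%:R^-1 *: v k.

Lemma osimplex_segment v k e : 0 < e <= 1 ->
  osimplex v (v k + e *: (barycenter v - v k)).
Proof.
move=> /andP[e0 e1]; exists (fun j => (1 - e) * (j == k)%:R + e * m.+1%:R^-1); split.
- move=> j; apply: ltr_wpDl; last by rewrite mulr_gt0// invr_gt0 ltr0n.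
  by rewrite mulr_ge0// subr_ge0.
- rewrite big_split /= -!mulr_sumr sum_eq sumr_const card_ord mulr1 -[_^-1 *+ _]mulr_natr.
  by rewrite mulVf ?mulr1 ?subrK// pnatr_eq0.
- under [RHS]eq_bigr do rewrite scalerDl -!scalerA.
  rewrite big_split /= -!scaler_sumr sum_delta scalerBl scale1r scalerBr addrA addrAC.
  by rewrite /barycenter scaler_sumr.
Qed.

(** The segment from a vertex to the barycentre runs inside the open simplex. Properness of the
    filter makes limits at the vertex unique, so the [lim] in mass lumping can be evaluated. *)
Global Instance within_osimplex_proper v k :
  ProperFilter (within (osimplex v) (nbhs (v k))).
Proof.
apply: within_nbhs_proper => B nB.
have [e [e01 Be]] : exists e : R, 0 < e <= 1 /\ B (v k + e *: (barycenter v - v k)).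
  apply: (@filter_ex _ (0 : R)^'+); near=> e; split.
    by apply/andP; split; near: e; [exact: nbhs_right_gt|exact: nbhs_right_le].
  by near: e; exact: line_near.
by exists (v k + e *: (barycenter v - v k)); split=> //; exact: osimplex_segment.
Unshelve. all: by end_near. Qed.

Lemma cvg_within_osimplex v k (f g : 'cV[R]_d -> R) :
  (forall x, osimplex v x -> f x = g x) -> {for v k, continuous g} ->
  f x @[x --> within (osimplex v) (nbhs (v k))] --> g (v k).
Proof.
move=> fg cg; apply: (@cvg_trans _ (g x @[x --> within (osimplex v) (nbhs (v k))])).
  apply: near_eq_cvg; rewrite near_withinE; apply: nearW => x xv.
  by rewrite fg.
exact: cvg_within_filter.
Qed.

End SimplexLimits.

Section Glue.
Context {R : realType} {m d N : nat}.
Variable v : 'I_N -> 'I_m.+1 -> 'cV[R]_d.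

(* The continuous function that is affine on each [v s] and equals [g] at the
   vertices; it is 0 off the simplices. *)
Definition glue (g : 'cV[R]_d -> R) x : R :=
  if pselect (exists s, csimplex (v s) x) is left e
  then let s := projT1 (cid e) in \sum_k bary (v s) k x * g (v s k) else 0.

Hypothesis nv : forall s, nondeg (v s).
Hypothesis conf : forall s s', csimplex (v s) `&` csimplex (v s') `<=`
  face (v s) [set k | [exists k', v s k == v s' k']]%SET.

(** Independence of the chosen simplex: by conformity a common point has nonzero coordinates only at
    shared vertices, where both formulas use the same value of [g]. *)
Lemma glueE g s x : csimplex (v s) x -> glue g x = \sum_k bary (v s) k x * g (v s k).
Proof.
move=> xs; rewrite /glue; case: pselect => [e|ne]; last by exfalso; apply: ne; exists s.
case: cid => s' /= xs'.
have /(face_bary (nv s)) xf := conf (conj xs xs').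
have [_ xE] := (csimplexP (nv s) x).1 xs.
have bE k' : bary (v s') k' x = \sum_k bary (v s) k x * bary (v s') k' (v s k).
  by rewrite {1}xE bary_sum// sum_bary.
under eq_bigr do rewrite bE mulr_suml; rewrite exchange_big /=.
apply: eq_bigr => k _; under eq_bigr do rewrite -mulrA; rewrite -mulr_sumr.
have [kJ|/xf ->] := boolP (k \in [set k | [exists k', v s k == v s' k']]%SET); last by rewrite !mul0r.
move: kJ; rewrite inE => /existsP[k' /eqP kk']; congr (_ * _).
rewrite kk'; under eq_bigr do rewrite bary_vertex//.
exact: (sum_delta (V := R^o) (fun j => g (v s' j)) k').
Qed.

Lemma glue_vertex g s k : glue g (v s k) = g (v s k).
Proof.
rewrite (glueE g (@vertex_csimplex _ _ _ (v s) k)).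
under eq_bigr do rewrite bary_vertex//.
exact: (sum_delta (V := R^o) (fun j => g (v s j)) k).
Qed.

(** The finitely many closed simplices that miss [x] stay away from a neighbourhood of it, and on
    each simplex containing [x] the function is polynomial. *)
Lemma glue_continuous g :
  {within \bigcup_s csimplex (v s), continuous (glue g)}.
Proof.
apply/subspace_continuousP => x _; apply/cvgrPdist_lt => e e0.
suff : \forall y \near x, forall s, csimplex (v s) y -> `|glue g x - glue g y| < e.
  by move=> H; rewrite near_withinE; apply: filterS H => y Hy [s _]; exact: Hy.
apply: (@filter_forall _ _ (fun s y => csimplex (v s) y -> is_true (`|glue g x - glue g y| < e))
  _ (nbhs_filter x)) => s.
have [xs|xs] := pselect (csimplex (v s) x); last first.
  have H : \forall y \near x, (~` csimplex (v s)) y.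
    by apply: open_nbhs_nbhs; split=> //; apply: closed_openC; exact: csimplex_closed.
  by apply: filterS H => y /= Hy /Hy.
pose G y := \sum_k bary (v s) k y * g (v s k).
have cG : continuous G.
  apply: polyf_continuous; apply: polyf_sum => k _.
  by apply: polyfM; [exact: polyf_bary|exact: polyf_cst].
have := cG x; move/cvgrPdist_lt => /(_ e e0); apply: filterS => y + ys.
by rewrite (glueE g xs) (glueE g ys).
Qed.

End Glue.

Section AffineFunctions.
Context {R : realType} {d : nat}.

Lemma affine_poly_on D (f : 'cV[R]_d -> R) c a :
  (forall x, D x -> f x = c + frob a x) -> poly_on D 1 f.
Proof.
move=> fE; exists d.+1, (fun m => if unlift ord0 m is Some i then a i 0 else c),
  (fun m i => (m == lift ord0 i) : nat); split=> [m|x /fE ->].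
  case: (unliftP ord0 m) => [j|] ->.
    rewrite (bigD1 j)//= eqxx big1 // => i /negbTE ij.
    by rewrite (inj_eq lift_inj) eq_sym ij.
  by rewrite big1// => i _; rewrite (negbTE (neq_lift _ _)).
rewrite big_ord_recl unlift_none big1 ?mulr1 => [|i _]; last first.
  by rewrite (negbTE (neq_lift _ _)) expr0.
congr (_ + _); rewrite frob_col; apply: eq_bigr => j _; rewrite liftK.
rewrite (bigD1 j)//= eqxx expr1 big1 ?mulr1// => i /negbTE ij.
by rewrite (inj_eq lift_inj) eq_sym ij.
Qed.

Lemma poly_on1_affine D (f : 'cV[R]_d -> R) : poly_on D 1 f ->
  exists c a, forall x, D x -> f x = c + frob a x.
Proof.
move=> [N [c [a [a1 fE]]]].
have mono (e : 'I_d -> nat) : (\sum_i e i <= 1)%N ->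
    exists c a, forall x : 'cV[R]_d, \prod_i x i 0 ^+ e i = c + frob a x.
  move=> e1; have [e0|] := boolP [forall i, e i == 0%N].
    exists 1, 0 => x; rewrite frob0l addr0 big1// => i _.
    by rewrite (eqP (forallP e0 i)).
  rewrite negb_forall => /existsP[j ej]; exists 0, (delta_mx j 0) => x.
  rewrite add0r frobC frob_delta (bigD1 j)//= big1 => [|i ij].
    have -> : e j = 1%N; last by rewrite mulr1.
    apply/eqP; rewrite eqn_leq lt0n ej andbT; apply: leq_trans e1.
    by rewrite (bigD1 j)//= leq_addr.
  have -> : e i = 0%N => //.
  apply/eqP; rewrite -leqn0 -(leq_add2l 1) addn0; apply: leq_trans e1.
  rewrite (bigD1 j)//= (bigD1 i)//= addnA; apply: leq_trans (leq_addr _ _).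
  by rewrite leq_add2r lt0n.
have [c' c'E] := choice (fun m => mono _ (a1 m)); have [a' a'E] := choice c'E.
exists (\sum_m c m * c' m), (\sum_m c m *: a' m) => x /fE ->.
rewrite frob_suml -big_split; apply: eq_bigr => m _ /=.
by rewrite a'E mulrDr frobZl.
Qed.

End AffineFunctions.

Section DeriveBary.
Context {R : realType} {V : normedModType R}.

(** A direction with zero coefficient sum keeps the point in the open simplex for small times, so
    [f] need only be known there. This also covers elements of a surface, where nothing is known off
    the element. *)
Lemma derive_bary_tangent m d (v : 'I_m.+1 -> 'cV[R]_d) (f : 'cV[R]_d -> V) c a x :
  nondeg v -> (forall y, osimplex v y -> f y = \sum_k bary v k y *: c k) ->
  osimplex v x -> \sum_k a k = 0 -> is_derive x (\sum_k a k *: v k) f (\sum_k a k *: c k).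
Proof.
move=> nv fE xv a0; apply: is_derive_near_affine.
have H := osimplex_near xv a0.
have {}H : \forall h \near 0^', osimplex v (h *: (\sum_k a k *: v k) + x).
  exact: cvg_within H.
near=> h; rewrite (fE _ (near H h _))// (fE _ xv) [X in _ = _ + X]scaler_sumr -big_split.
apply: eq_bigr => k _ /=; rewrite baryD scalerDl scalerA; congr (_ + (_ * _) *: _).
rewrite frob_sumr; under eq_bigr do rewrite frobZr.
have -> : a k = \sum_i a i * frob (gbary v k) (v i - v ord0); last first.
  under [RHS]eq_bigr do rewrite frobBr mulrBr.
  by rewrite sumrB -mulr_suml a0 mul0r subr0.
under eq_bigr do rewrite gbary_edge// mulrBr.
rewrite sumrB -mulr_suml a0 mul0r subr0 (bigD1 k)//= eqxx mulr1 big1 ?addr0// => i /negbTE ik.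
by rewrite eq_sym ik mulr0.
Unshelve. all: by end_near. Qed.

Lemma derive_bary m (v : 'I_m.+1 -> 'cV[R]_m) (f : 'cV[R]_m -> V) c x w :
  nondeg v -> (forall y, osimplex v y -> f y = \sum_k bary v k y *: c k) ->
  osimplex v x -> is_derive x w f (\sum_k frob (gbary v k) w *: c k).
Proof.
move=> nv fE xv; rewrite -{1}(gbary_square w nv); apply: derive_bary_tangent => //.
by rewrite -frob_suml sum_gbary frob0l.
Qed.

End DeriveBary.

Section FiniteElements.
Context {R : realType} {n : nat}.
Local Notation d := n.+1.
Local Notation pt := 'cV[R]_d.
Variables (Om : set pt) (M : @mesh R n).
Hypothesis hM : regular_partition Om M.
Local Notation K_ := (@cell _ _ M).
Local Notation mesh_nondeg := (mesh_nondeg hM).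

Lemma mesh_conf K K' : csimplex (K_ K) `&` csimplex (K_ K') `<=`
  face (K_ K) [set k | [exists k', K_ K k == K_ K' k']]%SET.
Proof. by case: hM => _ _ _ _; exact. Qed.

Lemma closure_cells : closure Om = \bigcup_K csimplex (K_ K).
Proof. by case: hM. Qed.

Lemma vertex_closure K k : closure Om (K_ K k).
Proof. by rewrite closure_cells; exists K => //; exact: vertex_csimplex. Qed.

Lemma osimplex_closure K x : osimplex (K_ K) x -> closure Om x.
Proof. by rewrite closure_cells => xK; exists K => //; exact: osimplex_csimplex. Qed.

Lemma Sh1_bary f K x : Sh Om M 1 f -> csimplex (K_ K) x ->
  f x = \sum_k bary (K_ K) k x * f (K_ K k).
Proof.
move=> [_ /(_ K) /poly_on1_affine[c [a fE]]] xK; rewrite (fE _ xK).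
rewrite {1}(bary_square x (mesh_nondeg K)) frob_sumr -[c in LHS]mul1r.
rewrite -(sum_bary (K_ K) x) mulr_suml -big_split; apply: eq_bigr => k _ /=.
by rewrite fE ?frobZr ?mulrDr//; exact: vertex_csimplex.
Qed.

Lemma glue_Sh1 g : Sh Om M 1 (glue K_ g).
Proof.
split; first by rewrite closure_cells; apply: glue_continuous => //; [exact: mesh_nondeg|exact: mesh_conf].
move=> K; apply: (@affine_poly_on _ _ _ _ (\sum_k ((k == ord0)%:R - frob (gbary (K_ K) k) (K_ K ord0)) * g (K_ K k))
  (\sum_k g (K_ K k) *: gbary (K_ K) k)) => x xK.
rewrite (glueE mesh_nondeg mesh_conf g xK) frob_suml -big_split; apply: eq_bigr => k _ /=.
by rewrite /bary frobBr frobZl; ring.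
Qed.

Lemma lagrange_node1 z : lagrange_node M 1 z <-> exists K k, z = K_ K k.
Proof.
split=> [[K [a [a1 ->]]]|[K [k ->]]]; last first.
  exists K, (fun j => (j == k) : nat); split.
    by rewrite (bigD1 k)//= eqxx big1 // => j /negbTE ->.
  by under [RHS]eq_bigr do rewrite divr1; rewrite sum_delta.
have [k ak] : exists k, a k != 0%N.
  apply: contrapT => H; move: a1; rewrite big1 // => j _.
  by apply/eqP/negPn/negP => aj; apply: H; exists j.
have ak1 : a k = 1%N.
  apply/eqP; rewrite eqn_leq lt0n ak andbT -a1 (bigD1 k)//= leq_addr //.
exists K, k; rewrite (bigD1 k)//= ak1 divr1 scale1r big1 ?addr0// => j jk.
have -> : a j = 0%N; last by rewrite mul0r scale0r.
move: a1; rewrite (bigD1 k)//= ak1 (bigD1 j)//= => /eqP.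
by rewrite -{2}[1%N]addn0 eqn_add2l addn_eq0 => /andP[/eqP].
Qed.

(** The interpolant is a choice from a set of candidates; the glued nodal function shows that the
    set is inhabited. *)
Lemma interp1_spec g : Sh Om M 1 (interp Om M 1 g) /\
  forall K k, interp Om M 1 g (K_ K k) = g (K_ K k).
Proof.
have [|S H] := @xgetPex _ (fun=> 0)
  [set f | Sh Om M 1 f /\ forall z, lagrange_node M 1 z -> f z = g z] _.
  exists (glue K_ g); split; first exact: glue_Sh1.
  move=> z /lagrange_node1[K [k ->]]; apply: glue_vertex.
  - exact: mesh_nondeg.
  - exact: mesh_conf.
by split=> // K k; apply: H; apply/lagrange_node1; exists K, k.
Qed.

Lemma interp1E g K x : csimplex (K_ K) x ->
  interp Om M 1 g x = \sum_k bary (K_ K) k x * g (K_ K k).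
Proof.
have [S gE] := interp1_spec g; move=> xK; rewrite (Sh1_bary S xK).
by under eq_bigr do rewrite gE.
Qed.

Lemma interp_mx1E p q (g : pt -> 'M[R]_(p, q)) K x : csimplex (K_ K) x ->
  interp_mx Om M 1 g x = \sum_k bary (K_ K) k x *: g (K_ K k).
Proof.
move=> xK; apply/matrixP => i j; rewrite mxE summxE (interp1E _ xK).
by apply: eq_bigr => k _; rewrite mxE.
Qed.

Lemma SSh_bary B K x : SSh Om M B -> csimplex (K_ K) x ->
  B x = \sum_k bary (K_ K) k x *: B (K_ K k).
Proof.
move=> [_ SB] xK; apply/matrixP => i j; rewrite summxE (Sh1_bary (SB i j) xK).
by apply: eq_bigr => k _; rewrite mxE.
Qed.

Lemma pwconstE {V : lmodType R} (c : 'I_(ncell M) -> V) K x : osimplex (K_ K) x ->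
  pwconst c x = c K.
Proof.
move=> xK; rewrite /pwconst (bigD1 K)//= indicE mem_set// scale1r big1 ?addr0// => K' KK'.
rewrite indicE memNset ?scale0r// => xK'; move/eqP: KK'; apply.
exact: (osimplex_disjoint hM xK' xK).
Qed.

Lemma lumpE f (F : 'I_(ncell M) -> 'I_d.+1 -> R) :
  (forall K k, f p @[p --> within (osimplex (K_ K)) (nbhs (K_ K k))] --> F K k) ->
  lump M f = d.+1%:R^-1 * \sum_K vol (osimplex (K_ K)) * \sum_k F K k.
Proof.
move=> H; rewrite /lump; congr (_ * _); apply: eq_bigr => K _; congr (_ * _).
by apply: eq_bigr => k _; apply: cvg_lim.
Qed.

Lemma intOm_ext f g : (forall K x, osimplex (K_ K) x -> f x = g x) -> intOm M f = intOm M g.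
Proof. by move=> fg; apply: eq_bigr => K _; apply: Lint_ext; exact: fg. Qed.

End FiniteElements.

(** * One-sided time derivatives *)

Section TimeCalculus.
Context {R : realType} (T : R) (t : R).
Hypothesis t0T : 0 < t <= T.
Local Notation W := (within `[0, T]%classic (t^')).

(** As [t > 0], points of [[0, T]] accumulate at [t] from the left, also for [t = T]. Hence
    one-sided time derivatives are unique. *)
Lemma time_filter_proper : ProperFilter W.
Proof.
apply: Build_ProperFilter => H.
have H1 : \forall s \near t, s != t -> ~ (`[0, T]%classic s) by exact: H.
have [s [[st s0] Hs]] : exists s, (s < t /\ 0 < s) /\ (s != t -> ~ (`[0, T]%classic s)).
  have /andP[tp _] := t0T.
  apply: (@filter_ex _ t^'-); near=> s; split; last first.
    by near: s; apply: cvg_within H1.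
  by split; near: s; [exact: nbhs_left_lt|exact: nbhs_left_gt].
apply: Hs; first by rewrite lt_eqF.
have /andP[_ tT] := t0T.
by rewrite /= in_itv /= (ltW s0) (le_trans (ltW st)).
Unshelve. all: by end_near. Qed.

Let time_proper := time_filter_proper.
Local Existing Instance time_proper.

Lemma has_ddt_ddt {V : normedModType R} (f : R -> V) l : has_ddt T f t l -> ddt T f t = l.
Proof. by move=> fl; apply: cvg_lim. Qed.

Lemma ex_ddtP {V : normedModType R} (f : R -> V) : ex_ddt T f t -> has_ddt T f t (ddt T f t).
Proof. by []. Qed.

Lemma has_ddt_ext {V : normedModType R} (f g : R -> V) l :
  (forall s, 0 <= s <= T -> f s = g s) -> has_ddt T f t l -> has_ddt T g t l.
Proof.
move=> fg; apply: cvg_trans; apply: near_eq_cvg; rewrite near_withinE.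
have /andP[tp tT] := t0T.
apply: nearW => s; rewrite /= in_itv /= => s0T.
by rewrite !fg// (ltW tp) tT.
Qed.

Lemma time_neq : \forall s \near W, s != t.
Proof. by rewrite near_withinE; near=> s => _; near: s; exact: nbhs_dnbhs_neq.
Unshelve. all: by end_near. Qed.

Lemma cvg_time : s @[s --> W] --> t.
Proof.
apply: cvg_trans (@cvg_id _ (nbhs t)); apply: cvg_trans (cvg_within _).
exact: cvg_within.
Qed.

Lemma has_ddt_cvg {V : normedModType R} (f : R -> V) l : has_ddt T f t l ->
  f s @[s --> W] --> f t.
Proof.
move=> fl; have : (s - t) *: ((s - t)^-1 *: (f s - f t)) + f t @[s --> W] --> (t - t) *: l + f t.
  apply: cvgD; last exact: cvg_cst.
  by apply: cvgZ => //; apply: cvgB; [exact: cvg_time|exact: cvg_cst].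
rewrite subrr scale0r add0r; apply: cvg_trans; apply: near_eq_cvg.
near=> s; have st : s != t by near: s; exact: time_neq.
by rewrite scalerA mulfV ?subr_eq0// scale1r subrK.
Unshelve. all: by end_near. Qed.

Lemma has_ddt_cst {V : normedModType R} (c : V) : has_ddt T (fun=> c) t 0.
Proof.
rewrite /has_ddt /tquot (_ : (fun s => _) = fun=> 0); first exact: cvg_cst.
by apply/funext => s; rewrite subrr scaler0.
Qed.

Lemma has_ddtD {V : normedModType R} (f g : R -> V) l l' :
  has_ddt T f t l -> has_ddt T g t l' -> has_ddt T (fun s => f s + g s) t (l + l').
Proof.
move=> fl gl; rewrite /has_ddt /tquot.
rewrite (_ : (fun s => _) = fun s => (s - t)^-1 *: (f s - f t) + (s - t)^-1 *: (g s - g t)).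
  exact: cvgD.
by apply/funext => s; rewrite -scalerDr opprD addrACA.
Qed.

Lemma has_ddtZ {V : normedModType R} (f : R -> V) l (c : R) :
  has_ddt T f t l -> has_ddt T (fun s => c *: f s) t (c *: l).
Proof.
move=> fl; rewrite /has_ddt /tquot.
rewrite (_ : (fun s => _) = fun s => c *: ((s - t)^-1 *: (f s - f t))).
  by apply: cvgZ => //; exact: cvg_cst.
by apply/funext => s; rewrite -scalerBr !scalerA mulrC.
Qed.

Lemma has_ddt_sum {V : normedModType R} I (r : seq I) (P : pred I) (f : I -> R -> V) l :
  (forall i, P i -> has_ddt T (f i) t (l i)) ->
  has_ddt T (fun s => \sum_(i <- r | P i) f i s) t (\sum_(i <- r | P i) l i).
Proof.
move=> H; elim: r => [|a r IH].
  rewrite big_nil (funext (fun x => big_nil _ _ P (f ^~ x))); exact: has_ddt_cst.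
rewrite big_cons (funext (fun x => big_cons _ _ a r P (f ^~ x))).
by case Pa: (P a) => //; apply: has_ddtD => //; exact: H.
Qed.

Lemma has_ddtM (f g : R -> R^o) (l l' : R) :
  has_ddt T f t l -> has_ddt T g t l' ->
  has_ddt T (fun s => f s * g s : R^o) t (f t * l' + l * g t).
Proof.
move=> fl gl; rewrite /has_ddt /tquot.
rewrite (_ : (fun s => _) = fun s => f s *: ((s - t)^-1 *: (g s - g t)) +
    ((s - t)^-1 *: (f s - f t)) * g t).
  apply: cvgD; first by apply: cvgZ => //; exact: has_ddt_cvg fl.
  by apply: cvgM => //; exact: cvg_cst.
apply/funext => s; rewrite /GRing.scale /=; ring.
Qed.

Lemma has_ddt_comp (f : R -> R^o) l (h : R -> R) h' : has_ddt T f t l ->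
  is_derive (f t : R) 1 h h' -> has_ddt T (fun s => h (f s) : R^o) t (h' * l).
Proof.
(* Caratheodory's form of differentiability avoids dividing by [f s - f t], which may vanish for [s]
   near [t]. *)
move=> fl /is_derive1_caratheodory[k [kE ck <-]]; rewrite /has_ddt /tquot.
rewrite (_ : (fun s => _) = fun s => k (f s) *: ((s - t)^-1 *: (f s - f t))).
  apply: cvgZ => //; apply: (@cvg_comp _ _ _ f k _ (nbhs (f t))) => //.
  exact: has_ddt_cvg fl.
by apply/funext => s; rewrite kE !scalerA /GRing.scale /=; ring.
Qed.

Lemma has_ddt_mxP p q (f : R -> 'M[R]_(p, q)) l : has_ddt T f t l <->
  forall i j, has_ddt T (fun s => f s i j : R^o) t (l i j).
Proof.
have E i j : (fun s => (s - t)^-1 *: (f s i j - f t i j) : R^o) =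
    (fun s => ((s - t)^-1 *: (f s - f t)) i j) by apply/funext => s; rewrite !mxE.
split=> [fl i j|fl].
  rewrite /has_ddt /tquot E.
  apply: (@cvg_comp _ _ _ (fun s => (s - t)^-1 *: (f s - f t)) (fun M : 'M[R]_(p, q) => M i j) _ (nbhs l)) => //.
  exact: coord_continuous.
by apply: cvg_mx => i j; have := fl i j; rewrite /has_ddt /tquot E.
Qed.

End TimeCalculus.

(** * Time derivatives of determinants, inverses and area elements *)

Section TimeDeterminant.
Context {R : realType} (T : R) (t : R).
Hypothesis t0T : 0 < t <= T.
Local Notation has_ddtR f l := (@has_ddt R R^o T f t l).
Local Notation ex_ddtR f := (@ex_ddt R R^o T f t).

Lemma has_ddt_prod_seq (I : eqType) (r : seq I) (f : I -> R -> R) (f' : I -> R) :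
  uniq r -> (forall i, has_ddtR (f i) (f' i)) ->
  has_ddtR (fun s => \prod_(i <- r) f i s) (\sum_(i <- r) f' i * \prod_(j <- r | j != i) f j t).
Proof.
move=> ur ff'; elim: r ur => [_|a r IH] /=.
  rewrite big_nil (funext (fun x => big_nil _ _ xpredT (f ^~ x))).
  exact: has_ddt_cst.
move=> /andP[ar ur]; rewrite (funext (fun x => big_cons _ _ a r xpredT (f ^~ x))) /=.
have := has_ddtM (ff' a) (IH ur).
rewrite addrC; congr (has_ddt _ _ _ _).
rewrite [RHS]big_cons big_cons eqxx /=; congr (_ * _ + _).
  rewrite big_seq_cond [RHS]big_seq_cond; apply: eq_bigl => i; rewrite andbT.
  by case ir: (i \in r) => //=; rewrite (memPn ar _ ir).
rewrite mulr_sumr; apply: eq_big_seq => i ir.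
by rewrite big_cons eq_sym (memPn ar _ ir) mulrCA.
Qed.

(** Jacobi's formula. Expanding along row [i], the trace is the sum over [i] of determinants with
    that row replaced by the one of [A']; the product rule in the Leibniz formula gives the same
    terms. *)
Lemma has_ddt_det p (A : R -> 'M[R]_p) A' : has_ddt T A t A' ->
  has_ddtR (fun s => \det (A s)) (\tr (\adj (A t) *m A')).
Proof.
move=> /has_ddt_mxP AA'.
pose D i : 'M[R]_p := \matrix_(k, l) (if k == i then A' k l else A t k l).
have -> : \tr (\adj (A t) *m A') = \sum_i \det (D i).
  rewrite mxtrace_mulC; apply: eq_bigr => i _; rewrite mxE (expand_det_row _ i).
  apply: eq_bigr => j _; rewrite !mxE eqxx; congr (_ * _); rewrite /cofactor.
  congr (_ * \det _); apply/matrixP => k l; rewrite !mxE.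
  by rewrite eq_sym (negbTE (neq_lift _ _)).
rewrite /determinant exchange_big /=.
apply: has_ddt_sum => s _.
have -> : \sum_i (-1) ^+ s * \prod_i0 D i i0 (s i0) =
   (-1) ^+ s *: (\sum_i A' i (s i) * \prod_(j | j != i) A t j (s j)).
  rewrite scaler_sumr; apply: eq_bigr => i _; congr (_ * _).
  rewrite (bigD1 i)//= mxE eqxx; congr (_ * _); apply: eq_bigr => j /negbTE ji.
  by rewrite mxE ji.
apply: has_ddtZ; apply: has_ddt_prod_seq; first exact: index_enum_uniq.
by move=> i; exact: AA'.
Qed.

Lemma has_ddt_mulmx p q r (A : R -> 'M[R]_(p, q)) (B : R -> 'M[R]_(q, r)) A' B' :
  has_ddt T A t A' -> has_ddt T B t B' ->
  has_ddt T (fun s => A s *m B s) t (A t *m B' + A' *m B t).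
Proof.
move=> /has_ddt_mxP AA' /has_ddt_mxP BB'.
apply/has_ddt_mxP => i j; rewrite !mxE -big_split /=.
rewrite (_ : (fun s => _) = fun s => \sum_k A s i k * B s k j); last first.
  by apply/funext => s; rewrite mxE.
by apply: has_ddt_sum => k _; exact: has_ddtM.
Qed.

Lemma has_ddt_trmx p q (A : R -> 'M[R]_(p, q)) A' :
  has_ddt T A t A' -> has_ddt T (fun s => (A s)^T) t A'^T.
Proof.
move=> /has_ddt_mxP AA'; apply/has_ddt_mxP => i j; rewrite mxE.
rewrite (_ : (fun s => _) = fun s => A s j i)//.
by apply/funext => s; rewrite mxE.
Qed.

Lemma has_ddt_frob p q (A B : R -> 'M[R]_(p, q)) A' B' :
  has_ddt T A t A' -> has_ddt T B t B' ->
  has_ddtR (fun s => frob (A s) (B s)) (frob (A t) B' + frob A' (B t)).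
Proof.
move=> /has_ddt_mxP AA' /has_ddt_mxP BB'.
rewrite /frob -big_split; apply: has_ddt_sum => i _; rewrite -big_split.
by apply: has_ddt_sum => j _; exact: has_ddtM.
Qed.

Lemma has_ddt_tr p (A : R -> 'M[R]_p) A' :
  has_ddt T A t A' -> has_ddtR (fun s => \tr (A s)) (\tr A').
Proof. by move=> /has_ddt_mxP AA'; apply: has_ddt_sum => i _; exact: AA'. Qed.

Lemma ex_ddt_mx p q (f : R -> 'M[R]_(p, q)) :
  (forall i j, ex_ddtR (fun s => f s i j)) -> ex_ddt T f t.
Proof.
move=> fij; apply/cvg_ex.
exists (\matrix_(i, j) @ddt R R^o T (fun s => f s i j) t); apply/has_ddt_mxP => i j.
by rewrite mxE; exact: fij.
Qed.

(** Cramer's formula: the entries of the inverse are minors over the determinant, and all of these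
    inherit differentiability. *)
Lemma ex_ddt_invmx p (A : R -> 'M[R]_p) : (forall s, 0 <= s <= T -> A s \in unitmx) ->
  ex_ddt T A t -> ex_ddt T (fun s => invmx (A s)) t.
Proof.
move=> uA /cvg_ex[A' AA'].
have tT : 0 <= t <= T by have /andP[/ltW -> ->] := t0T.
have dA0 s : 0 <= s <= T -> \det (A s) != 0 by move=> /uA; rewrite unitmxE unitfE.
have iE s : 0 <= s <= T -> (\det (A s))^-1 *: \adj (A s) = invmx (A s).
  by move=> /uA u; rewrite /invmx u.
have dinv := has_ddt_comp (has_ddt_det AA') (is_deriveV (f := id) (dA0 _ tT) (is_derive_id _ _)).
have cof i j : exists l, has_ddtR (fun s => \adj (A s) i j) l.
  have H : has_ddt T (fun s => row' j (col' i (A s))) t (row' j (col' i A')).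
    apply/has_ddt_mxP => k l; rewrite !mxE.
    rewrite (_ : (fun s => _) = fun s => A s (lift j k) (lift i l)).
      by move/has_ddt_mxP : AA'; exact.
    by apply/funext => s; rewrite !mxE.
  eexists; rewrite (_ : (fun s => _) = fun s => (-1) ^+ (j + i) *: (\det (row' j (col' i (A s))) : R^o)).
    exact: has_ddtZ (has_ddt_det H).
  by apply/funext => s; rewrite mxE.
apply: ex_ddt_mx => i j; have [l Hl] := cof i j.
apply/cvg_ex; eexists; apply: (has_ddt_ext (T := T) t0T (f := fun s => (\det (A s))^-1 * \adj (A s) i j)).
  by move=> s /iE <-; rewrite [RHS]mxE.
exact: has_ddtM dinv Hl.
Qed.

Lemma has_ddt_ln_det p (A : R -> 'M[R]_p) A' : 0 < \det (A t) -> has_ddt T A t A' ->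
  has_ddtR (fun s => ln (\det (A s))) (\tr (invmx (A t) *m A')).
Proof.
move=> dA /has_ddt_det AA'; have := has_ddt_comp AA' (is_derive1_ln dA).
congr (has_ddt _ _ _ _); rewrite /invmx unitmxE unitfE lt0r_neq0//.
by rewrite -scalemxAl mxtraceZ.
Qed.

(** Jacobi's formula under the square root. The derivative of [E^T E] has two transposed parts with
    equal traces, and the resulting 2 cancels the [1/2] of the root. *)
Lemma has_ddt_gram m d (v : R -> 'I_m.+1 -> 'cV[R]_d) v' :
  0 < gram (v t) -> (forall k, has_ddt T (fun s => v s k) t (v' k)) ->
  has_ddtR (fun s => gram (v s))
    (gram (v t) * \tr (invmx ((edges (v t))^T *m edges (v t)) *m (edges (v t))^T *m edges v')).
Proof.
move=> g0 vv'; set g := gram (v t) in g0 *.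
pose E s := edges (v s).
have dE : has_ddt T E t (edges v').
  apply/has_ddt_mxP => i j; rewrite mxE.
  rewrite (_ : (fun s => _) = fun s => v s (lift ord0 j) i 0 + (-1) *: (v s ord0 i 0 : R^o)).
    rewrite -[X in _ + X]mulN1r; apply: has_ddtD.
      by have /has_ddt_mxP := vv' (lift ord0 j); exact.
    by apply: has_ddtZ; have /has_ddt_mxP := vv' ord0; exact.
  by apply/funext => s; rewrite mxE scaleN1r.
have dG := has_ddt_mulmx (has_ddt_trmx dE) dE.
have D0 : 0 < \det ((E t)^T *m E t) by rewrite -sqrtr_gt0.
have := has_ddt_comp (has_ddt_det dG) (is_derive1_sqrt D0).
congr (has_ddt _ _ _ _); set G := (E t)^T *m E t.
have uG : G \in unitmx by rewrite unitmxE unitfE lt0r_neq0.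
have adjE : \adj G = \det G *: invmx G.
  by rewrite /invmx uG scalerA mulfV ?scale1r// lt0r_neq0.
have gE : \det G = g ^+ 2 by rewrite /g /gram sqr_sqrtr// ltW.
have Gs : (invmx G)^T = invmx G by rewrite trmx_inv trmx_mul trmxK.
have tr2 : \tr (invmx G *m ((edges v')^T *m E t)) = \tr (invmx G *m ((E t)^T *m edges v')).
  by rewrite -mxtrace_tr !trmx_mul trmxK Gs mxtrace_mulC.
have sE : Num.sqrt (\det G) = g by [].
rewrite -/G sE adjE gE -scalemxAl mxtraceZ mulmxDr mxtraceD tr2 mulmxA.
have g0' := lt0r_neq0 g0; clearbody g; by field.
Qed.

End TimeDeterminant.

(** * Transport by the velocity *)

Section OpenMeasurable.
Context {R : realType}.

(** An open set is a countable union of boxes with rational corners. It is applied to [Om], on which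
    pressure functions are measurable, so that they can be restricted to the cells. *)
Lemma measurable_open m (A : set 'cV[R]_m) : open A -> measurable (cvec @^-1` A).
Proof.
move=> oA; pose box (q : {ffun 'I_m -> rat * rat}) :=
  [set x : 'cV[R]_m | forall i, ratr (q i).1 < x i 0 < ratr (q i).2].
have mbox q : measurable (cvec @^-1` box q).
  rewrite (_ : _ @^-1` _ = \big[setI/setT]_(i < m)
     (setT `&` (fun t => cvec t i 0) @^-1` `]ratr (q i).1, ratr (q i).2[)).
    by apply: bigsetI_measurable => i _; apply: measurable_cvec_coord => //; exact: measurable_itv.
  rewrite -bigcap_seq; apply/seteqP; split=> t H i.
    by move=> _; split=> //=; rewrite in_itv; exact: H.
  by have [] := H i; rewrite /= ?mem_index_enum// in_itv.
rewrite (_ : _ @^-1` _ = \bigcup_q (if `[< box q `<=` A >] then cvec @^-1` box q else set0)).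
  by apply: countable_bigcupT_measurable => // q; case: asboolP.
apply/seteqP; split=> t; last by move=> [q _]; case: asboolP => // qA; exact: qA.
move=> /= At; have /nbhs_ballP[e /= e0 eA] := open_nbhs_nbhs (conj oA At).
have H i : exists ab : rat * rat, (cvec t i 0 - e < ratr ab.1 :> R) && (ratr ab.1 < cvec t i 0 :> R)
    && (cvec t i 0 < ratr ab.2 :> R) && (ratr ab.2 < cvec t i 0 + e :> R).
  have [|a] := @rat_in_itvoo R (cvec t i 0 - e) (cvec t i 0); first by rewrite ltrBlDr ltrDl.
  have [|b] := @rat_in_itvoo R (cvec t i 0) (cvec t i 0 + e); first by rewrite ltrDl.
  rewrite !in_itv /= => /andP[b1 b2] /andP[a1 a2].
  by exists (a, b); rewrite /= a1 a2 b1 b2.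
have [f fE] := choice H; exists (finfun f) => //.
have tb : box (finfun f) (cvec t).
  by move=> i; rewrite ffunE; move: (fE i) => /andP[/andP[/andP[_ ->] ->] _].
case: asboolP => // nA; exfalso; apply: nA => x xb; apply: eA; split=> // i j.
rewrite ord1 /ball /= ltr_distl; move: (fE i) (xb i) => /andP[/andP[/andP[h1 _] _] h4].
rewrite ffunE => /andP[h5 h6].
by rewrite ltrBlDr -ltrBlDl; apply/andP; split; lra.
Qed.

End OpenMeasurable.

Lemma derive_osimplex {R : realType} {V : normedModType R} m (v : 'I_m.+1 -> 'cV[R]_m)
    (f g : 'cV[R]_m -> V) x w l : nondeg v -> (forall y, osimplex v y -> f y = g y) ->
  osimplex v x -> is_derive x w g l -> is_derive x w f l.
Proof.
move=> nv fg xv; apply: near_eq_is_derive.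
have H : \forall y \near x, forall k, 0 < bary v k y.
  apply: (@filter_forall _ _ (fun k y => is_true (0 < bary v k y)) _ (nbhs_filter x)) => k.
  have N : nbhs (bary v k x) [set z : R | 0 < z].
    apply: open_nbhs_nbhs; split; first exact: open_gt.
    by have [/(_ k)] := (osimplex_bary nv x).1 xv.
  exact: (bary_continuous N).
apply: filterS H => y Hy; apply/esym/fg/(osimplex_bary nv); split=> //.
exact: bary_square.
Qed.

Section Transport.
Context {R : realType} {n : nat}.
Local Notation d := n.+1.
Local Notation pt := 'cV[R]_d.
Variables (Om : set pt) (M : @mesh R n).
Hypothesis hM : regular_partition Om M.
Hypothesis oOm : open Om.
Local Notation K_ := (@cell _ _ M).

(** A barycentric coordinate grows towards its own vertex and is constant along the opposite side,
    so minus its normalised gradient is the outer normal there. *)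
Lemma outer_normal_gbary K i :
  outer_normal (K_ K) i (- (Num.sqrt (frob (gbary (K_ K) i) (gbary (K_ K) i)))^-1 *: gbary (K_ K) i).
Proof.
have nK := mesh_nondeg hM K; set g := gbary _ _; set r := Num.sqrt _.
have [j ji] : exists j : 'I_d.+1, j != i.
  by exists (lift i ord0); rewrite eq_sym neq_lift.
have g0 : 0 < frob g g.
  rewrite lt_neqAle frob_ge0 eq_sym frob_eq0 andbT; apply/eqP => gE.
  have := gbary_edge nK i j i; rewrite -/g gE frob0l eqxx eq_sym (negbTE ji) subr0.
  by move/eqP; rewrite eq_sym oner_eq0.
have r0 : 0 < r by rewrite sqrtr_gt0.
split=> [|a b ai bi|b bi].
- rewrite frobZl frobZr mulrA mulrNN -expr2 -[X in _ * X](sqr_sqrtr (ltW g0)).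
  by rewrite -exprMn mulVf ?expr1n// gt_eqF.
- by rewrite frobZl gbary_edge// eq_sym (negbTE ai) eq_sym (negbTE bi) subrr mulr0.
- by rewrite frobZl gbary_edge// eqxx eq_sym (negbTE bi) subr0 mulr1 oppr_lt0 invr_gt0.
Qed.

Lemma intOm_ae_eq (f g : pt -> R) :
  (forall K, measurable_fun (cvec @^-1` osimplex (K_ K)) (f \o cvec)) ->
  (forall K, measurable_fun (cvec @^-1` osimplex (K_ K)) (g \o cvec)) ->
  ae_eq_on Om f g -> intOm M f = intOm M g.
Proof.
move=> mf mg fg; apply: eq_bigr => K _; rewrite /Lint /Rintegral; congr fine.
have [_ sOm _ _ _] := hM.
apply: ae_eq_integral.
- by have [] := bmeas_osimplex (mesh_nondeg hM K).
- by apply/measurable_EFinP; exact: mf.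
- by apply/measurable_EFinP; exact: mg.
- by apply: filterS fg => t fgt tK /=; rewrite fgt//; exact: (sOm K).
Qed.

Variables (z : pt -> pt).
Hypothesis zp : forall K, exists k, forall i, poly_on (csimplex (K_ K)) k (fun x => z x i 0).

Lemma cell_poly : exists (w : 'I_(ncell M) -> pt -> pt)
    (G : 'I_(ncell M) -> 'I_d -> 'I_d -> pt -> R),
  [/\ forall K i, polyf (fun x => w K x i 0), forall K i l, polyf (G K i l),
    forall K i x u, is_derive x u (fun x => w K x i 0) (\sum_l u l 0 * G K i l x) &
    forall K x, csimplex (K_ K) x -> z x = w K x].
Proof.
have H K i : exists gG : (pt -> R) * ('I_d -> pt -> R),
   [/\ polyf gG.1, forall l, polyf (gG.2 l),
   forall x u, is_derive x u gG.1 (\sum_l u l 0 * gG.2 l x) &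
   forall x, csimplex (K_ K) x -> z x i 0 = gG.1 x].
  have [k /(_ i) /poly_on_polyf[g pg gE]] := zp K.
  by have [G pG dG] := polyf_derive pg; exists (g, G).
pose f K := projT1 (choice (H K)); have fE K := projT2 (choice (H K)).
exists (fun K x => \col_i (f K i).1 x), (fun K i l => (f K i).2 l).
have E K i : (fun x : pt => (\col_i (f K i).1 x) i 0) = (f K i).1 by apply/funext => x; rewrite mxE.
split=> [K i|K i l|K i x u|K x xK]; try by rewrite ?E; have [] := fE K i.
by apply/colP => i; rewrite mxE; have [_ _ _ ->] := fE K i.
Qed.

Lemma grad_cell (w : 'I_(ncell M) -> pt -> pt) G :
  (forall K i x u, is_derive x u (fun x => w K x i 0) (\sum_l u l 0 * G K i l x)) ->
  (forall K x, csimplex (K_ K) x -> z x = w K x) ->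
  forall K x, osimplex (K_ K) x -> grad z x = \matrix_(i, j) G K i j x.
Proof.
move=> dG zw K x xK; apply/matrixP => i j; rewrite !mxE.
rewrite (_ : pd j z x = \col_i G K i j x) ?mxE//; apply: derive_val.
apply: (derive_osimplex (mesh_nondeg hM K) (g := w K)) => //.
  by move=> y /osimplex_csimplex; exact: zw.
apply: is_derive_mx => a b; rewrite ord1 mxE.
have := dG K a x (delta_mx j 0).
rewrite (_ : \sum_l _ = G K a j x)//.
rewrite (bigD1 j)//= mxE !eqxx mul1r big1 ?addr0// => l /negbTE lj.
by rewrite mxE lj mul0r.
Qed.

Variable dD : set pt.
Hypothesis zb : H1D_conditions Om M dD z.

Lemma boundary_flux F x : boundary_side Om F -> csimplex (side F) x ->
  frob (gbary (K_ F.1) F.2) (z x) = 0.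
Proof.
move=> bF xF; have [z0 zn] := zb.
have [/z0 ->|xD] := pselect (dD x); first by rewrite frob0r.
have oN := outer_normal_gbary F.1 F.2.
have := zn F _ x bF oN xF xD; have [nn _ _] := oN.
rewrite frobZr frobC => /eqP; rewrite mulf_eq0 => /orP[/eqP E|/eqP//].
by move: nn; rewrite E scale0r frob0r => /eqP; rewrite eq_sym oner_eq0.
Qed.

(* The fluxes of [L z] cancel on interior facets and vanish on boundary facets. *)
Lemma transport_zero (L : pt -> R) : Sh Om M 1 L ->
  intOm M (fun x => divg z x * L x) = 0 ->
  \sum_K Lint (osimplex (K_ K)) (fun x => frob (z x) (\sum_k L (K_ K k) *: gbary (K_ K) k)) = 0.
Proof.
move=> SL z0; have [w [G [pw pG dG zw]]] := cell_poly.
pose LK K x := \sum_k bary (K_ K) k x * L (K_ K k).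
pose gL K := \sum_k L (K_ K k) *: gbary (K_ K) k.
have pLK K : polyf (LK K).
  by apply: polyf_sum => k _; apply: polyfM; [exact: polyf_bary|exact: polyf_cst].
have LKE K x : csimplex (K_ K) x -> L x = LK K x by exact: (Sh1_bary hM SL).
have dLK K x u : is_derive x u (LK K) (frob (gL K) u).
  apply: is_derive_near_affine; apply: nearW => h; rewrite /LK.
  under eq_bigr do rewrite baryD mulrDl; rewrite big_split; congr (_ + _).
  rewrite frob_suml scaler_sumr; apply: eq_bigr => k _.
  by rewrite frobZl -mulrA (mulrC _ (L _)).
(* Product rule for the partial derivatives of [L z] on the cell; the diagonal sum is
   [z . grad L + L div z]. *)
pose H K i l x := w K x i 0 * gL K l 0 + LK K x * G K i l x.
have E K i : (fun x => (LK K x *: w K x) i 0) = (fun x => w K x i 0) * LK K.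
  by apply/funext => x; rewrite mxE mulrC.
have pH1 K : polyf (fun x => frob (w K x) (gL K)).
  by under eq_fun do rewrite frobC; apply: polyf_frob => i j; rewrite ord1.
have pH2 K : polyf (fun x => \sum_i G K i i x * LK K x).
  by apply: polyf_sum => i _; exact: polyfM.
have HZ : \sum_K Lint (osimplex (K_ K)) (fun x => \sum_i H K i i x) = 0.
  apply: (mesh_div_zero oOm hM (w := fun K x => LK K x *: w K x)).
  - by move=> K i; rewrite E; exact: polyfM.
  - by move=> K K' x xK xK'; rewrite -(LKE K)// -(zw K)// (LKE K')// (zw K').
  - move=> F x bF xF; have [xK _] := (csimplex_side hM F x).1 xF.
    by rewrite frobZr -zw// boundary_flux// mulr0.
  - by move=> K i l; apply: polyfD; apply: polyfM => //; exact: polyf_cst.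
  - move=> K i x u; rewrite E.
    have D1 := dG K i x u; have D2 := dLK K x u; have := is_deriveM D1 D2.
    rewrite (_ : _ + _ = \sum_l u l 0 * H K i l x)//.
    rewrite frob_col [X in X + _]mulr_sumr [X in _ + X]mulr_sumr -big_split.
    by apply: eq_bigr => l _; rewrite /H /=; ring.
rewrite -[RHS]HZ -[LHS]addr0 -[X in _ + X = _]z0 /intOm -[LHS]big_split; apply: eq_bigr => K _ /=.
have nK := mesh_nondeg hM K; have bK := bmeas_osimplex nK.
rewrite (Lint_ext (g := fun x => frob (w K x) (gL K))); last first.
  by move=> x /osimplex_csimplex/zw ->.
rewrite (@Lint_ext _ _ _ (fun x => divg z x * L x) (fun x => \sum_i G K i i x * LK K x)); last first.
  move=> x xK; rewrite (LKE K); last exact: osimplex_csimplex.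
  rewrite /divg (grad_cell dG zw xK) -mulr_suml; congr (_ * _).
  by apply: eq_bigr => i _; rewrite mxE.
rewrite -LintD//; apply: Lint_ext => x _; rewrite frob_col -big_split.
by apply: eq_bigr => i _; rewrite /H mulrC [X in _ + X]mulrC.
Qed.

Lemma divergence_free (P : set (pt -> R)) (L : pt -> R) : pressure_space Om M P ->
  (forall r, P r -> 0 = intOm M (fun x => divg z x * r x)) -> Sh Om M 1 L ->
  intOm M (fun x => divg z x * L x) = 0.
Proof.
move=> [_ PL2 PS] z0 SL; have [w [G [pw pG dG zw]]] := cell_poly.
have [r Pr Lr] := PS _ SL; rewrite [RHS](z0 r Pr); have [mr _] := PL2 r Pr.
pose D K x := \sum_i G K i i x.
have DE K x : osimplex (K_ K) x -> divg z x = D K x.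
  move=> xK; rewrite /divg (grad_cell dG zw xK).
  by apply: eq_bigr => i _; rewrite mxE.
have mK K : measurable (cvec @^-1` osimplex (K_ K)) by have [] := bmeas_osimplex (mesh_nondeg hM K).
have mD K : measurable_fun (cvec @^-1` osimplex (K_ K)) (D K \o cvec).
  by apply: measurable_funTS; apply: measurable_polyf; apply: polyf_sum.
have mdiv K : measurable_fun (cvec @^-1` osimplex (K_ K)) (divg z \o cvec).
  by apply: eq_measurable_fun (mD K) => t /set_mem /= tK; rewrite (DE K).
apply: intOm_ae_eq.
- move=> K; apply: measurable_funM => //.
  apply: (@eq_measurable_fun _ _ _ _ _ ((fun x => \sum_k bary (K_ K) k x * L (K_ K k)) \o cvec)).
    by move=> t /set_mem /= /osimplex_csimplex tK; rewrite (Sh1_bary hM SL tK).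
  apply: measurable_funTS; apply: measurable_polyf; apply: polyf_sum => k _.
  by apply: polyfM; [exact: polyf_bary|exact: polyf_cst].
- move=> K; apply: measurable_funM => //.
  have [_ sOm _ _ _] := hM.
  by apply: (measurable_funS _ _ mr); [exact: measurable_open|move=> t; exact: sOm].
- by apply: filterS Lr => t Lt /Lt /= ->.
Qed.
End Transport.

(** * The tensor equation *)

Section LumpedMatrices.
Context {R : realType} {n : nat}.
Local Notation d := n.+1.
Local Notation pt := 'cV[R]_d.
Variables (Om : set pt) (M : @mesh R n).
Hypothesis hM : regular_partition Om M.
Local Notation K_ := (@cell _ _ M).

(** Data are indexed by cell and vertex, not by node: lumping takes limits from inside each cell,
    and cellwise coefficients jump across facets. *)
Definition nodal (F : 'I_(ncell M) -> 'I_d.+1 -> R) : R :=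
  d.+1%:R^-1 * \sum_K vol (osimplex (K_ K)) * \sum_k F K k.

Lemma nodalD F G : nodal F + nodal G = nodal (fun K k => F K k + G K k).
Proof.
rewrite /nodal -mulrDr -big_split; congr (_ * _); apply: eq_bigr => K _ /=.
by rewrite -mulrDr -big_split.
Qed.

Lemma eq_nodal F G : (forall K k, F K k = G K k) -> nodal F = nodal G.
Proof.
by move=> FG; congr (_ * _); apply: eq_bigr => K _; congr (_ * _); apply: eq_bigr => k _.
Qed.

Lemma has_ddt_nodal T t (F : R -> _) F' :
  (forall K k, has_ddt T (fun s => F s K k : R^o) t (F' K k)) ->
  has_ddt T (fun s => nodal (F s) : R^o) t (nodal F').
Proof.
move=> H; apply: (@has_ddtZ _ _ _ R^o); apply: has_ddt_sum => K _.
by apply: (@has_ddtZ _ _ _ R^o); apply: has_ddt_sum => k _.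
Qed.

Lemma lump_nodal (f : pt -> R) (g : 'I_(ncell M) -> pt -> R) :
  (forall K x, osimplex (K_ K) x -> f x = g K x) ->
  (forall K k, {for K_ K k, continuous (g K)}) ->
  lump M f = nodal (fun K k => g K (K_ K k)).
Proof.
by move=> fg cg; apply: lumpE => K k; apply: cvg_within_osimplex => //; exact: fg.
Qed.

Lemma nodal_interp {p q} K (a : 'I_d.+1 -> 'M[R]_(p, q)) k :
  \sum_j bary (K_ K) j (K_ K k) *: a j = a k.
Proof. by under eq_bigr do rewrite bary_vertex ?(mesh_nondeg hM)//; exact: sum_delta. Qed.

Lemma polyf_nodal {p q} K (a : 'I_d.+1 -> 'M[R]_(p, q)) i j :
  polyf (fun x => (\sum_k bary (K_ K) k x *: a k) i j).
Proof.
under eq_fun do rewrite summxE; apply: polyf_sum => k _; under eq_fun do rewrite mxE.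
by apply: polyfM; [exact: polyf_bary|exact: polyf_cst].
Qed.

Lemma polyf_frob2 {p q} (A C : pt -> 'M[R]_(p, q)) :
  (forall i j, polyf (fun x => A x i j)) -> (forall i j, polyf (fun x => C x i j)) ->
  polyf (fun x => frob (A x) (C x)).
Proof. by move=> pA pC; apply: polyf_sum => i _; apply: polyf_sum => j _; exact: polyfM. Qed.

Lemma polyf_det {p} (A : pt -> 'M[R]_p) :
  (forall i j, polyf (fun x => A x i j)) -> polyf (fun x => \det (A x)).
Proof.
move=> pA; apply: polyf_sum => s _; apply: polyfM; first exact: polyf_cst.
by apply: polyf_prod.
Qed.

Lemma polyf_adj {p} (A : pt -> 'M[R]_p) i j :
  (forall i j, polyf (fun x => A x i j)) -> polyf (fun x => (\adj (A x)) i j).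
Proof.
move=> pA; under eq_fun do rewrite mxE; apply: polyfM; first exact: polyf_cst.
by apply: polyf_det => a b; under eq_fun do rewrite !mxE.
Qed.

Lemma lump_frob p q (l : 'I_(ncell M) -> R) (f : pt -> R)
    (a c : 'I_(ncell M) -> 'I_d.+1 -> 'M[R]_(p, q)) :
  (forall K x, osimplex (K_ K) x -> f x = l K *
     frob (\sum_k bary (K_ K) k x *: a K k) (\sum_k bary (K_ K) k x *: c K k)) ->
  lump M f = nodal (fun K k => l K * frob (a K k) (c K k)).
Proof.
move=> fE; rewrite (lump_nodal fE); last first.
  move=> K k; apply: polyf_continuous; apply: polyfZ.
  by apply: polyf_frob2 => i j; exact: polyf_nodal.
by apply: eq_nodal => K k; rewrite !nodal_interp.
Qed.

(** Integrands containing derivatives are known to be polynomial only inside the open cells, so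
    linearity of [intOm] is proved for this class. *)
Definition cell_polyf (f : pt -> R) : Prop :=
  forall K, exists2 g, polyf g & forall x, osimplex (K_ K) x -> f x = g x.

Lemma cell_polyf_polyf f : polyf f -> cell_polyf f.
Proof. by move=> pf K; exists f. Qed.

Lemma cell_polyfD f g : cell_polyf f -> cell_polyf g -> cell_polyf (fun x => f x + g x).
Proof.
move=> pf pg K; have [f' pf' fE] := pf K; have [g' pg' gE] := pg K.
by exists (fun x => f' x + g' x) => [|x xK]; [exact: polyfD|rewrite fE// gE].
Qed.

Lemma cell_polyf_sum I (r : seq I) (P : pred I) f : (forall i, P i -> cell_polyf (f i)) ->
  cell_polyf (fun x => \sum_(i <- r | P i) f i x).
Proof.
move=> pf; elim: r => [|a r IH].
  by under eq_fun do rewrite big_nil; apply: cell_polyf_polyf; exact: polyf_cst.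
rewrite (funext (fun x => big_cons _ _ a r P (f^~ x))); case Pa: (P a) => //.
by apply: cell_polyfD => //; exact: pf.
Qed.

Lemma intOmZ (f : pt -> R) c : cell_polyf f -> intOm M (fun x => c * f x) = c * intOm M f.
Proof.
move=> pf; rewrite /intOm mulr_sumr; apply: eq_bigr => K _; have [g pg fg] := pf K.
rewrite (Lint_ext fg) -LintZ//; last exact/bmeas_osimplex/(mesh_nondeg hM).
by apply: Lint_ext => x /fg ->.
Qed.

Lemma intOm_sum I (r : seq I) (P : pred I) (f : I -> pt -> R) :
  (forall i, P i -> cell_polyf (f i)) ->
  intOm M (fun x => \sum_(i <- r | P i) f i x) = \sum_(i <- r | P i) intOm M (f i).
Proof.
move=> pf; rewrite /intOm exchange_big /=; apply: eq_bigr => K _.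
have H i : exists g, P i -> polyf g /\ forall x, osimplex (K_ K) x -> f i x = g x.
  by have [/pf/(_ K)[g pg fg]|Pi] := boolP (P i); [exists g|exists (fun=> 0)].
have [g gP] := choice H.
rewrite (Lint_ext (g := fun x => \sum_(i <- r | P i) g i x)); last first.
  by move=> x xK; apply: eq_bigr => i /gP[_ ->].
rewrite Lint_sum; [|exact/bmeas_osimplex/(mesh_nondeg hM)|by move=> i /gP[]].
by apply: eq_bigr => i /gP[_ fg]; apply/esym/Lint_ext.
Qed.

End LumpedMatrices.

Section LambdaAlgebra.
Context {R : realType} {n : nat}.
Local Notation d := n.+1.

(** The gradient of the affine function with nodal values [l], written through its increments along
    the edges at [v ord0]. This is the form in which the factors of [Lambda] act on gradients. *)
Lemma sum_gbary_square (v : 'I_d.+1 -> 'cV[R]_d) (l : 'I_d.+1 -> R) : nondeg v ->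
  \sum_k l k *: gbary v k = invmx (edges v)^T *m \col_j (l (lift ord0 j) - l ord0).
Proof.
move=> nv; have /(congr1 trmx) := invmx_gram nv.
rewrite trmx_mul trmxK !trmx_inv trmx_mul trmxK => E.
under eq_bigr do rewrite /gbary E scalemxAr; rewrite -mulmx_sumr.
congr (_ *m _); apply/colP => j; rewrite summxE mxE.
under eq_bigr do rewrite !mxE mulrBr (mulrC _ (_ == lift _ _)%:R) (mulrC _ (_ == ord0)%:R).
by rewrite sumrB; congr (_ - _); exact: (sum_delta (V := R^o)).
Qed.

Variables (M : @mesh R n) (B : 'cV[R]_d -> 'M[R]_d) (K : 'I_(ncell M)).
Local Notation v := (cell K).
Hypothesis pB : forall k, posdef (B (v k)).

(* The coefficient [lam_coef] is chosen for this discrete chain rule. *)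
Lemma hatLambda_frob m :
  frob (hatLambda K B m) (invmx (B (v ord0)) - invmx (B (v (lift ord0 m)))) =
  ln (\det (B (v (lift ord0 m)))) - ln (\det (B (v ord0))).
Proof.
rewrite /hatLambda; set Bi := B (v (lift ord0 m)); set B0 := B (v ord0).
have pBi : posdef Bi by exact: pB.
have pB0 : posdef B0 by exact: pB.
have [->|ne] := eqVneq Bi B0; first by rewrite !subrr frob0r.
rewrite /lam_coef (addrC (- invmx Bi)); set D := invmx B0 - invmx Bi.
have D0 : frob (Bi - B0) D != 0 by rewrite gt_eqF// frob_gap_gt0.
rewrite frobDl frobZl -(opprB Bi B0) frobNl mulrN mulfVK//.
rewrite !tr_mxln ?det_inv; try exact: posdef_inv.
rewrite !lnV ?posrE ?posdef_det_gt0//.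
ring.
Qed.

End LambdaAlgebra.

Section ElasticEnergy.
Context {R : realType} {n : nat}.
Local Notation d := n.+1.
Local Notation pt := 'cV[R]_d.
Variables (Om : set pt) (M : @mesh R n).
Hypothesis hM : regular_partition Om M.
Local Notation K_ := (@cell _ _ M).
Local Notation nodal := (@nodal _ _ M).
Variables (T : R) (c : physics (R := R)) (B : R -> pt -> 'M[R]_d).
Hypothesis sB : forall t, 0 <= t <= T -> SSh Om M (B t) /\ posdef_on Om (B t).
Hypothesis dB : time_differentiable Om T B.

Local Notation Bn s K k := (B s (K_ K k)).

Let posB s K k : 0 <= s <= T -> posdef (Bn s K k).
Proof. by move=> /sB[_]; apply; exact: (vertex_closure hM). Qed.

Let BE s K x : 0 <= s <= T -> csimplex (K_ K) x ->
  B s x = \sum_k bary (K_ K) k x *: Bn s K k.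
Proof. by move=> /sB[SB _] xK; exact: (SSh_bary hM SB). Qed.

Let posBx s K x : 0 <= s <= T -> osimplex (K_ K) x -> posdef (B s x).
Proof. by move=> /sB[_]; move=> pB xK; apply: pB; exact: (osimplex_closure hM xK). Qed.

(* The derivative of [elastic_density c] at [A]. *)
Definition stress (A : 'M[R]_d) : 'M[R]_d := (modG c / 2) *: (1%:M - invmx A).

Lemma stress_sym A : posdef A -> (stress A)^T = stress A.
Proof.
by move=> /posdef_inv[sA _]; rewrite /stress linearZ /= linearB /= sA trmx1.
Qed.

Definition stress_test s x : 'M[R]_d :=
  \matrix_(i, j) glue K_ (fun y => stress (B s y) i j) x.

Lemma stress_testE s K x : csimplex (K_ K) x ->
  stress_test s x = \sum_k bary (K_ K) k x *: stress (Bn s K k).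
Proof.
move=> xK; apply/matrixP => i j; rewrite mxE summxE.
rewrite (glueE (mesh_nondeg hM) (mesh_conf hM) _ xK).
by apply: eq_bigr => k _; rewrite [RHS]mxE.
Qed.

Lemma ex_ddt_node t K k : 0 < t <= T -> ex_ddt T (fun s => Bn s K k) t.
Proof. by move=> t0T; apply: dB => //; exact: (vertex_closure hM). Qed.

Lemma ex_ddt_stress t K k : 0 < t <= T -> ex_ddt T (fun s => stress (Bn s K k)) t.
Proof.
move=> t0T; have /cvg_ex[l hl] : ex_ddt T (fun s => invmx (Bn s K k)) t.
  by apply: (ex_ddt_invmx t0T _ (@ex_ddt_node t K k t0T)) => s sT; apply: posdef_unit; exact: posB.
apply/cvg_ex; exists ((modG c / 2) *: (0 - 1 *: l)); apply: has_ddtZ.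
have := has_ddtD (has_ddt_cst T t (1%:M : 'M[R]_d)) (has_ddtZ (c := -1) hl).
rewrite scaleN1r scale1r; congr has_ddt; apply/funext => s; by rewrite scaleN1r.
Qed.

Lemma has_ddt_stress_test t K x : 0 < t <= T -> csimplex (K_ K) x ->
  has_ddt T (fun s => stress_test s x) t
    (\sum_k bary (K_ K) k x *: ddt T (fun s => stress (Bn s K k)) t).
Proof.
move=> t0T xK; rewrite (_ : (fun s => _) = fun s => \sum_k bary (K_ K) k x *: stress (Bn s K k)).
  by apply: has_ddt_sum => k _; apply: has_ddtZ; exact/ex_ddtP/ex_ddt_stress.
by apply/funext => s; exact: stress_testE.
Qed.

Lemma test_fun_stress : test_fun Om T (SSh Om M) stress_test.
Proof.
split=> [s sT|t x t0T].
  split=> [x|i j]; last first.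
    rewrite (_ : (fun x => _) = glue K_ (fun y => stress (B s y) i j)); first exact: (glue_Sh1 hM).
    by apply/funext => x; rewrite mxE.
  rewrite (closure_cells hM) => -[K _ xK]; rewrite (stress_testE _ xK) linear_sum.
  by apply: eq_bigr => k _; rewrite linearZ /= stress_sym//; exact: posB.
rewrite (closure_cells hM) => -[K _ xK]; apply/cvg_ex; eexists.
exact: (has_ddt_stress_test t0T xK).
Qed.

(** Lumping needs a limit at each vertex from inside the cell. Inside, the trace of [mxln] is the
    logarithm of the determinant, which is continuous in the affine extension of [B] from the
    cell. *)
Lemma lump_elastic s : 0 <= s <= T -> lump M (fun x => elastic_density c (B s x)) =
  nodal (fun K k => modG c / 2 * (\tr (Bn s K k) - ln (\det (Bn s K k)) - d%:R)).
Proof.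
move=> sT; pose A K x := \sum_k bary (K_ K) k x *: Bn s K k.
pose g K x := modG c / 2 * (\tr (A K x) - ln (\det (A K x)) - d%:R).
have pA K i j : polyf (fun x => A K x i j) by exact: polyf_nodal.
have AE K k : A K (K_ K k) = Bn s K k by exact: (nodal_interp hM).
rewrite (lump_nodal (g := g)).
- by apply: eq_nodal => K k; rewrite /g AE.
- move=> K x xK; rewrite /elastic_density /g !linearB /= mxtrace1 tr_mxln; last exact: (posBx sT xK).
  by rewrite (BE sT (osimplex_csimplex xK)).
- move=> K k; apply: continuousM; first exact: cst_continuous.
  apply: continuousB; last exact: cst_continuous.
  apply: continuousB; first by apply: polyf_continuous; apply: polyf_sum.
  apply: (@continuous_comp _ _ _ (fun x => \det (A K x)) (@ln R)).
    by apply: polyf_continuous; exact: polyf_det.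
  by apply: continuous_ln; rewrite AE; exact/posdef_det_gt0/posB.
Qed.

Lemma has_ddt_elastic t : 0 < t <= T ->
  has_ddt T (fun s => lump M (fun x => elastic_density c (B s x)) : R^o) t
    (nodal (fun K k => frob (ddt T (fun s => Bn s K k) t) (stress (Bn t K k)))).
Proof.
move=> t0T; have t0T' : 0 <= t <= T by move: t0T => /andP[/ltW -> ->].
have := @has_ddt_nodal _ _ M T t
  (fun s K k => modG c / 2 * (\tr (Bn s K k) - ln (\det (Bn s K k)) - d%:R))
  (fun K k => frob (ddt T (fun s => Bn s K k) t) (stress (Bn t K k))).
move=> H; apply: (has_ddt_ext t0T) (H _) => [s sT|K k]; first by rewrite lump_elastic.
have D := ex_ddtP (@ex_ddt_node t K k t0T); have pB := posB K k t0T'; set B' := ddt _ _ _ in D *.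
have D1 := has_ddt_tr D; have D2 := has_ddt_ln_det (posdef_det_gt0 pB) D.
have := has_ddtZ (V := R^o) (c := modG c / 2) (has_ddtD (has_ddtD D1 (has_ddtZ (V := R^o) (c := -1) D2))
  (has_ddt_cst T t (- d%:R : R^o))).
have [sI _] := posdef_inv pB.
rewrite addr0 (_ : frob _ _ = (modG c / 2) *: (\tr B' + (-1) *: \tr (invmx (Bn t K k) *m B') : R^o)).
  by congr has_ddt; apply/funext => s; rewrite -[LHS]/(_ * (_ + -1 * _ + _)) mulN1r.
rewrite frobC frobZl frobE linearB /= mulmxBl linearB /= trmx1 mul1mx sI.
by rewrite -[(-1) *: _]/(-1 * _) mulN1r.
Qed.

(** The product rule at every node: subtracting the part in which the test function is
    differentiated leaves the rate of [B] against the stress, which is the rate of the elastic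
    energy found in [has_ddt_elastic]. *)
Lemma stress_pairing t : 0 < t <= T ->
  ddt T (fun s => lump M (fun x => frob (B s x) (stress_test s x)) : R^o) t
  - lump M (fun x => frob (B t x) (dt T stress_test t x)) =
  nodal (fun K k => frob (ddt T (fun s => Bn s K k) t) (stress (Bn t K k))).
Proof.
move=> t0T; have t0T' : 0 <= t <= T by move: t0T => /andP[/ltW -> ->].
have dtE : lump M (fun x => frob (B t x) (dt T stress_test t x)) =
    nodal (fun K k => frob (Bn t K k) (ddt T (fun s => stress (Bn s K k)) t)).
  rewrite (lump_frob hM (l := fun=> 1) (a := fun K k => Bn t K k)
    (c := fun K k => ddt T (fun s => stress (Bn s K k)) t)).
    by apply: eq_nodal => K k; rewrite mul1r.
  move=> K x /osimplex_csimplex xK; rewrite mul1r (BE t0T' xK); congr frob.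
  by rewrite /dt (has_ddt_ddt t0T (has_ddt_stress_test t0T xK)).
have -> : ddt T (fun s => lump M (fun x => frob (B s x) (stress_test s x)) : R^o) t =
    nodal (fun K k => frob (Bn t K k) (ddt T (fun s => stress (Bn s K k)) t) +
      frob (ddt T (fun s => Bn s K k) t) (stress (Bn t K k))).
  apply: (has_ddt_ddt t0T); apply: (has_ddt_ext t0T
    (f := fun s => nodal (fun K k => frob (Bn s K k) (stress (Bn s K k))))).
    move=> s sT; rewrite (lump_frob hM (l := fun=> 1) (a := fun K k => Bn s K k)
      (c := fun K k => stress (Bn s K k))).
      by apply: eq_nodal => K k; rewrite mul1r.
    by move=> K x /osimplex_csimplex xK; rewrite mul1r (BE sT xK) (stress_testE _ xK).
  apply: has_ddt_nodal => K k; apply: has_ddt_frob; first exact/ex_ddtP/ex_ddt_node.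
  exact/ex_ddtP/ex_ddt_stress.
by rewrite dtE -nodalD addrAC subrr add0r.
Qed.

Variables (t : R) (lam : pt -> R) (lamK : 'I_(ncell M) -> R).
Hypothesis t0T : 0 < t <= T.
Hypothesis lamE : forall K x, osimplex (K_ K) x -> lam x = lamK K.

Let t0T' : 0 <= t <= T.
Proof. by move: t0T => /andP[/ltW -> ->]. Qed.

(** Lumping sees only vertex values, where the interpolant equals the stress, and
    [(B - 1) : (1 - B^-1)] is the trace of [B + B^-1 - 2]. The adjugate formula supplies the
    continuity of the inverse at the vertices. *)
Lemma relaxation_stress :
  lump M (fun x => frob ((lam x)^-1 *: (B t x - 1%:M)) (stress_test t x)) =
  lump M (fun x => modG c / (2 * lam x) * \tr (B t x + invmx (B t x) - 2 *: 1%:M)).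
Proof.
have BE1 K x : osimplex (K_ K) x ->
    B t x - 1%:M = \sum_k bary (K_ K) k x *: (Bn t K k - 1%:M).
  move=> /osimplex_csimplex xK; rewrite (BE t0T' xK).
  under [RHS]eq_bigr do rewrite scalerBr.
  by rewrite sumrB -scaler_suml sum_bary scale1r.
rewrite (lump_frob hM (l := fun K => (lamK K)^-1) (a := fun K k => Bn t K k - 1%:M)
    (c := fun K k => stress (Bn t K k))); last first.
  move=> K x xK; rewrite frobZl (lamE xK) (BE1 K x xK) (stress_testE _ (osimplex_csimplex xK)).
  by [].
pose A K x := \sum_k bary (K_ K) k x *: Bn t K k.
pose g K x := modG c / (2 * lamK K) * (\tr (A K x) + (\det (A K x))^-1 * \tr (\adj (A K x)) - 2 * d%:R).
have invE (X : 'M[R]_d) : posdef X -> \tr (X + invmx X - 2 *: 1%:M) = \tr X + (\det X)^-1 * \tr (\adj X) - 2 * d%:R.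
  move=> /posdef_unit uX; rewrite mxtraceD -scaleN1r scalerA mxtraceZ mxtraceD mxtrace1 mulN1r mulNr.
  by rewrite /invmx uX mxtraceZ.
have pA K i j : polyf (fun x => A K x i j) by exact: polyf_nodal.
have AE K k : A K (K_ K k) = Bn t K k by exact: (nodal_interp hM).
rewrite (lump_nodal (g := g)).
- apply: eq_nodal => K k; rewrite /g AE -invE; last exact: posB.
  have pX := posB K k t0T'; set X := Bn t K k in pX *.
  have [sI _] := posdef_inv pX; have [sX _] := pX.
  have sX1 : (X - 1%:M)^T = X - 1%:M by rewrite linearB /= sX trmx1.
  rewrite frobZr frobE sX1 mulmxBl mulmxBr mulmx1 mulmxV; last exact: posdef_unit.
  rewrite mul1mx.
  have -> : X - 1%:M - (1%:M - invmx X) = X + invmx X - 2 *: 1%:M.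
    by move: X (invmx X) {pX sI sX sX1} => X Y; apply/matrixP => i j; rewrite !mxE; ring.
  by rewrite invfM; ring.
- move=> K x xK; rewrite (lamE xK) invE; last exact: (posBx t0T' xK).
  by rewrite (BE t0T' (osimplex_csimplex xK)).
- move=> K k; apply: continuousM; first exact: cst_continuous.
  apply: continuousB; last exact: cst_continuous.
  apply: continuousD; first by apply: polyf_continuous; apply: polyf_sum.
  apply: continuousM; last first.
    by apply: polyf_continuous; apply: polyf_sum => i _; exact: polyf_adj.
  apply: continuousV; first by rewrite AE gt_eqF//; exact/posdef_det_gt0/posB.
  by apply: polyf_continuous; exact: polyf_det.
Qed.

End ElasticEnergy.

Section TensorTerms.
Context {R : realType} {n : nat}.
Local Notation d := n.+1.
Local Notation pt := 'cV[R]_d.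
Variables (Om : set pt) (M : @mesh R n).
Hypothesis hM : regular_partition Om M.
Hypothesis oOm : open Om.
Local Notation K_ := (@cell _ _ M).

Lemma pd_bary {p q} (f : pt -> 'M[R]_(p, q)) K a j x :
  (forall y, osimplex (K_ K) y -> f y = \sum_k bary (K_ K) k y *: a k) ->
  osimplex (K_ K) x -> pd j f x = \sum_k gbary (K_ K) k j 0 *: a k.
Proof.
move=> fE xK; under eq_bigr do rewrite -frob_delta.
exact/derive_val/(derive_bary _ (mesh_nondeg hM K) fE).
Qed.

Lemma pd_bary_scalar (f : pt -> R) K (a : 'I_d.+1 -> R) j x :
  (forall y, osimplex (K_ K) y -> f y = \sum_k bary (K_ K) k y * a k) ->
  osimplex (K_ K) x -> pd j (f : pt -> R^o) x = \sum_k gbary (K_ K) k j 0 * a k.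
Proof.
move=> fE xK; under eq_bigr do rewrite -frob_delta.
exact/derive_val/(derive_bary (V := R^o) _ (mesh_nondeg hM K) fE).
Qed.

Variables (T : R) (c : physics (R := R)) (B : R -> pt -> 'M[R]_d).
Hypothesis sB : forall t, 0 <= t <= T -> SSh Om M (B t) /\ posdef_on Om (B t).
Variable t : R.
Hypothesis t0T : 0 <= t <= T.

Local Notation Bn K k := (B t (K_ K k)).
Local Notation GG := (stress_test M c B t).
Local Notation stress := (stress c).
Local Notation lnB K := (fun k => ln (\det (Bn K k))).

Let posB K k : posdef (Bn K k).
Proof. by move: t0T => /sB[_]; apply; exact: (vertex_closure hM). Qed.

Let BE K x : osimplex (K_ K) x -> B t x = \sum_k bary (K_ K) k x *: Bn K k.
Proof. by move: t0T => /sB[SB _] /osimplex_csimplex xK; exact: (SSh_bary hM SB). Qed.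

Let GE K x : osimplex (K_ K) x -> GG x = \sum_k bary (K_ K) k x *: stress (Bn K k).
Proof. by move=> /osimplex_csimplex; exact: (stress_testE hM). Qed.

(** The transposed edge matrix turns Cartesian derivatives into increments along the edges, where
    [hatLambda] satisfies the discrete chain rule of [hatLambda_frob]; the inverse factor turns the
    increments of [ln det] back into a Cartesian gradient. *)
Lemma Lambda_chain_rule K i :
  \sum_j frob (\sum_m ((invmx (edges (K_ K))^T) i m * ((edges (K_ K))^T) m j) *: hatLambda K (B t) m)
    (\sum_k gbary (K_ K) k j 0 *: stress (Bn K k)) =
  modG c / 2 * (\sum_k lnB K k *: gbary (K_ K) k) i 0.
Proof.
have nK := mesh_nondeg hM K; rewrite sum_gbary_square// mxE mulr_sumr.
under eq_bigr do rewrite frob_suml; rewrite exchange_big; apply: eq_bigr => m _ /=.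
transitivity ((invmx (edges (K_ K))^T) i m * frob (hatLambda K (B t) m)
    (\sum_j ((edges (K_ K))^T) m j *: \sum_k gbary (K_ K) k j 0 *: stress (Bn K k))).
  rewrite frob_sumr mulr_sumr; apply: eq_bigr => j _.
  by rewrite frobZl frobZr mulrA.
have -> : \sum_j ((edges (K_ K))^T) m j *: \sum_k gbary (K_ K) k j 0 *: stress (Bn K k) =
    (modG c / 2) *: (invmx (Bn K ord0) - invmx (Bn K (lift ord0 m))).
  under eq_bigr do rewrite scaler_sumr; rewrite exchange_big /=.
  transitivity (\sum_k ((k == lift ord0 m)%:R - (k == ord0)%:R) *: stress (Bn K k)).
    apply: eq_bigr => k _; under eq_bigr do rewrite scalerA; rewrite -scaler_suml.
    congr (_ *: _); rewrite -(gbary_edge nK) frob_col; apply: eq_bigr => j _.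
    by rewrite !mxE mulrC.
  under eq_bigr do rewrite scalerBl; rewrite sumrB !sum_delta /stress -scalerBr.
  by congr (_ *: _); rewrite opprB addrC addrA subrK.
by rewrite frobZr hatLambda_frob// [in RHS]mxE mulrCA.
Qed.

Variables (z : pt -> pt) (dD : set pt) (P : set (pt -> R)).
Hypothesis zp : forall K, exists k, forall i, poly_on (csimplex (K_ K)) k (fun x => z x i 0).
Hypothesis zb : H1D_conditions Om M dD z.
Hypothesis hP : pressure_space Om M P.
Hypothesis zdiv : forall r, P r -> 0 = intOm M (fun x => divg z x * r x).

Lemma transport_stress :
  \sum_i \sum_j intOm M (fun x => frob (z x i 0 *: Lambda M (B t) i j x) (pd j GG x)) = 0.
Proof.
have [w [G [pw pG dG zw]]] := cell_poly zp.
pose C K i j := frob (\sum_m ((invmx (edges (K_ K))^T) i m * ((edges (K_ K))^T) m j) *: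
  hatLambda K (B t) m) (\sum_k gbary (K_ K) k j 0 *: stress (Bn K k)).
have E K i j x : osimplex (K_ K) x ->
    frob (z x i 0 *: Lambda M (B t) i j x) (pd j GG x) = w K x i 0 * C K i j.
  move=> xK; rewrite frobZl (zw K x (osimplex_csimplex xK)) /C; congr (_ * frob _ _).
    by rewrite /Lambda (pwconstE hM _ xK).
  by apply: (pd_bary (K := K)) => // y; exact: GE.
have pf i j : cell_polyf M (fun x => frob (z x i 0 *: Lambda M (B t) i j x) (pd j GG x)).
  move=> K; exists (fun x => w K x i 0 * C K i j); last exact: E.
  by apply: polyfM => //; exact: polyf_cst.
under eq_bigr do rewrite -(intOm_sum hM)//.
rewrite -(intOm_sum hM) => [|i _]; last by apply: cell_polyf_sum.
have [SL LE] := interp1_spec hM (fun x => ln (\det (B t x))).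
have T0 := transport_zero hM oOm zp zb SL (divergence_free hM oOm zp hP zdiv SL).
rewrite -[RHS](mulr0 (modG c / 2)) -[X in _ = _ * X]T0 mulr_sumr; apply: eq_bigr => K _.
have bK := bmeas_osimplex (mesh_nondeg hM K).
have pF : polyf (fun x => frob (w K x) (\sum_k interp Om M 1 (fun x => ln (\det (B t x))) (K_ K k) *: gbary (K_ K) k)).
  by under eq_fun do rewrite frobC; apply: polyf_frob => i j; rewrite ord1.
rewrite (@Lint_ext _ _ _ (fun x => frob (z x) _) _ (fun x xK => congr1 (frob^~ _) (zw K x (osimplex_csimplex xK)))).
rewrite -LintZ//; apply: Lint_ext => x xK.
under eq_bigr do under eq_bigr do rewrite (E _ _ _ _ xK).
rewrite frob_col mulr_sumr; apply: eq_bigr => i _; rewrite -mulr_sumr /C Lambda_chain_rule mulrCA.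
congr (_ * (_ * _)); congr (fun_of_matrix _ i 0); apply: eq_bigr => k _.
by rewrite LE.
Qed.

(* At the nodes, [stress B *m B] is [G / 2 (B - 1)]. *)
Lemma interp_stress :
  2 * intOm M (fun x => frob (grad z x) (interp_mx Om M 1 (fun y => GG y *m B t y) x)) =
  modG c * intOm M (fun x => frob (B t x - 1%:M) (grad z x)).
Proof.
have [w [G [pw pG dG zw]]] := cell_poly zp.
have IE K x : osimplex (K_ K) x ->
    interp_mx Om M 1 (fun y => GG y *m B t y) x = (modG c / 2) *: (B t x - 1%:M).
  move=> xK; rewrite (interp_mx1E hM _ (osimplex_csimplex xK)) (BE xK).
  have -> : 1%:M = \sum_k bary (K_ K) k x *: 1%:M :> 'M[R]_d.
    by rewrite -scaler_suml sum_bary scale1r.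
  rewrite -sumrB scaler_sumr; apply: eq_bigr => k _.
  have -> : GG (K_ K k) = stress (Bn K k).
    by rewrite (stress_testE hM _ _ _ (@vertex_csimplex _ _ _ (K_ K) k)) (nodal_interp hM).
  rewrite -scalerBr scalerA mulrC -scalerA; congr (_ *: _); rewrite -scalemxAl mulmxBl mul1mx.
  by rewrite mulVmx//; exact: posdef_unit.
have cp : cell_polyf M (fun x => frob (B t x - 1%:M) (grad z x)).
  move=> K; exists (fun x => frob (\sum_k bary (K_ K) k x *: Bn K k - 1%:M) (\matrix_(i, j) G K i j x)).
    apply: polyf_frob2 => i j; under eq_fun do rewrite mxE; last exact: pG.
    by apply: polyfD; [exact: polyf_nodal|exact: polyf_cst].
  by move=> x xK; rewrite (BE xK) (grad_cell hM dG zw xK).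
have -> : modG c = 2 * (modG c / 2) by rewrite mulrC divfK// pnatr_eq0.
rewrite -mulrA; congr (_ * _); rewrite -(intOmZ hM)//.
apply: intOm_ext => K x xK; rewrite (IE K x xK) frobC frobZl; congr (_ * _).
Qed.

End TensorTerms.

(** * The diffusion bound on non-obtuse meshes *)

Section Diffusion.
Context {R : realType} {n : nat}.
Local Notation d := n.+1.
Local Notation pt := 'cV[R]_d.

(* With zero row sums only the differences between nodes matter. *)
Lemma sum_polar N (g : 'I_N -> 'I_N -> R) (b : 'I_N -> 'I_N -> R) :
  (forall k l, g k l = g l k) -> (forall k, \sum_l g k l = 0) ->
  \sum_k \sum_l g k l * (b k k - b k l - b l k + b l l) = - (2 * \sum_k \sum_l g k l * b k l).
Proof.
move=> gS g0.
have E1 : \sum_k \sum_l g k l * b k k = 0.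
  by rewrite big1// => k _; rewrite -mulr_suml g0 mul0r.
have E2 : \sum_k \sum_l g k l * b l l = 0.
  rewrite exchange_big big1//= => l _; rewrite -mulr_suml.
  by under eq_bigr do rewrite gS; rewrite g0 mul0r.
have E3 : \sum_k \sum_l g k l * b l k = \sum_k \sum_l g k l * b k l.
  by rewrite exchange_big; apply: eq_bigr => k _; apply: eq_bigr => l _; rewrite gS.
transitivity (\sum_k \sum_l g k l * b k k - \sum_k \sum_l g k l * b k l
   - \sum_k \sum_l g k l * b l k + \sum_k \sum_l g k l * b l l); last by rewrite E1 E2 E3; ring.
rewrite -!sumrB -big_split; apply: eq_bigr => k _ /=; rewrite -!sumrB -big_split.
by apply: eq_bigr => l _ /=; ring.
Qed.

Lemma frob_sum2 p q N (a c : 'I_N -> 'M[R]_(p, q)) (g : 'I_N -> pt) :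
  \sum_j frob (\sum_k g k j 0 *: a k) (\sum_l g l j 0 *: c l) =
  \sum_k \sum_l frob (g k) (g l) * frob (a k) (c l).
Proof.
under eq_bigr do rewrite frob_suml; rewrite exchange_big; apply: eq_bigr => k _ /=.
under eq_bigr do rewrite frob_sumr; rewrite exchange_big; apply: eq_bigr => l _ /=.
by rewrite frob_col mulr_suml; apply: eq_bigr => j _; rewrite frobZl frobZr mulrA.
Qed.

(** Since the gradients sum to zero, both sides become sums over pairs of nodes of
    [frob (g k) (g m)] times a difference expression. The weights of distinct pairs are nonpositive,
    so the bound [frob_gap_ge_ln] for each pair suffices. *)
Lemma diffusion_ge N (g : 'I_N -> pt) (A : 'I_N -> 'M[R]_d) (c : R) : 0 <= c ->
  \sum_k g k = 0 -> (forall k l, k != l -> frob (g k) (g l) <= 0) ->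
  (forall k, posdef (A k)) ->
  c / d%:R * frob (\sum_k ln (\det (A k)) *: g k) (\sum_k ln (\det (A k)) *: g k) <=
  \sum_j frob (\sum_k g k j 0 *: A k) (\sum_k g k j 0 *: (c *: (1%:M - invmx (A k)))).
Proof.
move=> c0 g0 gk pA; rewrite frob_sum2; set l := fun k => ln (\det (A k)).
pose H k := c *: (1%:M - invmx (A k)).
have gS k m : frob (g k) (g m) = frob (g m) (g k) by exact: frobC.
have gz k : \sum_m frob (g k) (g m) = 0 by rewrite -frob_sumr g0 frob0r.
rewrite frob_suml; under eq_bigr do rewrite frobZl frob_sumr mulr_sumr.
have -> : \sum_k \sum_m l k * frob (g k) (l m *: g m) = \sum_k \sum_m frob (g k) (g m) * (l k * l m).
  by apply: eq_bigr => k _; apply: eq_bigr => m _; rewrite frobZr; ring.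
have P1 := sum_polar (fun k m => l k * l m) gS gz.
have P2 := sum_polar (fun k m => frob (A k) (H m)) gS gz.
(* Multiplication by [-2] brings both forms into the shape of [sum_polar] and reverses the
   inequality; the nonpositive weights reverse it once more. *)
rewrite -(ler_nM2l (_ : - (2 : R) < 0)) ?oppr_lt0//.
rewrite mulNr -P2 mulNr mulrCA -mulrN -P1 mulr_sumr; apply: ler_sum => k _.
rewrite mulr_sumr; apply: ler_sum => m _.
have -> : frob (A k) (H k) - frob (A k) (H m) - frob (A m) (H k) + frob (A m) (H m) =
    c * frob (A k - A m) (invmx (A m) - invmx (A k)).
  have -> : c * frob (A k - A m) (invmx (A m) - invmx (A k)) = frob (A k - A m) (H k - H m).
    rewrite -frobZr /H -scalerBr; congr (frob _ (_ *: _)).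
    by rewrite opprB [RHS]addrC addrA subrK.
  by rewrite frobBr !frobBl; ring.
have [->|km] := eqVneq k m; first by rewrite !subrr frob0r !mulr0 add0r addNr !mulr0.
rewrite [leRHS]mulrCA; apply: ler_wnM2l; first exact: gk.
rewrite -mulrA; apply: ler_wpM2l => //; rewrite ler_pdivrMl ?ltr0n//.
by apply: le_trans (frob_gap_ge_ln (pA k) (pA m)); rewrite (_ : _ + _ = (l k - l m) ^+ 2)//; ring.
Qed.

Variables (Om : set pt) (M : @mesh R n).
Hypothesis hM : regular_partition Om M.
Local Notation K_ := (@cell _ _ M).

(** Both outer normals are negative multiples of the gradients, so the two signs cancel in the
    product and the angle condition on the normals carries over. *)
Lemma nonobtuse_gbary K k l : nonobtuse (K_ K) -> k != l ->
  frob (gbary (K_ K) k) (gbary (K_ K) l) <= 0.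
Proof.
move=> no kl; have ok := outer_normal_gbary hM K k; have ol := outer_normal_gbary hM K l.
have := no k l _ _ kl ok ol.
have [+ _ _] := ok; have [+ _ _] := ol.
move: ok ol; set rk := Num.sqrt _; set rl := Num.sqrt _ => ok ol.
set nl := _ *: gbary _ l; set nk := _ *: gbary _ k => nl1 nk1 ac.
(* Inverting [acos] requires its argument to lie in [[-1, 1]]; this is Cauchy-Schwarz for unit
   vectors, read off the squared lengths of [nk - nl] and [nk + nl]. *)
have x1 : -1 <= - frob nk nl <= 1.
  apply/andP; split.
    have := frob_ge0 (nk - nl); rewrite frobBl !frobBr nk1 nl1 (frobC nl); lra.
  have := frob_ge0 (nk + nl); rewrite frobDl !frobDr nk1 nl1 (frobC nl); lra.
have : 0 <= - frob nk nl.
  rewrite -[X in _ <= X]acosK ?in_itv//=; apply: cos_ge0_pihalf; rewrite ac andbT.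
  by apply: le_trans (acos_ge0 _) => //; rewrite oppr_le0 divr_ge0// pi_ge0.
rewrite oppr_ge0 /nk /nl frobZl frobZr mulrA mulrNN => x0.
rewrite -(pmulr_rle0 _ (_ : 0 < rk^-1 * rl^-1))// lt_neqAle mulr_ge0 ?invr_ge0 ?sqrtr_ge0// andbT eq_sym.
rewrite mulf_neq0//; apply/eqP => r0.
  by move: nk1; rewrite /nk r0 oppr0 scale0r frob0r => /eqP; rewrite eq_sym oner_eq0.
by move: nl1; rewrite /nl r0 oppr0 scale0r frob0r => /eqP; rewrite eq_sym oner_eq0.
Qed.

Variables (T : R) (c : physics (R := R)) (B : R -> pt -> 'M[R]_d) (t : R).
Hypothesis sB : forall t, 0 <= t <= T -> SSh Om M (B t) /\ posdef_on Om (B t).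
Hypothesis t0T : 0 <= t <= T.
Hypothesis G0 : 0 <= modG c.
Hypothesis al0 : 0 <= alpha c.
Hypothesis no : 0 < alpha c -> forall K, nonobtuse (K_ K).

(** All derivatives are constant on a cell, so the bound is applied cell by cell and multiplied by
    the volume. The constant [G / 2] of the stress becomes [G / (2 d)]. If [alpha c = 0], both sides
    vanish. *)
Lemma stress_diffusion_le : stress_diffusion Om M c B t <=
  alpha c * intOm M (fun x => \sum_j frob (pd j (B t) x) (pd j (stress_test M c B t) x)).
Proof.
rewrite /stress_diffusion; move: al0; rewrite le_eqVlt => /predU1P[<-|a0]; first by rewrite !mul0r.
have no1 := no a0.
have -> : alpha c * modG c / (2 * d%:R) = alpha c * (modG c / 2 / d%:R).
  by rewrite -mulrA invfM !mulrA.
rewrite -mulrA ler_pM2l// /intOm mulr_sumr; apply: ler_sum => K _.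
set b := fun k => B t (K_ K k); set L := interp _ _ _ _.
have pb k : posdef (b k) by have [_] := sB t0T; apply; exact: (vertex_closure hM).
have [SL LE] := interp1_spec hM (fun x => ln (\det (B t x))).
have bK := bmeas_osimplex (mesh_nondeg hM K).
pose g := gbary (K_ K).
have -> : Lint (osimplex (K_ K)) (fun x => \sum_j (pd j (L : pt -> R^o) x) ^+ 2) =
    frob (\sum_k ln (\det (b k)) *: g k) (\sum_k ln (\det (b k)) *: g k) * vol (osimplex (K_ K)).
  rewrite -Lint_cst//; apply: Lint_ext => x xK; rewrite frob_col; apply: eq_bigr => j _.
  rewrite (pd_bary_scalar hM (K := K) (a := fun k => ln (\det (b k))))// => [|y yK]; last first.
    by rewrite /L (interp1E hM _ (osimplex_csimplex yK)).
  by rewrite -expr2 summxE; congr (_ ^+ 2); apply: eq_bigr => k _; rewrite [RHS]mxE mulrC.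
have -> : Lint (osimplex (K_ K)) (fun x => \sum_j frob (pd j (B t) x) (pd j (stress_test M c B t) x)) =
    (\sum_j frob (\sum_k g k j 0 *: b k) (\sum_k g k j 0 *: stress c (b k))) * vol (osimplex (K_ K)).
  rewrite -Lint_cst//; apply: Lint_ext => x xK; apply: eq_bigr => j _.
  rewrite (pd_bary hM (K := K) (a := b))// => [|y yK]; last first.
    by have [SB _] := sB t0T; exact: (SSh_bary hM SB (osimplex_csimplex yK)).
  rewrite (pd_bary hM (K := K) (a := fun k => stress c (b k)))// => y yK.
  exact: (stress_testE hM _ _ _ (osimplex_csimplex yK)).
rewrite mulrA ler_wpM2r ?vol_ge0//; apply: diffusion_ge => //.
- by rewrite divr_ge0.
- exact: sum_gbary.
- by move=> k l; apply: nonobtuse_gbary; exact: no1.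
Qed.

End Diffusion.

(** * The interface *)

Section SurfaceGradient.
Context {R : realType} {m d : nat}.
Variable v : 'I_m.+1 -> 'cV[R]_d.
Hypothesis nv : nondeg v.

Lemma csimplex_affine (f : 'cV[R]_d -> R) :
  (exists a b, forall x, csimplex v x -> f x = frob a x + b) ->
  forall x, csimplex v x -> f x = \sum_k bary v k x * f (v k).
Proof.
move=> [a [b fE]] x xv; have [_ xE] := (csimplexP nv x).1 xv.
rewrite (fE _ xv) {1}xE frob_sumr -[b]mul1r -(sum_bary v x) mulr_suml -big_split.
by apply: eq_bigr => k _ /=; rewrite frobZr fE ?mulrDr//; exact: vertex_csimplex.
Qed.

Lemma sgradv_bary (z : 'cV[R]_d -> 'cV[R]_d) x :
  (forall y i, osimplex v y -> z y i 0 = \sum_k bary v k y * z (v k) i 0) -> osimplex v x ->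
  sgradv v z x = edges (z \o v) *m invmx ((edges v)^T *m edges v) *m (edges v)^T.
Proof.
move=> zE xv; set g := _ *m edges v; have gT : g^T = g by rewrite trmx_mul trmxK.
apply: trmx_inj; rewrite !trmx_mul trmxK trmx_inv gT mulmxA.
apply/matrixP => j i; rewrite !mxE; apply: eq_bigr => l _; congr (_ * _); rewrite !mxE.
have := @derive_bary_tangent _ R^o _ _ v (fun y => z y i 0) (fun k => z (v k) i 0)
  (fun k => (k == lift ord0 l)%:R - (k == ord0)%:R) x nv (fun y => zE y i) xv.
rewrite sumrB !sum_eq subrr => /(_ erefl).
have sE (V : lmodType R) (F : 'I_m.+1 -> V) :
    \sum_k ((k == lift ord0 l)%:R - (k == ord0)%:R) *: F k = F (lift ord0 l) - F ord0.
  by under eq_bigr do rewrite scalerBl; rewrite sumrB !sum_delta.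
rewrite !sE (_ : v _ - v _ = col l (edges v)) => [D|]; last by apply/colP => a; rewrite !mxE.
exact: derive_val.
Qed.

(** The surface gradient of the identity is the orthogonal projection onto the tangent space, so it
    drops out of the pairing. What remains is the expression for the rate of change of the area
    element in [has_ddt_gram]. *)
Lemma sgradv_pairing (z : 'cV[R]_d -> 'cV[R]_d) :
  (forall y i, osimplex v y -> z y i 0 = \sum_k bary v k y * z (v k) i 0) ->
  surf_int v (fun x => frob (sgradv v id x) (sgradv v z x)) =
  gram v * \tr (invmx ((edges v)^T *m edges v) *m (edges v)^T *m edges (z \o v)) / m`!%:R.
Proof.
move=> zE; rewrite /surf_int -mulrA -(Psi_cst v); congr (_ * _).
rewrite -[LHS]/(Psi v (fun x => frob (sgradv v id x) (sgradv v z x))); apply: Psi_ext => x xv.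
have idE y i : osimplex v y -> y i 0 = \sum_k bary v k y * v k i 0.
  move=> /osimplex_csimplex/(csimplexP nv)[_ {1}->]; rewrite summxE.
  by apply: eq_bigr => k _; rewrite mxE.
rewrite !sgradv_bary// frobE.
rewrite (_ : edges (id \o v) = edges v)//; set E := edges v; set g := E^T *m E.
have ug : g \in unitmx by exact: nv.
have gT : g^T = g by rewrite trmx_mul trmxK.
rewrite !trmx_mul trmxK trmx_inv gT !mulmxA.
by rewrite mxtrace_mulC !mulmxA -/g mulmxV// mul1mx mxtrace_mulC mulmxA.
Qed.

End SurfaceGradient.

Lemma gram_gt0_nondeg {R : realType} m d (v : 'I_m.+1 -> 'cV[R]_d) : 0 < gram v -> nondeg v.
Proof.
rewrite /gram sqrtr_gt0 => g0; rewrite /nondeg unitmxE unitfE; exact: lt0r_neq0.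
Qed.

Section SurfaceArea.
Context {R : realType} {n : nat}.
Local Notation d := n.+1.
Local Notation pt := 'cV[R]_d.
Variables (nv ne : nat) (el : 'I_ne -> 'I_d -> 'I_nv).

Lemma area_nondeg (q : 'I_nv -> pt) s : 0 < area (elt el q s) -> nondeg (elt el q s).
Proof.
rewrite /area pmulr_lgt0 ?invr_gt0 ?ltr0n ?fact_gt0//; exact: gram_gt0_nondeg.
Qed.

(** First variation of area, element by element: the rate of the area element and the surface
    pairing of the identity with the vertex velocity are the same trace. *)
Lemma has_ddt_areaG (T t : R) (q : R -> 'I_nv -> pt) (z : pt -> pt) :
  (forall s, 0 < area (elt el (q t) s)) -> VGv el (q t) z ->
  (forall k, has_ddt T (fun s => q s k) t (z (q t k))) ->
  has_ddt T (fun s => areaG el (q s) : R^o) t (dirichletG el (q t) id z).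
Proof.
move=> a0 Vz dq; apply: has_ddt_sum => s _; set v := elt el (q t) s.
have nv' : nondeg v by exact: area_nondeg.
rewrite sgradv_pairing// => [|y i yv]; last first.
  by have [_ /(_ s) zA] := Vz i; exact: (csimplex_affine nv' zA (osimplex_csimplex yv)).
have g0 : 0 < gram v by move: (a0 s); rewrite /area pmulr_lgt0 ?invr_gt0 ?ltr0n ?fact_gt0.
have := has_ddt_gram (v := fun s' => elt el (q s') s) (v' := z \o v) g0 (fun k => dq (el s k)).
move=> /(has_ddtZ (V := R^o) (c := n`!%:R^-1)).
rewrite -[_ *: (_ * _)]/(_ * _) mulrC.
by congr has_ddt; apply/funext => s'; rewrite /area mulrC.
Qed.

End SurfaceArea.

Section HatFunctions.
Context {R : realType} {n : nat}.
Local Notation d := n.+1.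
Local Notation pt := 'cV[R]_d.
Variables (nv ne : nat) (el : 'I_ne -> 'I_d -> 'I_nv) (q : 'I_nv -> pt).
Local Notation elt := (elt el q).
Hypothesis hS : closed_hypersurface el q.
Hypothesis a0 : forall s, 0 < area (elt s).

Lemma face_mono m p (v : 'I_m.+1 -> 'cV[R]_p) (J J' : {set 'I_m.+1}) :
  J \subset J' -> face v J `<=` face v J'.
Proof.
move=> JJ x [l [l0 lJ l1 xE]]; exists l; split=> // k kJ; apply: lJ.
by apply: contra kJ; exact: (fintype.subsetP JJ).
Qed.

Lemma elt_nondeg s : nondeg (elt s).
Proof. exact: area_nondeg. Qed.

Lemma elt_conf s s' : csimplex (elt s) `&` csimplex (elt s') `<=`
  face (elt s) [set k | [exists k', elt s k == elt s' k']]%SET.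
Proof.
have [_ _ _ /(_ s s') H] := hS; apply: (subset_trans H); apply: face_mono.
apply/fintype.subsetP => k; rewrite !inE => /imsetP[k' _ E].
by apply/existsP; exists k'; rewrite /Defs.elt E.
Qed.

(** An interior point has only positive barycentric coordinates, so by conformity every vertex of
    [s] belongs to [s']. Equal cardinality gives equal vertex sets, which determine the element. *)
Lemma osimplex_elt_inj s s' x : osimplex (elt s) x -> osimplex (elt s') x -> s = s'.
Proof.
have [[einj vinj _ _] _ _ H] := hS; move=> xs xs'; apply: vinj.
have card r : #|vset el r| = d by rewrite /vset card_imset ?card_ord//; exact: einj.
apply/eqP; rewrite eqEcard !card leqnn andbT; apply/fintype.subsetP => _ /imsetP[j _ ->].
apply: contrapT => /negP jn.
have := face_bary (elt_nondeg s) (H s s' x (conj (osimplex_csimplex xs) (osimplex_csimplex xs'))).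
move=> /(_ j); rewrite inE => /(_ jn) b0.
by have [/(_ j)] := (osimplex_bary (elt_nondeg s) x).1 xs; rewrite b0 ltxx.
Qed.

Lemma nuhE (nu : 'I_ne -> pt) s x : osimplex (elt s) x -> nuh el q nu x = nu s.
Proof.
move=> xs; rewrite /nuh (bigD1 s)//= indicE mem_set// scale1r big1 ?addr0// => s' ss'.
rewrite indicE memNset ?scale0r// => xs'; move/eqP: ss'; apply.
exact: osimplex_elt_inj xs' xs.
Qed.

Definition hat (k : 'I_nv) : pt -> R := glue elt (fun y => (y == q k)%:R).

Lemma hat_bary k s x : csimplex (elt s) x ->
  hat k x = \sum_j bary (elt s) j x * (el s j == k)%:R.
Proof.
move=> xs; rewrite /hat (glueE elt_nondeg elt_conf _ xs); apply: eq_bigr => j _.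
by have [[_ _ qinj _] _ _ _] := hS; rewrite (inj_eq qinj).
Qed.

Lemma hat_vertex k s j : hat k (elt s j) = (el s j == k)%:R.
Proof.
rewrite /hat (glue_vertex elt_nondeg elt_conf).
by have [[_ _ qinj _] _ _ _] := hS; rewrite (inj_eq qinj).
Qed.

Lemma VGv_hat k (w : pt) : VGv el q (fun x => hat k x *: w).
Proof.
move=> i; split.
  rewrite (_ : (fun x => _) = fun x => hat k x * w i 0); last by apply/funext => x; rewrite mxE.
  move=> x; apply: cvgMl; exact: (glue_continuous elt_nondeg elt_conf).
move=> s; exists (\sum_j ((el s j == k)%:R * w i 0) *: gbary (elt s) j),
  (\sum_j ((j == ord0)%:R - frob (gbary (elt s) j) (elt s ord0)) * (el s j == k)%:R * w i 0) => x xs.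
rewrite mxE (hat_bary k xs) frob_suml -big_split mulr_suml; apply: eq_bigr => j _ /=.
by rewrite /bary frobBr frobZl; ring.
Qed.

Lemma lumpG_hat (kap : pt -> R) (nu : 'I_ne -> pt) k w : VG el q kap ->
  lumpG el q (fun x => frob (kap x *: nuh el q nu x) (hat k x *: w)) =
  d%:R^-1 * \sum_s area (elt s) * ((k \in vset el s)%:R * (kap (q k) * frob (nu s) w)).
Proof.
move=> [_ kA]; rewrite /lumpG; congr (_ * _); apply: eq_bigr => s _; congr (_ * _).
have ns := elt_nondeg s.
pose K x := \sum_j bary (elt s) j x * kap (elt s j).
pose H x := \sum_j bary (elt s) j x * (el s j == k)%:R.
have pbar (f : 'I_d -> R) : polyf (fun x => \sum_j bary (elt s) j x * f j).
  by apply: polyf_sum => j _; apply: polyfM; [exact: polyf_bary|exact: polyf_cst].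
have vE (f : 'I_d -> R) j : \sum_i bary (elt s) i (elt s j) * f i = f j.
  by under eq_bigr do rewrite bary_vertex//; exact: (sum_delta (V := R^o)).
transitivity (\sum_j kap (elt s j) * (el s j == k)%:R * frob (nu s) w).
  apply: eq_bigr => j _; apply: cvg_lim => //.
  rewrite -(vE (fun i => kap (elt s i))) -(vE (fun i => (el s i == k)%:R)).
  apply: (@cvg_within_osimplex _ _ _ (elt s) j _ (fun x => K x * H x * frob (nu s) w)).
    move=> x xs; rewrite (nuhE nu xs) frobZl frobZr; have xc := osimplex_csimplex xs.
    by rewrite (csimplex_affine ns (kA s) xc) (hat_bary k xc) mulrA.
  by apply: polyf_continuous; apply: polyfM; [apply: polyfM; exact: pbar|exact: polyf_cst].
have [[einj _ _ _] _ _ _] := hS.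
have [/imsetP[i _ kE]|kn] := boolP (k \in vset el s); last first.
  rewrite mul0r big1// => j _; case: eqP => [jk|_]; last by rewrite mulr0 mul0r.
  by move: kn; rewrite -jk imset_f.
rewrite (bigD1 i)//= -kE eqxx mulr1 mul1r big1 ?addr0; first by rewrite /Defs.elt -kE.
by move=> j ji; rewrite kE (inj_eq (@einj s)) (negbTE ji) mulr0 mul0r.
Qed.

(** The hat function times a constant [w] has, along the edges of an element, the rank-one increment
    [w] times the row of increments of the hat. Only elements containing vertex [k] contribute. *)
Lemma curvature_at_vertex (kap : pt -> R) (nu : 'I_ne -> pt) k w : VG el q kap ->
  curvature_identity el q nu kap id ->
  0 = \sum_s (d%:R^-1 * kap (q k) * (area (elt s) * ((k \in vset el s)%:R * frob (nu s) w)) +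
     gram (elt s) * \tr (invmx ((edges (elt s))^T *m edges (elt s)) *m (edges (elt s))^T
       *m (w *m \row_j ((el s (lift ord0 j) == k)%:R - (el s ord0 == k)%:R))) / n`!%:R).
Proof.
move=> Vk /(_ _ (VGv_hat k w)); rewrite lumpG_hat// => E; rewrite [LHS]E.
rewrite /dirichletG mulr_sumr -big_split; apply: eq_bigr => s _ /=; congr (_ + _).
  by ring.
rewrite sgradv_pairing; last 2 first.
- exact: elt_nondeg.
- move=> y i yv; rewrite mxE (hat_bary k (osimplex_csimplex yv)) mulr_suml; apply: eq_bigr => j _.
  by rewrite hat_vertex mxE mulrA.
congr (_ * \tr (_ *m _) / _); apply/matrixP => i j; rewrite !mxE big_ord1 !mxE.
by rewrite !hat_vertex; ring.
Qed.

End HatFunctions.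

(** * Closed polygonal curves in the plane *)

Section PlanarCurves.
Context {R : realType}.
Local Notation pt := 'cV[R]_2.

Lemma frob2 (a b : pt) : frob a b = a 0 0 * b 0 0 + a 1 0 * b 1 0.
Proof.
rewrite frob_col !big_ord_recl big_ord0 addr0.
by rewrite (_ : lift ord0 ord0 = 1)//; apply/val_inj.
Qed.

Definition rot (a : pt) : pt := \col_i (if i == 0 then - a 1 0 else a 0 0).

Lemma rotE0 a : rot a 0 0 = - a 1 0. Proof. by rewrite mxE. Qed.
Lemma rotE1 a : rot a 1 0 = a 0 0. Proof. by rewrite mxE. Qed.

(** In the plane a vector orthogonal to the unit normal [n] is a multiple of the quarter turn of
    [n]; Lagrange's identity shows that the multiple is the length of [a] up to a sign. *)
Lemma tangent_rot (a n : pt) (la : R) : 0 < la -> la ^+ 2 = frob a a ->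
  frob n n = 1 -> frob a n = 0 -> exists2 s : R, s ^+ 2 = 1 & a = (s * la) *: rot n.
Proof.
move=> la0 laE n1 an; pose s := (a 1 0 * n 0 0 - a 0 0 * n 1 0) / la.
move: laE n1 an; rewrite !frob2 => laE n1 an.
have sl : s * la = a 1 0 * n 0 0 - a 0 0 * n 1 0 by rewrite divfK// gt_eqF.
exists s.
  have l2 : la ^+ 2 != 0 by rewrite expf_neq0// gt_eqF.
  apply: (mulIf l2); rewrite -exprMn sl mul1r laE.
  move: (n 0 0) (n 1 0) (a 0 0) (a 1 0) n1 an => x y u v n1 an.
  transitivity ((u * u + v * v) * (x * x + y * y) - (u * x + v * y) ^+ 2); first by ring.
  by rewrite n1 an expr0n subr0 mulr1.
apply/colP => i; rewrite sl [RHS]mxE; case: (unliftP ord0 i) => [j|] ->.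
  rewrite (_ : lift ord0 j = 1) ?rotE1; last by rewrite (ord1 j); apply/val_inj.
  move: (n 0 0) (n 1 0) (a 0 0) (a 1 0) n1 an => x y u v n1 an.
  transitivity (v * (x * x + y * y) - y * (u * x + v * y)); last by ring.
  by rewrite n1 an mulr0 subr0 mulr1.
rewrite rotE0; move: (n 0 0) (n 1 0) (a 0 0) (a 1 0) n1 an => x y u v n1 an.
transitivity (u * (x * x + y * y) - x * (u * x + v * y)); last by ring.
by rewrite n1 an mulr0 subr0 mulr1.
Qed.

(* Testing with the vector [w] orthogonal to [la *: n + lb *: n'] eliminates [k];
   with [x] the cosine of the angle between the normals, what remains is
   [(la + lb) (1 + x) = 0] or [(la - lb) (1 - x) = 0]. *)
Lemma equal_or_parallel (a b n n' : pt) (la lb e e' k : R) : 0 < la -> 0 < lb ->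
  la ^+ 2 = frob a a -> lb ^+ 2 = frob b b -> frob n n = 1 -> frob n' n' = 1 ->
  frob a n = 0 -> frob b n' = 0 -> e ^+ 2 = 1 -> e' ^+ 2 = 1 ->
  (forall w, k * (la * frob n w + lb * frob n' w) + (e / la * frob a w + e' / lb * frob b w) = 0) ->
  la = lb \/ exists2 r : R, r != 0 & b = r *: a.
Proof.
move=> la0 lb0 laE lbE n1 n1' an bn' e1 e1' H.
have [s s1 aE] := tangent_rot la0 laE n1 an; have [s' s1' bE] := tangent_rot lb0 lbE n1' bn'.
pose x := frob n n'.
have nr u v : frob u (rot v) = - frob v (rot u) by rewrite !frob2 !rotE0 !rotE1; ring.
have rr u v : frob (rot u) (rot v) = frob u v by rewrite !frob2 !rotE0 !rotE1; ring.
have r0 u : frob u (rot u) = 0 by rewrite frob2 rotE0 rotE1; ring.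
have := H (la *: rot n + lb *: rot n').
rewrite !frobDr !frobZr !r0 (nr n' n) aE bE !frobZl !rr n1 n1' (frobC n' n) -/x.
have -> : k * (la * (la * 0 + lb * frob n (rot n')) + lb * (la * - frob n (rot n') + lb * 0)) = 0 by ring.
rewrite add0r.
have -> : e / la * (la * (s * la * 1) + lb * (s * la * x)) = (e * s) * (la + lb * x) by field; exact: lt0r_neq0.
have -> : e' / lb * (la * (s' * lb * x) + lb * (s' * lb * 1)) = (e' * s') * (la * x + lb) by field; exact: lt0r_neq0.
have sgn1 (y z : R) : y ^+ 2 = 1 -> z ^+ 2 = 1 -> y * z = 1 \/ y * z = -1.
  move=> y1 z1; have /eqP : (y * z) ^+ 2 = 1 by rewrite exprMn y1 z1 mulr1.
  by rewrite sqrf_eq1 => /orP[/eqP|/eqP]; [left|right].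
have parallel (t : R) : t ^+ 2 = 1 -> n' = t *: n -> exists2 r : R, r != 0 & b = r *: a.
  move=> t1 nE; have sne0 (y : R) : y ^+ 2 = 1 -> y != 0.
    by move=> y1; rewrite -sqrf_eq0 y1 oner_eq0.
  exists (s' * lb * t / (s * la)).
    have [h1 h2 h3] := And3 (sne0 _ t1) (sne0 _ s1) (sne0 _ s1').
    have [h4 h5] := (lt0r_neq0 la0, lt0r_neq0 lb0).
    by rewrite !mulf_eq0 !invr_eq0 !mulf_eq0 (negbTE h1) (negbTE h2) (negbTE h3) (negbTE h4) (negbTE h5).
  rewrite bE aE scalerA divfK; last exact: mulf_neq0 (sne0 _ s1) (lt0r_neq0 la0).
  rewrite nE -[RHS]scalerA; congr (_ *: _); apply/colP => i; rewrite !mxE.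
  by case: ifP => _ //; rewrite mulrN.
have xp : x = 1 -> n' = 1 *: n.
  move=> x1; rewrite scale1r; apply/eqP; rewrite -subr_eq0 -frob_eq0 frobBl !frobBr n1 n1' (frobC n' n) -/x x1.
  by apply/eqP; ring.
have xm : x = -1 -> n' = (-1) *: n.
  move=> x1; rewrite scaleN1r; apply/eqP; rewrite -addr_eq0 -frob_eq0 frobDl !frobDr n1 n1' (frobC n' n) -/x x1.
  by apply/eqP; ring.
have pos : la + lb != 0 by rewrite gt_eqF// addr_gt0.
have same : (la + lb) * (1 + x) = 0 -> la = lb \/ exists2 r : R, r != 0 & b = r *: a.
  move=> /eqP; rewrite mulf_eq0 (negbTE pos) /= addrC addr_eq0 => /eqP/xm nE.
  by right; apply: parallel nE; rewrite sqrrN expr1n.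
have opp : (la - lb) * (1 - x) = 0 -> la = lb \/ exists2 r : R, r != 0 & b = r *: a.
  move=> /eqP; rewrite mulf_eq0 !subr_eq0 => /orP[/eqP|/eqP/esym/xp nE]; first by left.
  by right; apply: parallel nE; rewrite expr1n.
rewrite -aE -bE.
(* Equal signs give [(la + lb) (1 + x) = 0], hence opposite normals; different signs give
   [(la - lb) (1 - x) = 0], hence equal lengths or equal normals. *)
have [->|->] := sgn1 _ _ e1 s1; have [->|->] := sgn1 _ _ e1' s1' => E.
- by apply: same; rewrite -E; ring.
- by apply: opp; rewrite -E; ring.
- by apply: opp; apply/eqP; rewrite -oppr_eq0; apply/eqP; rewrite -[RHS]E; ring.
- by apply: same; apply/eqP; rewrite -oppr_eq0; apply/eqP; rewrite -[RHS]E; ring.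
Qed.

Variables (nv ne : nat) (el : 'I_ne -> 'I_2 -> 'I_nv) (q : 'I_nv -> pt).
Variables (nu : 'I_ne -> pt) (Ex : set pt).
Hypothesis hS : closed_hypersurface el q.
Hypothesis a0 : forall s, 0 < area (elt el q s).
Hypothesis hnu : forall s, unit_normal_into el q Ex s (nu s).

(** On a curve the facets of an element are single vertices, so the condition that a facet lies in
    exactly two elements counts the elements at a vertex. *)
Lemma vertex_star s s' k : s != s' -> k \in vset el s -> k \in vset el s' ->
  forall r, k \in vset el r -> r = s \/ r = s'.
Proof.
move=> ss' ks ks' r kr; have [_ facets _ _] := hS.
have [j jE] : exists j, facet el s j = [set k]%SET.
  have /imsetP[i _ kE] := ks; exists (lift i ord0); apply/setP => y; rewrite inE.
  apply/imsetP/eqP => [[i' + ->]|->].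
    rewrite !inE => ii'; rewrite kE; congr (el s _).
    move: ii'; apply: contraNeq; case: (unliftP i i') => [i0|] ->; last by rewrite eqxx.
    by rewrite !ord1 eqxx.
  by exists i; rewrite // !inE neq_lift.
have := facets s j; rewrite jE => c2.
have sub : [set s; s']%SET \subset [set r' | [set k]%SET \subset vset el r']%SET.
  by apply/fintype.subsetP => r'; rewrite !inE finset.sub1set => /orP[/eqP->|/eqP->].
have /eqP E : [set s; s']%SET == [set r' | [set k]%SET \subset vset el r']%SET.
  by rewrite eqEcard sub c2 cards2 ss'.
have : r \in [set s; s']%SET by rewrite E inE finset.sub1set.
by rewrite !inE => /orP[/eqP|/eqP]; [left|right].
Qed.

Lemma gram_planar s : gram (elt el q s) ^+ 2 = frob (edges (elt el q s)) (edges (elt el q s)).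
Proof.
rewrite /gram sqr_sqrtr det_mx11 mxE; under eq_bigr do rewrite mxE; rewrite -frob_col//.
exact: frob_ge0.
Qed.

Lemma planar_weakly_equidistributed kap : VG el q kap -> curvature_identity el q nu kap id ->
  weakly_equidistributed el q.
Proof.
move=> Vk cid s s' ss' /set0Pn[k]; rewrite inE => /andP[ks ks'].
have star := vertex_star ss' ks ks'.
pose la r := gram (elt el q r); pose a r : pt := edges (elt el q r).
(* The increment of the hat function along element [r]: [1] or [-1] when [k] is its second or first
   vertex, and [0] when [k] is not a vertex of it. *)
pose e r : R := (el r (lift ord0 ord0) == k)%:R - (el r ord0 == k)%:R.
have areaE r : area (elt el q r) = la r by rewrite /area divr1.
have la0 r : 0 < la r by rewrite -areaE.
have laE r : la r ^+ 2 = frob (a r) (a r) by exact: gram_planar.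
have e1 r : k \in vset el r -> e r ^+ 2 = 1.
  have [[/(_ r) einj _ _ _] _ _ _] := hS.
  move=> /imsetP[i _ kE]; rewrite /e kE !(inj_eq einj).
  case: (unliftP ord0 i) => [j|] ->.
    by rewrite (ord1 j) eqxx (negbTE (neq_lift _ _)) subr0 expr1n.
  by rewrite eq_sym (negbTE (neq_lift _ _)) eqxx sub0r sqrrN expr1n.
have e0 r : k \notin vset el r -> e r = 0.
  move=> kr; rewrite /e; do 2 (case: eqP => [E|_]; first by move: kr; rewrite -E imset_f).
  by rewrite subrr.
(* The factor [2^-1] is the lumping weight [1 / d] for [d = 2]. On a segment the Gram matrix is the
   squared length, so the trace term reduces to the edge over its length, with sign [e]. *)
have id_s w : (2^-1 * kap (q k)) * (la s * frob (nu s) w + la s' * frob (nu s') w) +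
    (e s / la s * frob (a s) w + e s' / la s' * frob (a s') w) = 0.
  have trE r : gram (elt el q r) * \tr (invmx ((edges (elt el q r))^T *m edges (elt el q r)) *m (edges (elt el q r))^T
       *m (w *m \row_j ((el r (lift ord0 j) == k)%:R - (el r ord0 == k)%:R))) / 1`!%:R =
       e r / la r * frob (a r) w.
    rewrite divr1 (mx11_scalar (_^T *m edges _)) invmx_scalar mul_scalar_mx -scalemxAl mxtraceZ.
    have -> : ((edges (elt el q r))^T *m edges (elt el q r)) 0 0 = la r ^+ 2.
      by rewrite laE frobE /a /mxtrace big_ord1.
    have -> : (\row_j ((el r (lift ord0 j) == k)%:R - (el r ord0 == k)%:R)) = (e r)%:M :> 'M[R]_1.
      by apply/matrixP => i j; rewrite !ord1 !mxE mulr1n.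
    rewrite mul_mx_scalar -scalemxAr mxtraceZ -frobE -/(la r) -/(a r).
    by field; exact: lt0r_neq0.
  have := curvature_at_vertex hS a0 k w Vk cid.
  rewrite (bigD1 s)//= (bigD1 s')/=; last by rewrite eq_sym.
  rewrite big1 ?addr0 => [|r /andP[rs rs']]; last first.
    have kr : k \notin vset el r.
      by apply/negP => /star[E|E]; [move: rs|move: rs']; rewrite E eqxx.
    by rewrite trE (negbTE kr) e0// !mul0r !mulr0 addr0.
  rewrite !trE ks ks' !areaE => E; by rewrite [RHS]E (_ : true%:R = 1 :> R)// !mul1r mulrDr addrACA.
have [l1 t1 _] := hnu s; have [l2 t2 _] := hnu s'.
have ort r : (edges (elt el q r))^T *m nu r = 0 -> frob (a r) (nu r) = 0.
  by move=> rE; rewrite frobE /a rE mxtrace0.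
have [E|[r r0 E]] := equal_or_parallel (la0 s) (la0 s') (laE s) (laE s') l1 l2 (ort _ t1) (ort _ t2)
  (e1 _ ks) (e1 _ ks') id_s; first by left; rewrite !areaE.
right; rewrite -/(a s) -/(a s') E linearZ /=; apply/andP; split; last exact: scalemx_sub.
by rewrite -{1}[(a s)^T](scalerK r0); apply: scalemx_sub; exact: submx_refl.
Qed.

End PlanarCurves.

(** * Assembling the energy law and equidistribution *)

Lemma phase_ge0 {R : realType} {n : nat} (Om : set 'cV[R]_n.+1) (M : @mesh R n) (I : interface)
    (am ap t : R) K x : regular_partition Om M -> 0 <= am -> 0 <= ap ->
  osimplex (@cell _ _ M K) x -> 0 <= phase Om M I am ap t x.
Proof.
move=> hM am0 ap0 xK; rewrite /phase (pwconstE (V := R^o) hM _ xK).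
by case: ifP => // _; case: ifP => // _; rewrite divr_ge0 ?addr_ge0.
Qed.

(* The space dimension is d = n + 1. *)
Theorem theorem3p10 (R : realType) (n : nat) (hd : n.+1 = 2%N \/ n.+1 = 3%N)
  (T : R) (hT : 0 < T)
  (Om : set 'cV[R]_n.+1) (hOm : lipschitz_domain Om) (hOm' : polyhedral_boundary Om)
  (M : mesh) (hM : regular_partition Om M)
  (dD : set 'cV[R]_n.+1) (hdD : dirichlet_part Om M dD)
  (c : physics) (hc : physics_ok c)
  (f1 f2 : R -> 'cV[R]_n.+1 -> 'cV[R]_n.+1)
  (hf1 : forcing Om T f1) (hf2 : forcing Om T f2)
  (U : set ('cV[R]_n.+1 -> 'cV[R]_n.+1)) (hU : velocity_space Om M dD U)
  (P : set ('cV[R]_n.+1 -> R)) (hP : pressure_space Om M P)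
  (I : interface) (hI : interface_ok T I)
  (u : R -> 'cV[R]_n.+1 -> 'cV[R]_n.+1) (p : R -> 'cV[R]_n.+1 -> R)
  (B : R -> 'cV[R]_n.+1 -> 'M[R]_n.+1) (kap : R -> 'cV[R]_n.+1 -> R)
  (dX : R -> 'cV[R]_n.+1 -> 'cV[R]_n.+1)
  (hsol : solution T Om M c f1 f2 I U P u p B kap dX)
  (hmesh : forall t, 0 < t <= T ->
     surface_mesh_assumptions (@conn _ _ I) (@vert _ _ I t) (@normal _ _ I t) Om)
  (hangle : 0 < alpha c -> forall K, nonobtuse (@cell _ _ M K)) :
  (forall t, 0 < t <= T ->
     exists2 dE : R,
       has_ddt T (energy Om M c I u B : R -> R^o) t dE &
       dE + viscous_dissipation Om M c I u t
          + relaxation_dissipation Om M c I B t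
          + stress_diffusion Om M c B t
       <= intOm M (fun x => frob (loadh Om M c f1 f2 I t x) (u t x))) /\
  (forall t, 0 < t <= T ->
     conformal (@conn _ _ I) (@vert _ _ I t) (@normal _ _ I t)) /\
  (n.+1 = 2%N -> forall t, 0 < t <= T ->
     weakly_equidistributed (@conn _ _ I) (@vert _ _ I t)).
Proof.
have oOm : open Om by case: hOm => -[].
have [[r0 r0' m0 m0'] [l0 l0' G0 g0] al0] := hc.
have sB := sol_B hsol; have dB := sol_dB hsol.
split; last split.
- move=> t t0T; have t0T' : 0 <= t <= T by move: t0T => /andP[/ltW -> ->].
  have [a0 _ _] := hmesh t t0T; have [VdX dq] := sol_dX hsol t0T.
  have [_ /(_ _ (sol_u hsol t0T'))[_ zp zb]] := hU.
  have [exK] := sol_momentum hsol t0T (conj (sol_u hsol) (sol_du hsol)).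
  have [_] := sol_tensor hsol t0T (test_fun_stress hM c sB dB).
  have zdiv r (Pr : P r) := sol_div hsol t0T Pr.
  have dE := has_ddt_elastic hM (c := c) sB dB t0T.
  have [lamK lamE] : exists lamK : 'I_(ncell M) -> R, forall K x, osimplex (cell K) x ->
      lamh Om M c I t x = lamK K.
    by eexists => K x xK; exact: (pwconstE (V := R^o) hM _ xK).
  rewrite /tensor_eq /momentum_eq (stress_pairing hM c sB dB t0T).
  rewrite (transport_stress hM oOm c sB t0T' zp zb hP zdiv).
  rewrite (relaxation_stress hM c sB t0T lamE) (interp_stress hM c sB t0T' zp).
  have sd := stress_diffusion_le hM sB t0T' (ltW G0) al0 hangle.
  have fC (a b : 'cV[R]_n.+1) k : frob (k *: a) b = frob (k *: b) a.
    by rewrite !frobZl frobC.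
  (* The kinematic equation replaces the fluid velocity by the vertex velocity in the lumped
     product, and the curvature equation then gives minus the first variation of area. With the
     minus sign of the capillary term this becomes the rate of the surface energy. *)
  have surf : intG (@conn _ _ I) (@vert _ _ I t) (fun x =>
      frob (kap t x *: nuh (@conn _ _ I) (@vert _ _ I t) (@normal _ _ I t) x) (u t x)) =
      - dirichletG (@conn _ _ I) (@vert _ _ I t) id (dX t).
    have E1 := sol_kinematic hsol t0T (sol_kap hsol t0T).
    have E2 := sol_curvature hsol t0T VdX.
    have F w : (fun x => frob (kap t x *: nuh (@conn _ _ I) (@vert _ _ I t) (@normal _ _ I t) x) (w x)) =
        (fun x => frob (w x) (nuh (@conn _ _ I) (@vert _ _ I t) (@normal _ _ I t) x) * kap t x).
      by apply/funext => x; rewrite frobZl frobC mulrC.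
    by move: E1 E2; rewrite !F; lra.
  have kinE s : intOm M (fun x => let z := Num.sqrt (rhoh Om M c I s x) *: u s x in frob z z) =
      kinetic Om M c I u u s.
    rewrite /kinetic; apply: intOm_ext => K x xK /=; rewrite frobZr frobZl frobZl mulrA -expr2 sqr_sqrtr//.
    by apply: (phase_ge0 _ _ hM) xK; exact: ltW.
  have viscE : viscous_dissipation Om M c I u t =
      intOm M (fun x => frob ((2 * muh Om M c I t x) *: symgrad (u t) x) (symgrad (u t) x)).
    rewrite /viscous_dissipation; apply: intOm_ext => K x xK /=; rewrite frobZr frobZl frobZl mulrA -expr2 sqr_sqrtr//.
    by rewrite mulr_ge0//; apply: (phase_ge0 _ _ hM) xK; exact: ltW.
  have presE : intOm M (fun x => p t x * divg (u t) x) = 0.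
    rewrite [RHS](sol_div hsol t0T (sol_p hsol t0T)); apply: intOm_ext => K x _.
    by rewrite mulrC.
  have dK := has_ddtZ (V := R^o) (c := 2^-1) (ex_ddtP exK).
  have dA := has_ddt_areaG a0 VdX dq.
  rewrite presE surf -viscE.
  (* With [w = u] the two terms containing a time derivative inside the integral coincide up to
     sign, and so do the two convective terms. Only the rate of the kinetic energy survives. *)
  rewrite (_ : (fun x => frob (rhoh Om M c I t x *: u t x) (dt T u t x)) =
    (fun x => frob (rhoh Om M c I t x *: dt T u t x) (u t x))); last by apply/funext => x.
  rewrite (_ : (fun x => rhoh Om M c I t x * frob (grad (u t) x *m u t x) (u t x)) =
    (fun x => rhoh Om M c I t x * frob (u t x) (grad (u t) x *m u t x))); last first.
    by apply/funext => x; rewrite frobC.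
  rewrite (has_ddt_ddt t0T dK) => ten mom.
  have := has_ddtD (has_ddtD dK dE) (has_ddtZ (V := R^o) (c := gam c) dA).
  set e' := (X in has_ddt _ _ _ X) => De; exists e'.
    move: De; congr has_ddt; apply/funext => s; by rewrite /energy kinE.
  (* Adding the two identities cancels the elastic coupling [G (B - 1) : grad u], and [sd] is the
     single inequality that enters. *)
  rewrite /relaxation_dissipation /e' -[_ *: ddt _ _ _]/(_ * _) -[gam c *: _]/(_ * _).
  move: ten mom; rewrite -[_ *: ddt _ _ _]/(_ * _); lra.
- by move=> t t0T; exists (kap t); [exact: (sol_kap hsol t0T)|exact: (sol_curvature hsol t0T)].
- move=> n2 t t0T; have [a0 _ _] := hmesh t t0T; have t0T' : 0 <= t <= T by move: t0T => /andP[/ltW -> ->].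
  have [hS _ hnu] := hI t t0T'.
  have cid := sol_curvature hsol t0T; have Vk := sol_kap hsol t0T.
  move: {hsol hmesh hangle} hS hnu a0 cid Vk; case: n2 => n1.
  move: I {hI}; subst n => I' hS hnu a0 cid Vk.
  exact: (planar_weakly_equidistributed hS a0 hnu Vk cid).
Qed.
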